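(* Assume (A1)–(A4) and step sizes satisfying (i) $\sum_k\alpha_{ij,k}^2<\infty$ and $\sup_k\alpha_{ij,k+1}/\alpha_{ij,k}<\infty$ for all $(i,j)\in\mathcal{E}$; (ii) $\sum_k\beta_{i,k}^2<\infty$ and $\sup_k\beta_{i,k+1}/\beta_{i,k}<\infty$ for all $i$; (iii) $\sum_k z_k=\infty$ with $z_k=\min\{\alpha_{ij,k}/k^{\nu_{ij}},(i,j)\in\mathcal{E};\beta_{i,k},i\in\mathcal{V}\}$. Then for every $(i,j)\in\mathcal{E}$ the local average data rate of Algorithm SC satisfies $\mathtt{B}_{ij}(k)=O(k^{-\nu_{ij}})$ almost surely. Moreover, if $\nu_{ij}=0$ then $\mathtt{B}_{ij}(k)=1$ for all $k$ almost surely. Finally, if $\nu_{ij}>0$ and the step sizes are $\alpha_{ij,k}=\alpha_{ij,1}/k^{\gamma_{ij}}$, $\beta_{i,k}=\beta_{i,1}/k$ with $\alpha_{ij,1}=\alpha_{ji,1}>0$, $\beta_{i,1}>0$, $1/2<\gamma_{ij}=\gamma_{ji}\le1$, $\nu_{ij}+\gamma_{ij}\le1$ for all edges, and $a>h-1/2$ (with $h,a$ as defined in the context), then almost surely $\mathtt{B}_{ij}(k)\le\dfrac{\exp(\|\theta\|_1/b_{ij})}{(1-\nu_{ij})k^{\nu_{ij}}}+O\!\left(\dfrac{\sqrt{\ln k}}{k^{h-1/2+\nu_{ij}}}\right).$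
   Context: Network: undirected weighted graph with sensor set $\mathcal{V}=\{1,\dots,N\}$, symmetric nonnegative weights $a_{ij}=a_{ji}$, with $a_{ij}>0$ iff $(i,j)\in\mathcal{E}$; the edge set $\mathcal{E}$ is regarded as a set of ordered pairs that is symmetric ($(i,j)\in\mathcal{E}\iff(j,i)\in\mathcal{E}$), $M=|\mathcal{E}|/2$ is the number of undirected edges, and $\mathcal{N}_i=\{j:(i,j)\in\mathcal{E}\}$. The Laplacian is $\mathcal{L}=\mathcal{D}-\mathcal{A}$ with $\mathcal{A}=(a_{ij})$, $\mathcal{D}=\mathrm{diag}(\sum_{j\in\mathcal{N}_i}a_{ij})$; $\lambda_2(\mathcal{L})$ is its second smallest eigenvalue. Observations: unknown $\theta\in\mathbb{R}^n$; sensor $i$ observes $y_{i,k}=H_{i,k}\theta+w_{i,k}$, $k\ge1$, with deterministic $H_{i,k}\in\mathbb{R}^{m_i\times n}$ and noise $w_{i,k}\in\mathbb{R}^{m_i}$. Let $d_{i,k}$ ($i\in\mathcal{V},k\ge1$) be the dithering noises used below, $\mathcal{F}_k=\sigma(w_{i,t},d_{i,t}: i\in\mathcal{V},1\le t\le k)$ and $\mathcal{F}^w_k=\sigma(w_{i,t}: i\in\mathcal{V},1\le t\le k)$. Assumptions. (A1) There is $\bar H>0$ with $\|H_{i,k}\|\le\bar H$ for all $i,k$, and there are a positive integer $p$ and $\delta>0$ with $\frac1p\sum_{t=k}^{k+p-1}\sum_{i=1}^N H_{i,t}^\top H_{i,t}\ge\delta I_n$ for all $k\ge1$. (A2) $\{w_{i,k},\mathcal{F}_k\}$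 is a martingale difference sequence and $\sup_{i,k}\mathbb{E}[\|w_{i,k}\|^\rho\mid\mathcal{F}^w_{k-1}]<\infty$ a.s. for some $\rho>2$. (A3) The graph is connected, i.e. $\mathrm{rank}(\mathcal{L})=N-1$. (A4) The $d_{i,k}$ are i.i.d. with the Laplace distribution $\mathrm{Lap}(0,1)$ (density $f(x)=\frac12e^{-|x|}$, distribution function $F$), mutually independent over all $(i,k)$, and independent of all $w_{j,t}$. Algorithm SC. Inputs: deterministic initial estimates $\hat\theta_{i,0}\in\mathbb{R}^n$; event-triggered coefficients $\nu_{ij}=\nu_{ji}\ge0$; noise coefficients $b_{ij}=b_{ji}>0$; step sizes $\alpha_{ij,k}=\alpha_{ji,k}>0$ ($(i,j)\in\mathcal{E}$) and $\beta_{i,k}>0$. For $k=1,2,\dots$: let $\varphi_k\in\mathbb{R}^n$ be the $l$-th standard basis vector, where $k=nq+l$ with $q\in\mathbb{N}\cup\{0\}$, $l\in\{1,\dots,n\}$; set $x_{i,k}=\varphi_k^\top\hat\theta_{i,k-1}$; set $C_{ij,k}=\nu_{ij}b_{ij}\ln k$; set $s_{ij,k}=1$ if $x_{i,k}+b_{ij}d_{i,k}>0$ and $s_{ij,k}=-1$ otherwise. Sensor $i$ sends the one-bit message $s_{ij,k}$ to neighbor $j$ iff $|x_{i,k}+b_{ij}d_{i,k}|>C_{ij,k}$; sensor $i$ sets $\hat s_{ji,k}=s_{ji,k}$ if it received $s_{ji,k}$ from $j$, and $\hat s_{ji,k}=0$ otherwise. With $G_{ij,k}(x)=F((x-C_{ij,k})/b_{ij})-F((-x-C_{ij,k})/b_{ij})$,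 update $\check\theta_{i,k}=\hat\theta_{i,k-1}+\varphi_k\sum_{j\in\mathcal{N}_i}\alpha_{ij,k}a_{ij}(\hat s_{ji,k}-G_{ij,k}(x_{i,k}))$, $\hat\theta_{i,k}=\check\theta_{i,k}+\beta_{i,k}H_{i,k}^\top(y_{i,k}-H_{i,k}\hat\theta_{i,k-1})$. Data rates: $\zeta_{ij}(t)\in\{0,1\}$ is the number of bits sensor $i$ sends to $j$ at time $t$ (i.e. $1$ iff $|x_{i,t}+b_{ij}d_{i,t}|>C_{ij,t}$). Local average data rate $\mathtt{B}_{ij}(k)=\frac1k\sum_{t=1}^k\zeta_{ij}(t)$; global average data rate $\mathtt{B}(k)=\frac{1}{2kM}\sum_{(i,j)\in\mathcal{E}}\sum_{t=1}^k\zeta_{ij}(t)$. Constants for the polynomial step-size case: $h=\min_{(i,j)\in\mathcal{E}}(\nu_{ij}/2+\gamma_{ij})$, $\mathcal{E}'=\{(i,j)\in\mathcal{E}:\nu_{ij}+\gamma_{ij}=1\}$, $\underline\beta=\min_i\beta_{i,1}$, $m'=\min_{(i,j)\in\mathcal{E}'}\alpha_{ij,1}e^{-\|\theta\|_1/b_{ij}}/b_{ij}$, and $a=\delta\underline\beta/N$ if $\mathcal{E}'=\varnothing$, $a=\frac{\delta\lambda_2(\mathcal{L})\underline\beta m'}{2Nn\bar H^2\underline\beta+N\lambda_2(\mathcal{L})m'}$ otherwise. For random $X_k$ and positive $r_k$, ''$X_k=O(r_k)$ a.s.'' means $\sup_k|X_k|/r_k<\infty$ almost surely. *)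

(* Defs.v *)
From mathcomp Require Import all_boot all_order all_algebra.
From mathcomp Require Import all_classical all_reals all_analysis.

Set Implicit Arguments.
Unset Strict Implicit.
Unset Printing Implicit Defensive.

Import Order.TTheory GRing.Theory Num.Theory.
Local Open Scope classical_set_scope.
Local Open Scope ring_scope.

Section LinAlg.
Variable R : realType.

Definition vnorm (p : nat) (v : 'cV[R]_p) : R := Num.sqrt (\sum_(r < p) v r 0 ^+ 2).

Definition norm1 (p : nat) (v : 'cV[R]_p) : R := \sum_(r < p) `|v r 0|.

Definition opnorm_le (p q : nat) (M : 'M[R]_(p, q)) (c : R) : Prop :=
  forall x : 'cV[R]_q, vnorm (M *m x) <= c * vnorm x.

Definition loewner_ge_scalar (p : nat) (M : 'M[R]_p) (c : R) : Prop :=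
  forall x : 'cV[R]_p, c * (x^T *m x) 0 0 <= (x^T *m M *m x) 0 0.

Definition laplacian (N : nat) (a : 'I_N -> 'I_N -> R) : 'M[R]_N :=
  diag_mx (\row_i \sum_(j < N | 0 < a i j) a i j) - \matrix_(i, j) a i j.

(* The eigenvalues of a square matrix listed with multiplicity: a sequence s
   with char_poly A = prod_{x in s} (X - x) (chosen classically; for a real
   symmetric matrix such a sequence exists and is unique up to permutation). *)
Definition eigen_seq (N : nat) (A : 'M[R]_N) : seq R :=
  xget [::] [set s : seq R | char_poly A = \prod_(x <- s) ('X - x%:P)].

Definition lambda2 (N : nat) (A : 'M[R]_N) : R :=
  nth 0 (sort <=%R (eigen_seq A)) 1.

End LinAlg.

Definition laplace_cdf (R : realType) (x : R) : R :=
  if x < 0 then expR x / 2 else 1 - expR (- x) / 2.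

(* Time index k >= 1; index 0 carries the initial estimates.                 *)
Section AlgorithmSC.
Variables (R : realType) (N n : nat) (a : 'I_N -> 'I_N -> R) (m : 'I_N -> nat)
  (H : forall i : 'I_N, nat -> 'M[R]_(m i, n)) (theta : 'cV[R]_n)
  (th0 : 'I_N -> 'cV[R]_n) (nu b : 'I_N -> 'I_N -> R)
  (alpha : 'I_N -> 'I_N -> nat -> R) (beta : 'I_N -> nat -> R)
  (* realisations of the observation noises and of the dithers *)
  (w : forall i : 'I_N, nat -> 'cV[R]_(m i)) (dd : 'I_N -> nat -> R).

(* phi_k = e_l where k = n q + l, l in {1..n}, i.e. l - 1 = (k - 1) mod n *)
Definition phiSC (k : nat) : 'cV[R]_n := \col_(r < n) ((r : nat) == (k.-1 %% n)%N)%:R.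

Definition CSC (i j : 'I_N) (k : nat) : R := nu i j * b i j * ln (k%:R).

Definition GSC (i j : 'I_N) (k : nat) (x : R) : R :=
  laplace_cdf ((x - CSC i j k) / b i j) - laplace_cdf ((- x - CSC i j k) / b i j).

Definition xSC (th : 'cV[R]_n) (k : nat) : R := ((phiSC k)^T *m th) 0 0.

Definition sSC (prev : 'I_N -> 'cV[R]_n) (i j : 'I_N) (k : nat) : R :=
  if 0 < xSC (prev i) k + b i j * dd i k then 1 else -1.

Definition sendsSC (prev : 'I_N -> 'cV[R]_n) (i j : 'I_N) (k : nat) : bool :=
  CSC i j k < `| xSC (prev i) k + b i j * dd i k |.

Definition shatSC (prev : 'I_N -> 'cV[R]_n) (j i : 'I_N) (k : nat) : R :=
  if sendsSC prev j i k then sSC prev j i k else 0.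

Definition stepSC (k : nat) (prev : 'I_N -> 'cV[R]_n) (i : 'I_N) : 'cV[R]_n :=
  let chk := prev i + (\sum_(j < N | 0 < a i j)
         alpha i j k * a i j * (shatSC prev j i k - GSC i j k (xSC (prev i) k))) *: phiSC k in
  let y := H i k *m theta + w i k in
  chk + beta i k *: ((H i k)^T *m (y - H i k *m prev i)).

Fixpoint estSC (k : nat) : 'I_N -> 'cV[R]_n :=
  match k with
  | 0 => th0
  | k'.+1 => fun i => stepSC k'.+1 (estSC k') i
  end.

Definition zetaSC (i j : 'I_N) (t : nat) : R := (sendsSC (estSC t.-1) i j t : nat)%:R.

Definition BSC (i j : 'I_N) (k : nat) : R := k%:R^-1 * \sum_(1 <= t < k.+1) zetaSC i j t.

End AlgorithmSC.

Section Prob.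
Context {d : measure_display} {T : measurableType d} {R : realType}.

Definition sigma_of (fs : set (T -> R)) : set (set T) :=
  <<s [set A | exists f, fs f /\ exists B : set R, measurable B /\ A = f @^-1` B] >>.

Definition measurable_wrt (G : set (set T)) (f : T -> R) : Prop :=
  forall B : set R, measurable B -> G (f @^-1` B).

Definition mutually_independent (mu : probability T R) (I : eqType)
    (G : I -> set (set T)) : Prop :=
  forall (J : seq I) (A : I -> set T), uniq J -> (forall j, j \in J -> G j (A j)) ->
    mu (\big[setI/setT]_(j <- J) A j) = (\prod_(j <- J) mu (A j))%E.

Definition cond_exp_zero (mu : probability T R) (G : set (set T)) (X : T -> R) : Prop :=
  mu.-integrable setT (EFin \o X) /\
  forall A, G A -> (\int[mu]_(x in A) (X x)%:E = 0)%E.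

Definition is_cond_exp_nonneg (mu : probability T R) (G : set (set T)) (X Y : T -> R) : Prop :=
  measurable_wrt G Y /\ (forall x, 0 <= Y x) /\
  forall A, G A -> (\int[mu]_(x in A) (Y x)%:E = \int[mu]_(x in A) (X x)%:E)%E.

End Prob.

Section Filtrations.
Context {disp : measure_display} {T : measurableType disp} {R : realType}.
Variables (N : nat) (m : 'I_N -> nat)
  (W : forall i : 'I_N, nat -> T -> 'cV[R]_(m i)) (D : 'I_N -> nat -> T -> R).

Definition filtF (k : nat) : set (set T) :=
  sigma_of [set f | (exists i t r, (1 <= t <= k)%N /\ f = fun om => W i t om r 0) \/
                    (exists i t, (1 <= t <= k)%N /\ f = D i t)].

Definition filtFw (k : nat) : set (set T) :=
  sigma_of [set f | exists i t r, (1 <= t <= k)%N /\ f = fun om => W i t om r 0].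

Definition sigmaWall : set (set T) :=
  sigma_of [set f | exists i t r, (1 <= t)%N /\ f = fun om => W i t om r 0].

End Filtrations.

Section Constants.
Variables (R : realType) (N : nat) (a nu b gamma : 'I_N -> 'I_N -> R)
  (alpha : 'I_N -> 'I_N -> nat -> R) (beta : 'I_N -> nat -> R).
Local Open Scope ereal_scope.

Definition zSC (k : nat) : \bar R :=
  Order.min
    (\big[Order.min/+oo]_(i < N) \big[Order.min/+oo]_(j < N | (0 < a i j)%R)
        (alpha i j k / (k%:R `^ nu i j))%:E)
    (\big[Order.min/+oo]_(i < N) (beta i k)%:E).

Definition hSC : R :=
  fine (\big[Order.min/+oo]_(i < N) \big[Order.min/+oo]_(j < N | (0 < a i j)%R)
          ((nu i j / 2 + gamma i j)%:E)).

Definition EprimeSC (i j : 'I_N) : bool := (0 < a i j)%R && (nu i j + gamma i j == 1)%R.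

Definition beta_lowSC : R := fine (\big[Order.min/+oo]_(i < N) (beta i 1)%:E).

Definition mprimeSC (n : nat) (theta : 'cV[R]_n) : R :=
  fine (\big[Order.min/+oo]_(i < N) \big[Order.min/+oo]_(j < N | EprimeSC i j)
          ((alpha i j 1 * expR (- norm1 theta / b i j) / b i j)%R)%:E).

Local Close Scope ereal_scope.

Definition aSC (n : nat) (theta : 'cV[R]_n) (delta Hbar : R) : R :=
  if [exists i, exists j, EprimeSC i j] then
    let l2 := lambda2 (laplacian a) in
    let bl := beta_lowSC in
    let mp := mprimeSC theta in
    (delta * l2 * bl * mp) / (2 * N%:R * n%:R * Hbar ^+ 2 * bl + N%:R * l2 * mp)
  else delta * beta_lowSC / N%:R.

End Constants.

(* Main.v *)
(* Let V_k be the sum over the sensors of |theta_{i,k} - theta|^2. Given the past,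
   the dither makes the received bit an unbiased observation of G(x_j), and a
   message on (i,j) at time k is sent with probability
   F((x - C)/b) + F((- x - C)/b) <= cosh(x / b) k^(- nu). Hence
   E[V_k | past] <= V_{k-1} - drift + noise with a nonnegative drift, the sum of
   alpha a (x_i - x_j)(G(x_i) - G(x_j)) and 2 beta |H (theta_i - theta)|^2.

   All moments are taken on the events where the conditional noise moments are at
   most K and V_s <= ell_s so far. Charging an exit from such an event to the
   descent inequality bounds the total exit probability, so V is almost surely
   bounded. An exponential supermartingale then compares the number of messages
   with its compensator up to sqrt(ln k * k^(1 - nu)), which gives the rate
   k^(- nu); for nu = 0 the sending probability is 1. That nu < 1 follows from
   conditions (i) and (iii) by AM-GM.

   For polynomial steps the drift, averaged over a window of length p + n,
   dominates r V / k with r the coercivity rate: excitation controls the mean of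
   the estimates and the spectral gap of the Laplacian their disagreement.
   Multiplying the descent by k^kappa and summing by parts yields
   sum k^(kappa - 1) E V_k < oo for every kappa <= h - 1/2 with kappa < r. With
   kappa = 0 and a crude slope bound this shows that V becomes small infinitely
   often, hence V -> 0 by the exit argument; then |x| <= |theta|_1 + o(1), the
   slope of G improves until r >= a, and kappa = h - 1/2 is admissible. Since
   cosh((theta_l + u) / b) <= exp(|theta_l| / b) + O(u^2), summability of
   k^(h - 3/2) V_k controls the excess of the compensator over
   exp(|theta|_1 / b) k^(1 - nu) / (1 - nu). *)

(* The conditional noise moments are bounded only path by path, so V may fail to be integrable.
   Hence every expectation is cut by events that belong to the past and decrease in time; for some
   pair of integer levels almost every path stays in all of them. The probabilistic input is then
   the orthogonality of bounded past-measurable functions to centred noise, monotone convergence,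
   and covers of small total mass. The exponent h measures the consensus noise: a symbol is received
   with probability of order k^(-nu), so its squared effect is of order alpha^2 k^(-nu) = k^(-2
   (gamma + nu / 2)). The constant a is a lower bound for the coercivity rate at half the slope
   constant m': near theta the slope of G loses at most a factor 2, and the expansion of the squared
   error gives a factor 2 back. The number [lambda2] is read off a classically chosen list with
   default entries, so it enters through two inequalities only: it is nonnegative and at most the
   minimal Rayleigh quotient. Its positivity follows from a > h - 1/2 > 0. *)
Require Import Defs.
From mathcomp Require Import all_boot all_order all_algebra.
From mathcomp Require Import all_classical all_reals all_analysis.
From mathcomp Require Import measurable_realfun ring lra zify.
Import Order.TTheory GRing.Theory Num.Theory.
Local Open Scope classical_set_scope.
Local Open Scope ring_scope.

Set Implicit Arguments.
Unset Strict Implicit.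
Unset Printing Implicit Defensive.

(** * Real analysis *)

Section RealPowers.
Context {R : realType}.
Implicit Types (x y u s k e : R) (t n : nat).

Lemma powRD_gt0 x y u : 0 < x -> x `^ (y + u) = x `^ y * x `^ u.
Proof. by move=> x0; rewrite powRD// (gt_eqF x0) implybT. Qed.

Lemma powRB1 x y : 0 < x -> x `^ (y - 1) = x `^ y / x.
Proof. by move=> x0; rewrite powRD_gt0// powR_inv1 ?ltW. Qed.

(** Concavity of ln: the tangent bound ln z <= z - 1 is taken at z = (1 + x) / (1 + k x) with weight
    k and at z = 1 / (1 + k x) with weight 1 - k; the two right sides cancel. *)
Lemma powR_bernoulli k x : 0 <= k <= 1 -> -1 < x -> (1 + x) `^ k <= 1 + k * x.
Proof.
move=> /andP[k0 k1] x1.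
have x0 : 0 < 1 + x by lra.
have u0 : 0 < 1 + k * x.
  have [->|k0'] := eqVneq k 0; first by rewrite mul0r; lra.
  have : 0 < k * (1 + x) by rewrite mulr_gt0// lt_def k0'.
  by lra.
rewrite /powR gt_eqF// -(@lnK _ (1 + k * x)) ?posrE// ler_expR.
have L (z : R) : 0 < z -> ln z <= z - 1.
  by move=> z0; have := @le_ln1Dx R (z - 1); rewrite (_ : 1 + (z - 1) = z); [apply; lra|lra].
have := L _ (divr_gt0 ltr01 u0); have := L _ (divr_gt0 x0 u0).
rewrite !ln_div ?posrE// ln1 sub0r => A B.
have : k * (ln (1 + x) - ln (1 + k * x)) + (1 - k) * - ln (1 + k * x)
    <= k * ((1 + x) / (1 + k * x) - 1) + (1 - k) * (1 / (1 + k * x) - 1).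
  by apply: lerD; apply: ler_wpM2l => //; lra.
have -> : k * ((1 + x) / (1 + k * x) - 1) + (1 - k) * (1 / (1 + k * x) - 1) = 0.
  by field; rewrite gt_eqF.
lra.
Qed.

Lemma powR_succ_diff k t : 0 <= k <= 1 -> (0 < t)%N ->
  t.+1%:R `^ k - t%:R `^ k <= k * t%:R `^ (k - 1).
Proof.
move=> k01 t0; have tp : 0 < t%:R :> R by rewrite ltr0n.
have -> : t.+1%:R = t%:R * (1 + t%:R^-1) :> R.
  by rewrite mulrDr mulr1 divff ?gt_eqF// -natr1.
have i0 : 0 < t%:R^-1 :> R by rewrite invr_gt0.
have j0 : 0 <= 1 + t%:R^-1 :> R by lra.
rewrite (powRM k (ltW tp) j0) powRB1//.
have i1 : -1 < t%:R^-1 :> R by lra.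
have p0 := powR_gt0 k tp.
have := powR_bernoulli k01 i1.
move=> /(ler_wpM2l (ltW p0)); lra.
Qed.

Lemma powR_pred_diff k t : 0 <= k <= 1 -> (0 < t)%N ->
  k * t%:R `^ (k - 1) <= t%:R `^ k - t.-1%:R `^ k.
Proof.
(* At t = 1 the base t - 1 is 0, outside the range of [powR_bernoulli]; [powR] gives 0 to the power
   0 the value 1, hence the separate case k = 0. *)
case: t => // t k01 _ /=; have [->|t0] := posnP t.
  rewrite !powR1 mulr1; case: (eqVneq k 0) => [->|k0]; first by rewrite powRr0 subrr.
  by rewrite powR0// subr0; case/andP: k01.
have tp : 0 < t.+1%:R :> R by rewrite ltr0n.
have -> : t%:R = t.+1%:R * (1 - t.+1%:R^-1) :> R.
  by rewrite mulrBr mulr1 divff ?gt_eqF// -natr1 addrK.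
have i0 : 0 < t.+1%:R^-1 :> R by rewrite invr_gt0.
have i1 : t.+1%:R^-1 < 1 :> R by rewrite invf_lt1// ltr1n.
have j0 : 0 <= 1 - t.+1%:R^-1 :> R by rewrite subr_ge0 ltW.
rewrite (powRM k (ltW tp) j0) powRB1//.
have i2 : -1 < - t.+1%:R^-1 :> R by rewrite ltrN2.
have p0 := powR_gt0 k tp.
have := powR_bernoulli k01 i2.
move=> /(ler_wpM2l (ltW p0)); set z := _^-1; set y := _ `^ k; set w := _ `^ k; rewrite -/z => Q.
rewrite mulrA; lra.
Qed.

(** Telescoping with [powR_pred_diff]. The factor 1 / (1 - k) comes without an additive constant,
    which lets it become the leading constant of the final data rate. *)
Lemma sum_powRN_le k n : 0 <= k < 1 ->
  \sum_(1 <= t < n.+1) t%:R `^ (- k) <= n%:R `^ (1 - k) / (1 - k).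
Proof.
move=> /andP[k0 k1]; rewrite ler_pdivlMr ?subr_gt0//.
elim: n => [|n IH]; first by rewrite big_geq// mul0r powR_ge0.
rewrite big_nat_recr//= mulrDl.
have k01 : 0 <= 1 - k <= 1 by lra.
have /= := @powR_pred_diff (1 - k) n.+1 k01 isT; have -> : 1 - k - 1 = - k by ring.
lra.
Qed.

Lemma sum_powR_bounded e n : 0 < e ->
  \sum_(1 <= t < n.+1) t%:R `^ (- (1 + e)) <= 1 + e^-1.
Proof.
move=> e0.
(* The induction closes only if the tail e^-1 (m + 1)^(-e) of the integral comparison is subtracted
   from the bound. *)
suff H m : \sum_(1 <= t < m.+2) t%:R `^ (- (1 + e)) <= 1 + e^-1 - e^-1 * m.+1%:R `^ (- e).
  case: n => [|n]; first by rewrite big_geq// addr_ge0// invr_ge0 ltW.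
  by apply: (le_trans (H n)); rewrite gerBl// mulr_ge0 ?powR_ge0// invr_ge0 ltW.
elim: m => [|m IH].
  by rewrite big_nat1 !powR1 mulr1 addrK.
rewrite big_nat_recr//=.
have tp : 0 < m.+2%:R :> R by rewrite ltr0n.
have mp : 0 < m.+1%:R :> R by rewrite ltr0n.
suff : m.+2%:R `^ (- (1 + e)) <= e^-1 * (m.+1%:R `^ (- e) - m.+2%:R `^ (- e)) by lra.
rewrite mulrC ler_pdivlMr//.
have -> : - (1 + e) = - e - 1 by ring.
rewrite powRB1//.
have E : m.+1%:R `^ (- e) = m.+2%:R `^ (-e) * expR (- e * ln (1 - m.+2%:R^-1)).
  have -> : m.+1%:R = m.+2%:R * (1 - m.+2%:R^-1) :> R.
    by rewrite mulrBr mulr1 divff ?gt_eqF// -(natr1 m.+1) addrK.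
  have i1 : m.+2%:R^-1 < 1 :> R by rewrite invf_lt1// ltr1n.
  rewrite powRM ?ltW// ?subr_gt0//; congr (_ * _).
  by rewrite /powR gt_eqF ?subr_gt0.
rewrite E -mulrA -[X in _ <= _ - X]mulr1 -mulrBr ler_wpM2l ?powR_ge0//.
have i1 : m.+2%:R^-1 < 1 :> R by rewrite invf_lt1// ltr1n.
have l : ln (1 - m.+2%:R^-1) <= - m.+2%:R^-1 :> R by apply: le_ln1Dx; rewrite ltrN2.
have := ler_wpM2l (ltW e0) l.
have := expR_ge1Dx (- e * ln (1 - m.+2%:R^-1)).
set z := m.+2%:R^-1; set w := ln _; set y := expR _.
move=> A1 A2; rewrite mulrC; lra.
Qed.

Lemma ln_le_powR e x : 0 < e -> 1 <= x -> ln x <= x `^ e / e.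
Proof.
move=> e0 x1; rewrite ler_pdivlMr// mulrC -ln_powR.
by apply/ltW/ln_sublinear/powR_gt0; lra.
Qed.

Lemma powRN_le1 t e : 0 <= e -> (0 < t)%N -> t%:R `^ (- e) <= 1.
Proof.
move=> e0 t0; rewrite -[leRHS](powRr0 (t%:R)) ler_powR ?oppr_le0//.
by rewrite ler1n.
Qed.

Lemma expR_quad u : expR u <= 1 + u + u ^+ 2 * expR `|u|.
Proof.
have e1 : expR u - 1 <= u * expR u.
  have := expR_ge1Dx (- u); move=> /(ler_wpM2l (expR_ge0 u)).
  by rewrite expRxMexpNx_1; lra.
have e2 : expR u - 1 <= u * (expR u - 1) + u by lra.
case: (leP 0 u) => u0.
  rewrite ger0_norm//; have : u * (expR u - 1) <= u * (u * expR u) by rewrite ler_wpM2l.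
  rewrite expr2; lra.
rewrite ltr0_norm//; have := expR_ge1Dx u => e3.
have e4 : 1 <= expR (- u) by rewrite -[leLHS]expR0 ler_expR; lra.
have : u * (expR u - 1) <= u * u by nra.
have : u ^+ 2 <= u ^+ 2 * expR (- u) by rewrite ler_peMr ?sqr_ge0.
rewrite expr2; lra.
Qed.

(** The first-order term sinh(s) u is at most sinh|s| (1 + u^2), and cosh s + sinh|s| = exp|s|.
    Giving up cosh s for exp|s| therefore removes the linear term, and the remaining error is
    quadratic in u, so that V itself and not its square root controls it. *)
Lemma cosh_shift_le s u B : `|u| <= B ->
  (expR (s + u) + expR (- (s + u))) / 2 <=
  expR `|s| + expR `|s| * (1 + expR B) * u ^+ 2.
Proof.
move=> uB; have M0 := expR_ge0 B.
have q1 : expR u <= 1 + u + u ^+ 2 * expR B.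
  by apply: (le_trans (expR_quad u)); rewrite lerD2l ler_wpM2l ?sqr_ge0// ler_expR.
have q2 : expR (- u) <= 1 - u + u ^+ 2 * expR B.
  apply: (le_trans (expR_quad (- u))); rewrite lerD2l sqrrN normrN.
  by rewrite ler_wpM2l ?sqr_ge0// ler_expR.
rewrite opprD !expRD.
have es := expR_ge0 s; have ens := expR_ge0 (- s).
have u2 := sqr_ge0 u; have u2' := sqr_ge0 (u - 1); have u2'' := sqr_ge0 (u + 1).
have a1 : expR s * expR u <= expR s * (1 + u + u ^+ 2 * expR B) by rewrite ler_wpM2l.
have a2 : expR (- s) * expR (- u) <= expR (- s) * (1 - u + u ^+ 2 * expR B).
  by rewrite ler_wpM2l.
rewrite ler_pdivrMr//; apply: (le_trans (lerD a1 a2)).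
have K0 : 0 <= u ^+ 2 * expR B by rewrite mulr_ge0.
case: (leP 0 s) => s0.
  rewrite (ger0_norm s0); have ss : expR (- s) <= expR s by rewrite ler_expR; lra.
  have : (expR s - expR (- s)) * u <= (expR s - expR (- s)) * (1 + u ^+ 2).
    by rewrite ler_wpM2l ?subr_ge0//; lra.
  have : (expR s + expR (- s)) * (u ^+ 2 * expR B) <= (expR s + expR s) * (u ^+ 2 * expR B).
    by rewrite ler_wpM2r// lerD2l.
  have : 0 <= expR (- s) * u ^+ 2 by rewrite mulr_ge0.
  have : 0 <= expR s * u ^+ 2 by rewrite mulr_ge0.
  lra.
rewrite (ltr0_norm s0); have ss : expR s <= expR (- s) by rewrite ler_expR; lra.
have : (expR (- s) - expR s) * (- u) <= (expR (- s) - expR s) * (1 + u ^+ 2).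
  by rewrite ler_wpM2l ?subr_ge0//; lra.
have : (expR s + expR (- s)) * (u ^+ 2 * expR B) <= (expR (- s) + expR (- s)) * (u ^+ 2 * expR B).
  by rewrite ler_wpM2r// lerD2r.
have : 0 <= expR (- s) * u ^+ 2 by rewrite mulr_ge0.
have : 0 <= expR s * u ^+ 2 by rewrite mulr_ge0.
lra.
Qed.

End RealPowers.

(** * The Laplace distribution function *)

Section LaplaceCdf.
Context {R : realType}.
Implicit Types x y u : R.
Local Notation F := (@laplace_cdf R).

Lemma laplace_cdf_ge0 u : 0 <= F u.
Proof.
rewrite /laplace_cdf; case: ifPn => [_|]; first by rewrite divr_ge0 ?expR_ge0.
rewrite -leNgt => u0; have : expR (- u) <= 1 by rewrite expR_le1; lra.
lra.
Qed.

Lemma laplace_cdf_le_expR u : F u <= expR u / 2.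
Proof.
rewrite /laplace_cdf; case: ifPn => // _.
suff : 2 <= expR u + expR (- u) by lra.
rewrite expRN; have u0 := expR_gt0 u.
suff : 0 <= (expR u - 1) ^+ 2 / expR u.
  have -> : (expR u - 1) ^+ 2 / expR u = expR u + (expR u)^-1 - 2 by field; rewrite gt_eqF.
  lra.
by rewrite divr_ge0 ?sqr_ge0// ltW.
Qed.

Lemma laplace_cdfN u : F (- u) = 1 - F u.
Proof.
rewrite /laplace_cdf oppr_lt0; case: (ltgtP 0 u) => [u0|u0|<-].
- by ring.
- by rewrite opprK.
- by rewrite !oppr0 expR0; lra.
Qed.

Lemma laplace_cdf_le1 u : F u <= 1.
Proof. by have := laplace_cdf_ge0 (- u); rewrite laplace_cdfN; lra. Qed.

Let diff_neg u v : v <= u -> u <= 0 ->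
  (u - v) * (expR v / 2) <= F u - F v <= (u - v) / 2.
Proof.
move=> vu u0; have E z : z <= 0 -> F z = expR z / 2.
  move=> z0; rewrite /laplace_cdf; case: ifPn => //; rewrite -leNgt => z1.
  have -> : z = 0 by lra.
  by rewrite oppr0 expR0; lra.
rewrite !E//; last lra.
have e1 := expR_ge1Dx (u - v); have e2 := expR_ge1Dx (v - u).
have E1 : expR u = expR v * expR (u - v) by rewrite -expRD; congr expR; ring.
have E2 : expR v = expR u * expR (v - u) by rewrite -expRD; congr expR; ring.
have u1 : expR u <= 1 by rewrite expR_le1.
have v0 := expR_gt0 v; have up := expR_gt0 u.
apply/andP; split; nra.
Qed.

(** The Laplace density is at least exp(-B) / 2 on [-B, B]. Negative arguments are explicit,
    positive ones follow by the reflection F(-u) = 1 - F(u), and an interval around 0 is split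
    there. *)
Lemma laplace_cdf_diff u v B : v <= u -> `|u| <= B -> `|v| <= B ->
  (u - v) * (expR (- B) / 2) <= F u - F v.
Proof.
rewrite !ler_norml => vu /andP[uB1 uB2] /andP[vB1 vB2].
have N w z : v <= w -> z <= u -> w <= z -> z <= 0 ->
    (z - w) * (expR (- B) / 2) <= F z - F w.
  move=> vw zu wz z0; have /andP[+ _] := diff_neg wz z0; apply: le_trans.
  by rewrite ler_wpM2l ?subr_ge0// ler_pM2r// ler_expR; lra.
have P w z : v <= w -> z <= u -> w <= z -> 0 <= w ->
    (z - w) * (expR (- B) / 2) <= F z - F w.
  move=> vw zu wz z0; have wz' : - z <= - w by lra.
  have w0 : - w <= 0 by lra.
  have /andP[+ _] := diff_neg wz' w0.
  rewrite !laplace_cdfN => A.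
  have : (z - w) * (expR (- B) / 2) <= (z - w) * (expR (- z) / 2).
    by rewrite ler_wpM2l ?subr_ge0// ler_pM2r// ler_expR; lra.
  lra.
case: (leP u 0) => u0; first exact: N.
case: (leP 0 v) => v0; first exact: P.
have := N v 0 (lexx _) (ltW u0) (ltW v0) (lexx _).
have := P 0 u (ltW v0) (lexx _) (ltW u0) (lexx _).
lra.
Qed.

Lemma laplace_cdf_nd u v : v <= u -> F v <= F u.
Proof.
move=> vu; have := @laplace_cdf_diff u v (`|u| + `|v|) vu.
rewrite lerDl lerDr !normr_ge0 => /(_ isT isT).
have : 0 <= (u - v) * (expR (- (`|u| + `|v|)) / 2).
  by rewrite mulr_ge0 ?subr_ge0// divr_ge0 ?expR_ge0.
lra.
Qed.

Lemma laplace_cdf_lip u v : v <= u -> F u - F v <= u - v.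
Proof.
move=> vu.
have N w z : w <= z -> z <= 0 -> F z - F w <= z - w.
  by move=> wz z0; have /andP[_] := diff_neg wz z0; lra.
have P w z : w <= z -> 0 <= w -> F z - F w <= z - w.
  move=> wz w0; have wz' : - z <= - w by lra.
  have w0' : - w <= 0 by lra.
  by have := N _ _ wz' w0'; rewrite !laplace_cdfN; lra.
case: (leP u 0) => u0; first exact: N.
case: (leP 0 v) => v0; first exact: P.
have := N v 0 (ltW v0) (lexx _); have := P 0 u (ltW u0) (lexx _); lra.
Qed.

Lemma measurable_laplace_cdf : measurable_fun setT F.
Proof.
apply: nondecreasing_measurable => // x y; exact: laplace_cdf_nd.
Qed.

End LaplaceCdf.

(** * Nonnegative recursions and bounded partial sums *)

Section BoundedSums.
Context {R : realType}.

(** Discrete Gronwall argument with 1 + c <= exp c. The right side does not depend on L, so with e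
    the exit probabilities from level L their total is of order 1 / L. *)
Lemma exit_sum_bound (v e c r : nat -> R) L Cc Cr : (forall k, 0 <= v k) -> (forall k, 0 <= e k) ->
  (forall k, 0 <= c k) -> (forall k, 0 <= r k) -> 0 <= L ->
  (forall k, v k.+1 + L * e k <= (1 + c k) * v k + r k) ->
  (forall k, \sum_(0 <= l < k) c l <= Cc) -> (forall k, \sum_(0 <= l < k) r l <= Cr) ->
  forall k, L * \sum_(0 <= l < k) e l <= expR Cc * (v 0%N + Cr).
Proof.
move=> v0 e0 c0 r0 L0 rec cC rC.
have main k : v k + L * \sum_(0 <= l < k) e l <=
    expR (\sum_(0 <= l < k) c l) * (v 0%N + \sum_(0 <= l < k) r l).
  elim: k => [|k IH]; first by rewrite !big_geq// mulr0 !addr0 expR0 mul1r.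
  rewrite !big_nat_recr//= expRD.
  have S0 : 0 <= L * \sum_(0 <= l < k) e l by rewrite mulr_ge0// sumr_ge0.
  have R0 : 0 <= v 0%N + \sum_(0 <= l < k) r l by rewrite addr_ge0// sumr_ge0.
  have ec1 : 1 <= expR (\sum_(0 <= l < k) c l) by rewrite -[leLHS]expR0 ler_expR sumr_ge0.
  have ec2 := expR_ge1Dx (c k).
  have step := rec k.
  move: (\sum_(0 <= l < k) e l) (\sum_(0 <= l < k) r l) (expR (\sum_(0 <= l < k) c l)) (expR (c k))
    IH S0 R0 ec1 ec2 step => Se Sr Ec ek IH S0 R0 ec1 ec2 step.
  apply: (@le_trans _ _ ((1 + c k) * (v k + L * Se) + r k)).
    have : 0 <= c k * (L * Se) by rewrite mulr_ge0.
    lra.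
  apply: (@le_trans _ _ ((1 + c k) * (Ec * (v 0%N + Sr)) + r k)).
    by rewrite lerD2r ler_wpM2l// addr_ge0.
  rewrite (_ : Ec * ek * (v 0%N + (Sr + r k)) = ek * (Ec * (v 0%N + Sr)) + Ec * ek * r k); last by ring.
  apply: lerD.
    by rewrite ler_wpM2r// mulr_ge0//; lra.
  rewrite -[leLHS]mul1r ler_wpM2r//.
  have : 1 * 1 <= Ec * ek by apply: ler_pM => //; have := c0 k; lra.
  by rewrite mulr1.
move=> k; have := main k; have := v0 k; have := expR_gt0 Cc.
have : expR (\sum_(0 <= l < k) c l) * (v 0%N + \sum_(0 <= l < k) r l) <= expR Cc * (v 0%N + Cr).
  apply: ler_pM; rewrite ?expR_ge0 ?ler_expR ?cC// ?lerD2l ?rC//.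
  by rewrite addr_ge0// sumr_ge0.
lra.
Qed.

Definition bsum (u : nat -> R) := exists C : R, forall m, \sum_(0 <= k < m) u k <= C.

Lemma bsumD u v : bsum u -> bsum v -> bsum (fun k => u k + v k).
Proof.
move=> [C uC] [C' vC]; exists (C + C') => l; rewrite big_split/=; exact: lerD.
Qed.

Lemma bsumZ c u : 0 <= c -> bsum u -> bsum (fun k => c * u k).
Proof. by move=> c0 [C uC]; exists (c * C) => l; rewrite -mulr_sumr ler_wpM2l. Qed.

Lemma bsum_le u v : (forall k, u k <= v k) -> bsum v -> bsum u.
Proof. by move=> uv [C vC]; exists C => l; apply: le_trans (vC l); exact: ler_sum. Qed.

Lemma bsum0 : bsum (fun=> 0).
Proof. by exists 0 => l; rewrite big1. Qed.

Lemma bsum_sum (I : Type) (s : seq I) (F : I -> nat -> R) :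
  (forall i, bsum (F i)) -> bsum (fun k => \sum_(i <- s) F i k).
Proof.
move=> bF; elim: s => [|i s IH].
  by apply: bsum_le bsum0 => k; rewrite big_nil.
by apply: bsum_le (bsumD (bF i) IH) => k; rewrite big_cons.
Qed.

Lemma eseries_bsum (u : nat -> R) : (forall k, 0 <= u k) ->
  (\sum_(1 <= k <oo) (u k)%:E < +oo)%E -> bsum (fun k => u k.+1).
Proof.
move=> u0 usum; exists (fine (\sum_(1 <= k <oo) (u k)%:E)%E) => l.
have fin : (\sum_(1 <= k <oo) (u k)%:E)%E \is a fin_num.
  by rewrite ge0_fin_numE// nneseries_ge0// => k _ _; rewrite lee_fin.
rewrite -lee_fin fineK//.
have -> : \sum_(0 <= k < l) u k.+1 = \sum_(1 <= k < l.+1) u k by rewrite big_add1.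
by rewrite -sumEFin; apply: nneseries_lim_ge => k _ _; rewrite lee_fin.
Qed.

End BoundedSums.

(** * Algebraic connectivity *)

Section AlgebraicConnectivity.
Import numFieldNormedType.Exports.
Context {R : realType} (N : nat) (a : 'I_N -> 'I_N -> R).
Hypothesis a_ge0 : forall i j, 0 <= a i j.
Hypothesis a_sym : forall i j, a i j = a j i.
Implicit Types x y : 'rV[R]_N.

Let dirichlet x := \sum_i \sum_j a i j * (x 0 i - x 0 j) ^+ 2.
Let sumsq x := \sum_i x 0 i ^+ 2.
Let L := laplacian a.

Lemma mul_laplacianE x j : (x *m L) 0 j = \sum_i a j i * (x 0 j - x 0 i).
Proof.
rewrite mxE /L /laplacian.
under eq_bigr do rewrite !mxE mulrBr.
rewrite sumrB [X in X - _](bigD1 j)//= eqxx mulr1n [X in _ + X - _]big1 ?addr0; last first.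
  by move=> i ij; rewrite (negbTE ij) mulr0n mulr0.
have -> : \sum_(j0 < N | 0 < a j j0) a j j0 = \sum_i a j i.
  rewrite [RHS](bigID (fun i => 0 < a j i))/= [X in _ = _ + X]big1 ?addr0// => i.
  by rewrite -leNgt => ai; apply/eqP; rewrite eq_le ai a_ge0.
rewrite mulr_sumr -sumrB; apply: eq_bigr => i _.
by rewrite (a_sym i j); ring.
Qed.

(** Symmetrisation in i and j. The polarised form serves the first variation of the Rayleigh
    quotient; a constant y shows that the entries of x L sum to 0. *)
Lemma laplacian_form x y :
  \sum_j (x *m L) 0 j * y 0 j =
  (\sum_i \sum_j a i j * ((x 0 i - x 0 j) * (y 0 i - y 0 j))) / 2.
Proof.
have E1 : \sum_j (x *m L) 0 j * y 0 j = \sum_i \sum_j a i j * ((x 0 i - x 0 j) * y 0 i).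
  apply: eq_bigr => j _; rewrite mul_laplacianE mulr_suml.
  by apply: eq_bigr => i _; rewrite mulrA.
have E2 : \sum_j (x *m L) 0 j * y 0 j = \sum_i \sum_j a i j * - ((x 0 i - x 0 j) * y 0 j).
  rewrite E1 exchange_big; apply: eq_bigr => i _; apply: eq_bigr => j _.
  by rewrite (a_sym j i); ring.
apply: (mulIf (_ : 2 != 0)); first by rewrite pnatr_eq0.
rewrite divfK ?pnatr_eq0// mulr_natr mulr2n {1}E1 E2 -big_split/=.
by apply: eq_bigr => i _; rewrite -big_split/=; apply: eq_bigr => j _; ring.
Qed.

Let dirichletE x : \sum_j (x *m L) 0 j * x 0 j = dirichlet x / 2.
Proof. by rewrite laplacian_form. Qed.

Let dirichlet_ge0 x : 0 <= dirichlet x.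
Proof. by do 2 (apply: sumr_ge0 => ? _); rewrite mulr_ge0 ?sqr_ge0. Qed.

Let sumsq_eq0 x : sumsq x = 0 -> x = 0.
Proof.
move=> /eqP; rewrite psumr_eq0; last by move=> i _; exact: sqr_ge0.
move=> /allP H; apply/rowP => i; rewrite mxE.
by have := H i (mem_index_enum _); rewrite sqrf_eq0 => /eqP.
Qed.

Let sumsq_ge0 x : 0 <= sumsq x.
Proof. by apply: sumr_ge0 => i _; exact: sqr_ge0. Qed.

Let continuous_sumR (I : Type) (r : seq I) (T : topologicalType) (f : I -> T -> R) :
  (forall i, continuous (f i)) -> continuous (fun z => \sum_(i <- r) f i z).
Proof. by move=> cf; apply: continuous_big => //; exact: add_continuous. Qed.

Let coord_cont i : continuous (fun x : 'rV[R]_N => x 0 i).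
Proof. exact: coord_continuous. Qed.

Let continuous_sqr (T : topologicalType) (f : T -> R) :
  continuous f -> continuous (fun z => f z ^+ 2).
Proof.
move=> cf; rewrite (_ : (fun z => f z ^+ 2) = (fun z => f z * f z)); last first.
  by apply/funext => z; rewrite expr2.
by move=> z; apply: (@cvgM _ _ _ _ f f); exact: cf.
Qed.

Let dirichlet_cont : continuous dirichlet.
Proof.
apply: continuous_sumR => i; apply: continuous_sumR => j x.
have c1 : continuous (fun _ : 'rV[R]_N => a i j) by exact: cst_continuous.
have c2 : continuous (fun x : 'rV[R]_N => (x 0 i - x 0 j) ^+ 2).
  apply: continuous_sqr => y; exact: (cvgB (@coord_cont i y) (@coord_cont j y)).
exact: (cvgM (c1 x) (c2 x)).
Qed.

Let sumsq_cont : continuous sumsq.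
Proof. by apply: continuous_sumR => i; apply: continuous_sqr; exact: coord_cont. Qed.

Let S := [set x : 'rV[R]_N | \sum_i x 0 i = 0 /\ sumsq x = 1].

Let compactS : compact S.
Proof.
have cB : compact [set v : 'rV[R]_N | forall i, v ord0 i \in `[(-1 : R), 1]].
  by apply: (@rV_compact _ _ (fun=> `[(-1 : R), 1]%classic)) => i; exact: segment_compact.
apply: subclosed_compact cB _.
  rewrite (_ : S = (fun x : 'rV[R]_N => \sum_i x 0 i) @^-1` [set y | y = 0] `&` sumsq @^-1` [set y | y = 1])//.
  apply: closedI; apply: preimage_closed; try exact: closed_eq.
    by move=> x _; apply: continuous_sumR => i; exact: coord_cont.
  by move=> x _; exact: sumsq_cont.
move=> x [_ x1] i /=; rewrite in_itv/= -ler_norml -sqrtr_sqr -sqrtr1 ler_wsqrtr//.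
by rewrite -x1 /sumsq (bigD1 i)//= lerDl sumr_ge0// => j _; exact: sqr_ge0.
Qed.

Let scaleS x : \sum_i x 0 i = 0 -> x != 0 -> S ((Num.sqrt (sumsq x))^-1 *: x).
Proof.
move=> x0 xn0; have s0 : 0 < sumsq x.
  by rewrite lt_def sumsq_ge0 andbT; apply: contra_neq xn0; exact: sumsq_eq0.
split; first by under eq_bigr do rewrite mxE; rewrite -mulr_sumr x0 mulr0.
rewrite /sumsq; under eq_bigr do rewrite mxE exprMn.
by rewrite -mulr_sumr exprVn sqr_sqrtr ?ltW// mulVf// gt_eqF.
Qed.

Let minimizer_ineq v : S v -> (forall y, S y -> dirichlet v <= dirichlet y) ->
  forall x, \sum_i x 0 i = 0 -> dirichlet v * sumsq x <= dirichlet x.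
Proof.
move=> Sv vmin x x0; have [->|xn0] := eqVneq x 0.
  by rewrite /sumsq big1 ?mulr0// => i _; rewrite mxE expr0n.
have := vmin _ (scaleS x0 xn0).
have s0 : 0 < sumsq x.
  by rewrite lt_def sumsq_ge0 andbT; apply: contra_neq xn0; exact: sumsq_eq0.
suff -> : dirichlet ((Num.sqrt (sumsq x))^-1 *: x) = dirichlet x / sumsq x.
  by rewrite ler_pdivlMr.
rewrite /dirichlet mulr_suml; apply: eq_bigr => i _; rewrite mulr_suml.
apply: eq_bigr => j _; rewrite !mxE -mulrBr exprMn exprVn sqr_sqrtr ?ltW//.
by ring.
Qed.

(* First variation in the direction of the residual v L - mu v itself. *)
Let minimizer_eigen v : S v -> (forall y, S y -> dirichlet v <= dirichlet y) ->
  v *m L = (dirichlet v / 2) *: v.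
Proof.
move=> Sv vmin; set m := dirichlet v / 2;
have [w wE] : exists w : 'rV[R]_N, forall i, w 0 i = (v *m L) 0 i - m * v 0 i.
  by exists (v *m L - m *: v) => i; rewrite !mxE.
(* The residual sums to zero, so v + t w stays in the subspace on which v is minimal. *)
have w0 : \sum_i w 0 i = 0.
  under eq_bigr do rewrite wE; rewrite sumrB -mulr_sumr Sv.1 mulr0 subr0.
  transitivity (\sum_j (v *m L) 0 j * (const_mx 1 : 'rV[R]_N) 0 j).
    by apply: eq_bigr => j _; rewrite [X in _ = _ * X]mxE mulr1.
  rewrite laplacian_form; rewrite big1 ?mul0r// => i _; rewrite big1// => j _.
  by rewrite !mxE subrr !mulr0.
have wv : sumsq w = \sum_j (v *m L) 0 j * w 0 j - m * \sum_j v 0 j * w 0 j.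
  by rewrite mulr_sumr -sumrB; apply: eq_bigr => i _; rewrite {1 2}wE expr2 {1}wE; ring.
have Q t : 0 <= 2 * t * sumsq w + t ^+ 2 * (dirichlet w / 2 - m * sumsq w).
  have := minimizer_ineq Sv vmin (x := v + t *: w).
  have -> : \sum_i (v + t *: w) 0 i = 0.
    by under eq_bigr do rewrite !mxE; rewrite big_split/= -mulr_sumr w0 Sv.1 mulr0 addr0.
  move=> /(_ erefl).
  have -> : sumsq (v + t *: w) = sumsq v + 2 * t * (\sum_j v 0 j * w 0 j) + t ^+ 2 * sumsq w.
    rewrite /sumsq !mulr_sumr -!big_split/=; apply: eq_bigr => i _.
    by rewrite !mxE; ring.
  have -> : dirichlet (v + t *: w) = dirichlet v + 4 * t * (\sum_j (v *m L) 0 j * w 0 j)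
      + t ^+ 2 * dirichlet w.
    rewrite laplacian_form /dirichlet.
    rewrite [X in _ + X + _](_ : _ = \sum_i \sum_j 2 * t * (a i j * ((v 0 i - v 0 j) * (w 0 i - w 0 j)))).
      rewrite mulr_sumr -!big_split/=; apply: eq_bigr => i _.
      rewrite mulr_sumr -!big_split/=; apply: eq_bigr => j _.
      by rewrite !mxE; ring.
    rewrite (_ : 4 * t * (_ / 2) = 2 * t * (\sum_i \sum_j a i j * ((v 0 i - v 0 j) * (w 0 i - w 0 j)))).
      by rewrite mulr_sumr; apply: eq_bigr => i _; rewrite mulr_sumr.
    by field.
  rewrite wv Sv.2 /m; lra.
(* If 2 t s + t^2 q >= 0 for all real t with s >= 0, then s = 0: the choice t = - s / (|q| + 1)
   would otherwise make it negative. *)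
have {Q}s0 : sumsq w = 0.
  apply/eqP; rewrite eq_le sumsq_ge0 andbT leNgt; apply/negP => s0.
  set q := dirichlet w / 2 - m * sumsq w in Q.
  have K0 : 0 < `|q| + 1 by rewrite ltr_wpDl.
  have := Q (- (sumsq w / (`|q| + 1))).
  have : q <= `|q| + 1 by rewrite (le_trans (ler_norm _))// lerDl.
  set K := `|q| + 1 in K0 *; set s := sumsq w in s0 * => qK.
  rewrite sqrrN => H.
  have : (s / K) ^+ 2 * q <= (s / K) ^+ 2 * K by rewrite ler_wpM2l ?sqr_ge0.
  have -> : (s / K) ^+ 2 * K = (s / K) * s by field; rewrite gt_eqF.
  have : 0 < s / K * s by rewrite mulr_gt0// divr_gt0.
  lra.
have {}w0 := sumsq_eq0 s0.
by apply/rowP => i; rewrite [RHS]mxE; apply/eqP; rewrite -subr_eq0 -wE w0 mxE.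
Qed.

Lemma laplacian_const : (const_mx 1 : 'rV[R]_N) *m L = 0.
Proof.
apply/rowP => j; rewrite mul_laplacianE !mxE big1// => i _.
by rewrite !mxE subrr mulr0.
Qed.

Hypothesis rankL : \rank L = N.-1.

(** Connectedness enters here: by the rank condition the kernel of the Laplacian is a line, spanned
    by the constant vector, and it meets the sum-zero vectors only in 0. *)
Let dirichlet_eq0 v : dirichlet v = 0 -> \sum_i v 0 i = 0 -> v = 0.
Proof.
move=> dv v0.
have N0 : (0 < N)%N || (v == 0).
  have [N0|//] := posnP N; apply/orP; right; apply/eqP/rowP => i.
  by exfalso; have := ltn_ord i; rewrite [X in (_ < X)%N]N0.
case/orP: N0 => [N0|/eqP//].
have aij i j : a i j * (v 0 i - v 0 j) ^+ 2 = 0.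
  move/eqP: dv; rewrite psumr_eq0; last first.
    by move=> k _; apply: sumr_ge0 => ? _; rewrite mulr_ge0 ?sqr_ge0.
  move=> /allP/(_ i (mem_index_enum _))/=; rewrite psumr_eq0; last first.
    by move=> ? _; rewrite mulr_ge0 ?sqr_ge0.
  by move=> /allP/(_ j (mem_index_enum _)) /eqP.
have vL : v *m L = 0.
  apply/rowP => j; rewrite mul_laplacianE mxE big1// => i _.
  move/eqP: (aij j i); rewrite mulf_eq0 sqrf_eq0 => /orP[|] /eqP ->.
    by rewrite mul0r.
  by rewrite mulr0.
have rk : \rank (kermx L) = 1%N by rewrite mxrank_ker rankL; case: (N) N0 => // n _; rewrite subSnn.
pose o : 'rV[R]_N := const_mx 1.
have on0 : o != 0.
  apply/eqP => /rowP/(_ (Ordinal N0)); rewrite !mxE => /eqP; by rewrite oner_eq0.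
have oK : (o <= kermx L)%MS by apply/sub_kermxP; exact: laplacian_const.
have vK : (v <= kermx L)%MS by apply/sub_kermxP.
have : (kermx L <= o)%MS.
  by have := mxrank_leqif_sup oK => /leqifP; case: ifP => // _; rewrite rk rank_rV on0.
move=> /(submx_trans vK)/sub_rVP[c vc].
move: v0; rewrite vc; under eq_bigr do rewrite !mxE mulr1.
rewrite sumr_const card_ord -mulr_natr => /eqP; rewrite mulf_eq0 pnatr_eq0.
by rewrite (gtn_eqF N0) orbF => /eqP ->; rewrite scale0r.
Qed.

(** Both 0 and m > 0 occur in the sorted eigenvalue list, so its second entry is at most m. If no
    eigenvalue list exists, or it has a single entry, [lambda2] is the default 0. *)
Lemma lambda2_le (v : 'rV[R]_N) m : v != 0 -> v *m L = m *: v -> 0 < m -> (0 < N)%N ->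
  lambda2 L <= m.
Proof.
move=> v0 vL m0 N0; rewrite /lambda2.
have [ex|nex] := pselect (exists s : seq R, char_poly L = \prod_(x <- s) ('X - x%:P)); last first.
  by rewrite /eigen_seq xgetPN ?nth_nil ?ltW// => s /= e; apply: nex; exists s.
have /= := xgetPex [::] ex; rewrite -/(eigen_seq L); set s := eigen_seq L => cs.
have ms : m \in sort <=%R s.
  rewrite mem_sort -root_prod_XsubC -cs -eigenvalue_root_char.
  by apply/eigenvalueP; exists v.
have zs : 0 \in sort <=%R s.
  rewrite mem_sort -root_prod_XsubC -cs -eigenvalue_root_char.
  apply/eigenvalueP; exists (const_mx 1); first by rewrite scale0r laplacian_const.
  by apply/eqP => /rowP/(_ (Ordinal N0)); rewrite !mxE => /eqP; rewrite oner_eq0.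
have ss : sorted <=%R (sort <=%R s) by apply: sort_sorted => x y; exact: le_total.
move: (sort <=%R s) ms zs ss => [//|x [|y t]] /=.
  by move=> _ _ _; exact: ltW.
move=> ms zs /andP[_ pt]; have /allP ay : all (>= y) t by exact: order_path_min (@le_trans _ _) pt.
rewrite leNgt; apply/negP => my.
have x_eq z : z \in [:: x, y & t] -> z < y -> z = x.
  rewrite !inE => /or3P[/eqP//|/eqP->|/ay/=]; first by rewrite ltxx.
  by move=> yz zy; have := le_lt_trans yz zy; rewrite ltxx.
have := x_eq _ ms my; have := x_eq _ zs (lt_trans m0 my) => <- mE.
by rewrite mE ltxx in m0.
Qed.

(** An entry of the list is a root of the characteristic polynomial, hence an eigenvalue, hence a
    Rayleigh quotient of a nonnegative form; the default entry is 0. *)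
Lemma lambda2_ge0 : 0 <= lambda2 L.
Proof.
rewrite /lambda2; set s := eigen_seq L.
have [ex|nex] := pselect (exists s : seq R, char_poly L = \prod_(x <- s) ('X - x%:P)); last first.
  by rewrite /s /eigen_seq xgetPN ?nth_nil// => t /= e; apply: nex; exists t.
have /= := xgetPex [::] ex; rewrite -/(eigen_seq L) -/s => cs.
have [s1|s1] := leqP (size (sort <=%R s)) 1; first by rewrite nth_default.
have := mem_nth 0 s1; set l := nth _ _ _.
rewrite mem_sort -root_prod_XsubC -cs -eigenvalue_root_char => /eigenvalueP[v vL v0].
have := dirichletE v; rewrite vL; under eq_bigr do rewrite mxE -mulrA -expr2.
rewrite -mulr_sumr -/(sumsq v) => E.
have s0 : 0 < sumsq v.
  by rewrite lt_def sumsq_ge0 andbT; apply: contra_neq v0; exact: sumsq_eq0.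
by rewrite -(pmulr_lge0 _ s0) E divr_ge0.
Qed.

(** The witness is the minimal Rayleigh quotient over unit sum-zero vectors, attained by
    compactness. It is positive in every case, while [lambda2] depends on a default value. The
    factor 2 appears because the double sum counts each edge in both directions. *)
Lemma spectral_gap : exists m : R, [/\ 0 < m, lambda2 L <= m &
  forall x : 'I_N -> R, \sum_i x i = 0 ->
    2 * m * \sum_i x i ^+ 2 <= \sum_i \sum_j a i j * (x i - x j) ^+ 2].
Proof.
suff [m [m0 lm H]] : exists m : R, [/\ 0 < m, lambda2 L <= m &
  forall x, \sum_i x 0 i = 0 -> 2 * m * sumsq x <= dirichlet x].
  exists m; split => // x x0; have := H (\row_i x i).
  rewrite (_ : \sum_i (\row_i0 x i0) 0 i = 0); last first.
    by under eq_bigr do rewrite mxE.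
  rewrite (_ : sumsq _ = \sum_i x i ^+ 2); last by apply: eq_bigr => i _; rewrite mxE.
  rewrite (_ : dirichlet _ = \sum_i \sum_j a i j * (x i - x j) ^+ 2); first exact.
  by apply: eq_bigr => i _; apply: eq_bigr => j _; rewrite !mxE.
have [S0|/asboolP S0] := pselect (S !=set0); last first.
  (* The sphere is empty when 0 is the only sum-zero vector; the inequality is then trivial and m
     only has to be positive and above [lambda2]. *)
  exists (Num.max 1 (lambda2 L)); split; [by rewrite lt_max ltr01|by rewrite le_max lexx orbT|].
  move=> x x0; have [->|xn0] := eqVneq x 0.
    rewrite /sumsq big1 ?mulr0// => i _; by rewrite mxE expr0n.
  by exfalso; move/asboolP: S0; apply; exists ((Num.sqrt (sumsq x))^-1 *: x); exact: scaleS.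
have [v /set_mem Sv vmin] : exists2 v, v \in S & forall t, t \in S -> dirichlet v <= dirichlet t.
  apply: (EVT_min_rV S0 compactS).
  by apply: continuous_subspaceT; exact: dirichlet_cont.
have {}vmin y : S y -> dirichlet v <= dirichlet y by move=> /mem_set; exact: vmin.
have v0 : v != 0.
  apply: contra_eq_neq (Sv.2) => ->; rewrite /sumsq big1 => [|i _]; last by rewrite mxE expr0n.
  by rewrite eq_sym oner_neq0.
have dv : 0 < dirichlet v.
  rewrite lt_def dirichlet_ge0 andbT; apply: contra_neq v0 => /dirichlet_eq0; apply.
  exact: Sv.1.
have N0 : (0 < N)%N.
  rewrite lt0n; apply: contra_neq v0 => N0; apply/rowP => i.
  by exfalso; have := ltn_ord i; rewrite [X in (_ < X)%N]N0.
exists (dirichlet v / 2); split; first by rewrite divr_gt0.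
  by apply: (lambda2_le v0) => //; [exact: minimizer_eigen|rewrite divr_gt0].
by move=> x x0; rewrite (_ : 2 * (dirichlet v / 2) = dirichlet v); [exact: minimizer_ineq|field].
Qed.

End AlgebraicConnectivity.

(** * Coercivity over excitation windows *)

Section Vectors.
Context {R : realType}.

Definition dotv (n : nat) (u v : 'cV[R]_n) : R := \sum_r u r 0 * v r 0.
Definition nsq (n : nat) (u : 'cV[R]_n) : R := \sum_r u r 0 ^+ 2.

Section FixedDim.
Context {n : nat}.
Implicit Types u v w : 'cV[R]_n.

Lemma nsq_ge0 u : 0 <= nsq u.
Proof. by apply: sumr_ge0 => r _; exact: sqr_ge0. Qed.

Lemma nsqE u : nsq u = dotv u u.
Proof. by apply: eq_bigr => r _; rewrite expr2. Qed.

Lemma vnorm_sq u : vnorm u ^+ 2 = nsq u.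
Proof. by rewrite /vnorm sqr_sqrtr ?nsq_ge0. Qed.

Lemma vnorm_ge0 u : 0 <= vnorm u.
Proof. exact: sqrtr_ge0. Qed.

Lemma nsqD u v : nsq (u + v) = nsq u + 2 * dotv u v + nsq v.
Proof.
rewrite /nsq /dotv mulr_sumr -!big_split/=; apply: eq_bigr => r _.
by rewrite !mxE; ring.
Qed.

Lemma nsqZ c u : nsq (c *: u) = c ^+ 2 * nsq u.
Proof. by rewrite mulr_sumr; apply: eq_bigr => r _; rewrite mxE exprMn. Qed.

Lemma nsqN u : nsq (- u) = nsq u.
Proof. by apply: eq_bigr => r _; rewrite mxE sqrrN. Qed.

Lemma nsq0 : nsq (0 : 'cV[R]_n) = 0.
Proof. by rewrite /nsq big1// => r _; rewrite mxE expr0n. Qed.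

Lemma dotvC u v : dotv u v = dotv v u.
Proof. by apply: eq_bigr => r _; rewrite mulrC. Qed.

Lemma dotvDr u v w : dotv u (v + w) = dotv u v + dotv u w.
Proof. by rewrite -big_split; apply: eq_bigr => r _; rewrite mxE mulrDr. Qed.

Lemma dotvZr c u v : dotv u (c *: v) = c * dotv u v.
Proof. by rewrite mulr_sumr; apply: eq_bigr => r _; rewrite mxE mulrCA. Qed.

Lemma dotvBr u v w : dotv u (v - w) = dotv u v - dotv u w.
Proof. by rewrite -sumrB; apply: eq_bigr => r _; rewrite !mxE mulrBr. Qed.

Lemma dotv_young c u v : 0 < c -> 2 * `|dotv u v| <= c * nsq u + c^-1 * nsq v.
Proof.
move=> c0; have H w : 0 <= c * nsq u + 2 * dotv u w + c^-1 * nsq w.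
  have -> : c * nsq u + 2 * dotv u w + c^-1 * nsq w = c^-1 * nsq (c *: u + w).
    rewrite nsqD nsqZ (_ : dotv (c *: u) w = c * dotv u w); last by rewrite dotvC dotvZr dotvC.
    by field; rewrite gt_eqF.
  by rewrite mulr_ge0 ?nsq_ge0// invr_ge0 ltW.
have := H v; have := H (- v); rewrite nsqN -scaleN1r dotvZr.
by case: (leP 0 (dotv u v)) => [/ger0_norm ->|/ltr0_norm ->]; lra.
Qed.

Lemma nsqD_le u v : nsq (u + v) <= 2 * nsq u + 2 * nsq v.
Proof.
have := @dotv_young 1 u v ltr01; rewrite invr1 nsqD.
have := ler_norm (dotv u v); lra.
Qed.

Lemma nsqD_ge c u v : 0 < c -> (1 - c) * nsq u <= nsq (u + v) + c^-1 * nsq v.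
Proof.
move=> c0; have := dotv_young u v c0; rewrite nsqD.
have := ler_norm (- dotv u v); rewrite normrN; have := nsq_ge0 v; lra.
Qed.

Lemma nsq_sum_le (k : nat) (u : nat -> 'cV[R]_n) :
  nsq (\sum_(0 <= l < k) u l) <= k%:R * \sum_(0 <= l < k) nsq (u l).
Proof.
elim: k => [|k IH]; first by rewrite !big_geq// nsq0 mul0r.
have [->|k0] := posnP k; first by rewrite !big_nat1 mul1r.
rewrite !big_nat_recr//= nsqD.
have kp : 0 < k%:R :> R by rewrite ltr0n.
have Y := @dotv_young k%:R^-1 (\sum_(0 <= l < k) u l) (u k).
rewrite invr_gt0 invrK in Y; have {}Y := Y kp.
have := ler_norm (dotv (\sum_(0 <= l < k) u l) (u k)).
have : k%:R^-1 * nsq (\sum_(0 <= l < k) u l) <= \sum_(0 <= l < k) nsq (u l).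
  by rewrite mulrC ler_pdivrMr// mulrC.
rewrite -natr1; lra.
Qed.

End FixedDim.

Lemma trmx_mulE n (u v : 'cV[R]_n) : (u^T *m v) 0 0 = dotv u v.
Proof. by rewrite mxE; apply: eq_bigr => r _; rewrite mxE. Qed.

Lemma dotv_mul m n (A : 'M[R]_(m, n)) u v : dotv u (A^T *m v) = dotv (A *m u) v.
Proof. by rewrite -!trmx_mulE trmx_mul mulmxA. Qed.

Lemma opnorm_nsq m n (A : 'M[R]_(m, n)) c u : opnorm_le A c -> 0 <= c ->
  nsq (A *m u) <= c ^+ 2 * nsq u.
Proof.
move=> Ac c0; rewrite -!vnorm_sq -exprMn.
by rewrite ler_pXn2r ?nnegrE ?mulr_ge0 ?vnorm_ge0//; exact: Ac.
Qed.

(** |A^T v|^2 = <A A^T v, v>, and Young's inequality with weight c^-2 bounds twice this by |A^T v|^2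
    + c^2 |v|^2. *)
Lemma opnorm_tr_nsq m n (A : 'M[R]_(m, n)) c v : opnorm_le A c -> 0 < c ->
  nsq (A^T *m v) <= c ^+ 2 * nsq v.
Proof.
move=> Ac c0; have c2 : 0 < c ^+ 2 by rewrite exprn_gt0.
have := opnorm_nsq (A^T *m v) Ac (ltW c0).
have : 0 < (c ^+ 2)^-1 by rewrite invr_gt0.
move=> ci; have := dotv_young (A *m (A^T *m v)) v ci; rewrite invrK -dotv_mul -nsqE.
rewrite ger0_norm ?nsq_ge0// => Y Z.
have : (c ^+ 2)^-1 * nsq (A *m (A^T *m v)) <= nsq (A^T *m v).
  by rewrite mulrC ler_pdivrMr// mulrC.
lra.
Qed.

Lemma loewner_nsq (n N p k : nat) (m : 'I_N -> nat)
    (H : forall i : 'I_N, nat -> 'M[R]_(m i, n)) delta (z : 'cV[R]_n) :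
  loewner_ge_scalar (p%:R^-1 *: \sum_(k <= t < k + p) \sum_(i < N) ((H i t)^T *m H i t)) delta ->
  delta * nsq z <= p%:R^-1 * \sum_(0 <= l < p) \sum_i nsq (H i (k + l)%N *m z).
Proof.
move=> /(_ z); rewrite trmx_mulE -nsqE => /le_trans; apply.
rewrite le_eqVlt; apply/orP; left; apply/eqP.
rewrite -scalemxAr -scalemxAl mxE; congr (_ * _).
rewrite -{1}[k]add0n big_addn addKn mulmx_sumr mulmx_suml summxE.
apply: eq_bigr => l _; rewrite mulmx_sumr mulmx_suml summxE; apply: eq_bigr => i _.
by rewrite mulmxA -trmx_mul -mulmxA trmx_mulE -nsqE addnC.
Qed.

End Vectors.

Section Coordinates.
Context {R : realType} {n : nat}.
Implicit Types (z u v : 'cV[R]_n) (k : nat).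

Lemma xSCE z k : (xSC z k : R) = dotv (phiSC R n k) z.
Proof. by rewrite /xSC trmx_mulE. Qed.

Lemma xSCB u v k : xSC (u - v) k = xSC u k - xSC v k :> R.
Proof. by rewrite !xSCE dotvBr. Qed.

Lemma xSCD u v k : xSC (u + v) k = xSC u k + xSC v k :> R.
Proof. by rewrite !xSCE dotvDr. Qed.

Lemma phiSC_nsq_le1 k : nsq (phiSC R n k) <= 1.
Proof.
rewrite /nsq; case: n => [|n']; first by rewrite big_ord0.
rewrite (bigD1 (inZp k.-1))//= big1 ?addr0 => [|r rk]; last first.
  rewrite mxE; case: eqP => [e|_]; last by rewrite expr0n.
  by move/eqP: rk; case; apply: val_inj.
by rewrite mxE eqxx expr1n.
Qed.

Lemma xSC_coord z k (n0 : (0 < n)%N) :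
  xSC z k = z (Ordinal (ltn_pmod k.-1 n0)) 0 :> R.
Proof.
rewrite xSCE /dotv (bigD1 (Ordinal (ltn_pmod k.-1 n0)))//= big1 ?addr0 => [|r rk].
  by rewrite mxE eqxx mul1r.
rewrite mxE; case: eqP => [e|_]; last by rewrite mul0r.
by move/eqP: rk; case; apply: val_inj.
Qed.

Lemma xSC_sq_le z k : (xSC z k : R) ^+ 2 <= nsq z.
Proof.
have [n0|n0] := posnP n; last first.
  rewrite xSC_coord /nsq (bigD1 (Ordinal (ltn_pmod k.-1 n0)))//= lerDl.
  by apply: sumr_ge0 => r _; exact: sqr_ge0.
rewrite xSCE /dotv big1 ?expr0n ?nsq_ge0// => r.
by exfalso; have := ltn_ord r; rewrite [X in (_ < X)%N]n0.
Qed.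

Lemma xSC_norm1_le z k : `|xSC z k : R| <= norm1 z.
Proof.
have [n0|n0] := posnP n; last first.
  rewrite xSC_coord /norm1 (bigD1 (Ordinal (ltn_pmod k.-1 n0)))//= lerDl.
  by apply: sumr_ge0.
rewrite xSCE /dotv big1 ?normr0 ?sumr_ge0// => r.
by exfalso; have := ltn_ord r; rewrite [X in (_ < X)%N]n0.
Qed.

End Coordinates.

(** The selector visits each coordinate exactly once in n consecutive steps. This lets a consensus
    step acting on one coordinate at a time control the whole disagreement vector. *)
Lemma xSC_cycle (R : realType) (n k : nat) (z : 'cV[R]_n) : (0 < n)%N ->
  \sum_(0 <= l < n) (xSC z (k + l).+1 : R) ^+ 2 = nsq z.
Proof.
move=> n0; rewrite big_mkord /nsq.
case: n n0 z => // n' n0 z.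
rewrite [RHS](reindex_inj (addrI (inZp k : 'I_n'.+1)))/=.
apply: eq_bigr => l _; rewrite (xSC_coord _ _ n0); congr (z _ _ ^+ 2).
by apply: val_inj => /=; rewrite modnDml.
Qed.

(** * Sums over sliding windows *)

Section WindowSums.
Context {R : realType}.
Implicit Types f : nat -> R.

Lemma sum_nat_widen f m1 m2 n1 n2 : (m1 <= m2)%N -> (n2 <= n1)%N ->
  (forall k, 0 <= f k) -> \sum_(m2 <= k < n2) f k <= \sum_(m1 <= k < n1) f k.
Proof.
move=> m12 n21 f0; have [n2m|/ltnW mn2] := leqP n2 m2.
  by rewrite big_geq// sumr_ge0.
rewrite (big_cat_nat (leq_trans m12 mn2) n21)/= (big_cat_nat m12 mn2)/=.
by rewrite addrAC lerDr addr_ge0// sumr_ge0.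
Qed.

Lemma window_sum_le f P m T : (forall k, 0 <= f k) ->
  \sum_(m <= k < T) \sum_(0 <= l < P) f (k + l).+1 <=
  P%:R * \sum_(m.+1 <= t < (T + P).+1) f t.
Proof.
move=> f0; rewrite exchange_big/= mulr_natl -[X in _ <= _ *+ X]subn0 -sumr_const_nat.
apply: ler_sum_nat => l /andP[_ lP].
have -> : \sum_(m <= k < T) f (k + l).+1 = \sum_(m + l.+1 <= t < T + l.+1) f t.
  by rewrite big_addn addnK; apply: eq_bigr => k _; rewrite addnS.
by apply: sum_nat_widen => //; lia.
Qed.

(** A sum of P telescoping sums, each at most 1. It bounds what is lost when the event at time k is
    replaced by the smaller event P steps later. *)
Lemma indicator_gap_sum (e : nat -> bool) P m T :
  \sum_(m <= k < T) ((e k)%:R - (e (k + P)%N)%:R : R) <= P%:R.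
Proof.
have e01 k : (0 <= (e k)%:R :> R) && ((e k)%:R <= 1 :> R) by rewrite ler0n lern1 leq_b1.
elim: P => [|P IH]; first by rewrite big1// => k _; rewrite addn0 subrr.
rewrite -natr1.
have -> : \sum_(m <= k < T) ((e k)%:R - (e (k + P.+1)%N)%:R : R) =
  \sum_(m <= k < T) ((e k)%:R - (e (k + P)%N)%:R : R) +
  \sum_(m <= k < T) ((e (k + P)%N)%:R - (e (k.+1 + P)%N)%:R : R).
  by rewrite -big_split/=; apply: eq_bigr => k _; rewrite addnS addSn; ring.
apply: lerD => //.
have [Tm|/ltnW mT] := leqP T m; first by rewrite big_geq.
rewrite -[X in X <= _]opprK -sumrN.
under eq_bigr do rewrite opprB.
rewrite (telescope_sumr (fun k => (e (k + P)%N)%:R)) //.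
by have /andP[? ?] := e01 (T + P)%N; have /andP[? ?] := e01 (m + P)%N; lra.
Qed.

End WindowSums.

Section WindowDrift.
Context {R : realType} {N n : nat}.
Local Notation vec := ('I_N -> 'cV[R]_n).
Variables (X : nat -> vec) (e : nat -> bool) (w : nat -> R).
Hypothesis e_anti : forall k, e k.+1 -> e k.
Hypothesis w_ge0 : forall k, 0 <= w k.
Hypothesis w_anti : forall k l, (0 < k <= l)%N -> w l <= w k.
Hypothesis w_le1 : forall k, (0 < k)%N -> w k <= 1.

Definition vsq (x : vec) : R := \sum_i nsq (x i).

Lemma vsq_ge0 x : 0 <= vsq x.
Proof. by apply: sumr_ge0 => i _; exact: nsq_ge0. Qed.

Let inc t := (e t.-1)%:R * vsq (X t \- X t.-1).

Let inc_ge0 t : 0 <= inc t.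
Proof. by rewrite mulr_ge0 ?ler0n ?vsq_ge0. Qed.

Let e_antiD k l : e (k + l)%N -> e k.
Proof. by elim: l => [|l IH]; rewrite ?addn0// addnS => /e_anti. Qed.

Let drift_sum_le k l P : (l <= P)%N ->
  (e (k + l)%N)%:R * vsq (X (k + l)%N \- X k) <= P%:R * \sum_(0 <= s < P) inc (k + s).+1.
Proof.
move=> lP; case: (boolP (e (k + l)%N)) => [el|_]; last first.
  by rewrite mul0r mulr_ge0// sumr_ge0.
rewrite mul1r; apply: (@le_trans _ _ (l%:R * \sum_(0 <= s < l) inc (k + s).+1)); last first.
  rewrite ler_pM ?ler0n ?sumr_ge0 ?ler_nat//.
  exact: sum_nat_widen (leqnn _) lP (fun s => inc_ge0 _).
have -> : \sum_(0 <= s < l) inc (k + s).+1 =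
    \sum_i \sum_(0 <= s < l) nsq (X (k + s).+1 i - X (k + s)%N i).
  rewrite exchange_big; apply: eq_big_nat => s /andP[_ sl]; rewrite /inc /= (_ : e _) ?mul1r//.
  by apply: (@e_antiD _ (l - s)%N); rewrite -addnA subnKC// ltnW.
rewrite mulr_sumr; apply: ler_sum => i _ /=.
have -> : X (k + l)%N i - X k i = \sum_(0 <= s < l) (X (k + s).+1 i - X (k + s)%N i).
  rewrite (@telescope_sumr_eq _ 0 l (fun s => X (k + s)%N i)) ?addn0// => s _.
  by rewrite addnS.
exact: nsq_sum_le.
Qed.

Variables (q : nat -> vec -> R) (eta B : R).
Hypothesis q_ge0 : forall t x, 0 <= q t x.
Hypothesis eta01 : 0 <= eta <= 1.
Hypothesis B0 : 0 <= B.
Hypothesis q_pert : forall t x y, (0 < t)%N -> (1 - eta) * q t x <= q t y + B * vsq (y \- x).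

(** Excitation concerns a state frozen over the window, the drift sees the current state. The gap is
    paid by the squared increments inside the window, whose total is noise-sized. Weight and
    indicator are read at the end k + Pm of the window, where both are smallest. *)
Lemma window_form_le P Pm m T : (0 < P <= Pm)%N ->
  (1 - eta) * \sum_(m <= k < T) w (k + Pm)%N * (e (k + Pm)%N)%:R *
      (P%:R^-1 * \sum_(0 <= l < P) q (k + l).+1 (X k))
  <= \sum_(m.+1 <= t < (T + Pm).+1) w t * (e t.-1)%:R * q t (X t.-1)
   + B * Pm%:R ^+ 2 * \sum_(m.+1 <= t < (T + Pm).+1) inc t.
Proof.
move=> /andP[P0 PPm]; have Pp : 0 < P%:R :> R by rewrite ltr0n.
pose f t := w t * (e t.-1)%:R * q t (X t.-1).
have f0 t : 0 <= f t by rewrite !mulr_ge0 ?ler0n.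
have term k l : (l < P)%N ->
    (1 - eta) * (w (k + Pm)%N * (e (k + Pm)%N)%:R * q (k + l).+1 (X k)) <=
    f (k + l).+1 + B * (Pm%:R * \sum_(0 <= s < Pm) inc (k + s).+1).
  move=> lP; have lPm := leq_trans (ltnW lP) PPm.
  have R0 : 0 <= B * (Pm%:R * \sum_(0 <= s < Pm) inc (k + s).+1).
    by rewrite !mulr_ge0 ?sumr_ge0.
  case: (boolP (e (k + Pm)%N)) => [eP|_]; last first.
    by rewrite mulr0 mul0r mulr0 addr_ge0.
  have el : e (k + l)%N.
    by apply: (@e_antiD _ (Pm - l)%N); rewrite -addnA subnKC.
  rewrite mulr1 mulrCA.
  have wle : w (k + Pm)%N <= w (k + l).+1 by apply: w_anti; lia.
  have wl1 : w (k + l).+1 <= 1 by exact: w_le1.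
  have := q_pert (X k) (X (k + l)%N) (ltn0Sn (k + l)).
  have := drift_sum_le k lPm; rewrite el mul1r => D1 D2.
  have D3 : (1 - eta) * q (k + l).+1 (X k) <= q (k + l).+1 (X (k + l)%N) +
      B * (Pm%:R * \sum_(0 <= s < Pm) inc (k + s).+1).
    by apply: (le_trans D2); rewrite lerD2l ler_wpM2l.
  apply: (@le_trans _ _ (w (k + l).+1 * ((1 - eta) * q (k + l).+1 (X k)))).
    by rewrite ler_wpM2r// mulr_ge0// subr_ge0; case/andP: eta01.
  apply: (le_trans (ler_wpM2l (w_ge0 _) D3)).
  rewrite mulrDr /f /= el mulr1 lerD2l.
  by rewrite ler_piMl.
have -> : (1 - eta) * \sum_(m <= k < T) w (k + Pm)%N * (e (k + Pm)%N)%:R *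
      (P%:R^-1 * \sum_(0 <= l < P) q (k + l).+1 (X k)) =
  P%:R^-1 * \sum_(m <= k < T) \sum_(0 <= l < P)
    (1 - eta) * (w (k + Pm)%N * (e (k + Pm)%N)%:R * q (k + l).+1 (X k)).
  rewrite !mulr_sumr; apply: eq_bigr => k _.
  rewrite -mulr_sumr -mulr_sumr; ring.
rewrite mulrC ler_pdivrMr//.
apply: (@le_trans _ _ (\sum_(m <= k < T) \sum_(0 <= l < P)
    (f (k + l).+1 + B * (Pm%:R * \sum_(0 <= s < Pm) inc (k + s).+1)))).
  by apply: ler_sum => k _; apply: ler_sum_nat => l /andP[_ lP]; exact: term.
under eq_bigr do rewrite big_split/= sumr_const_nat subn0 -[_ *+ P]mulr_natr.
rewrite big_split/= mulrDl lerD//.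
  apply: (le_trans (window_sum_le P m T f0)); rewrite mulrC ler_wpM2r ?ler0n//.
  by apply: sum_nat_widen => //; rewrite ltnS leq_add2l.
rewrite -mulr_suml ler_wpM2r ?ler0n// -mulr_sumr -mulrA ler_wpM2l//.
rewrite -mulr_sumr expr2 -mulrA ler_wpM2l ?ler0n//.
exact: window_sum_le.
Qed.

End WindowDrift.

Section Coercivity.
Context {R : realType} {N n : nat} (m : 'I_N -> nat) (a : 'I_N -> 'I_N -> R)
  (H : forall i : 'I_N, nat -> 'M[R]_(m i, n)) (Hbar delta bl ms lam : R) (p : nat).
Local Notation vec := ('I_N -> 'cV[R]_n).
Hypothesis a_ge0 : forall i j, 0 <= a i j.
Hypothesis Hbar0 : 0 < Hbar.
Hypothesis H_norm : forall i k, (1 <= k)%N -> opnorm_le (H i k) Hbar.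
Hypothesis p0 : (0 < p)%N.
Hypothesis delta0 : 0 < delta.
Hypothesis H_pe : forall k, (1 <= k)%N ->
     loewner_ge_scalar
       (p%:R^-1 *: \sum_(k <= t < k + p) \sum_(i < N) ((H i t)^T *m H i t)) delta.
Hypothesis bl0 : 0 < bl.
Hypothesis ms0 : 0 < ms.
Hypothesis lam0 : 0 < lam.
Hypothesis gap : forall x : 'I_N -> R, \sum_i x i = 0 ->
    2 * lam * \sum_i x i ^+ 2 <= \sum_i \sum_j a i j * (x i - x j) ^+ 2.
Hypothesis N0 : (0 < N)%N.
Hypothesis n0 : (0 < n)%N.

Definition obs_form t (x : vec) : R := \sum_i nsq (H i t *m x i).
Definition cons_form t (x : vec) : R := \sum_i \sum_j a i j * (xSC (x i) t - xSC (x j) t) ^+ 2.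

Lemma obs_form_ge0 t x : 0 <= obs_form t x.
Proof. by apply: sumr_ge0 => i _; exact: nsq_ge0. Qed.

Lemma cons_form_ge0 t x : 0 <= cons_form t x.
Proof. by do 2 (apply: sumr_ge0 => ? _); rewrite mulr_ge0 ?sqr_ge0. Qed.

Lemma obs_form_pert eta t x y : 0 < eta -> (0 < t)%N ->
  (1 - eta) * obs_form t x <= obs_form t y + (eta^-1 * Hbar ^+ 2) * vsq (y \- x).
Proof.
move=> eta0 t0; rewrite /obs_form !mulr_sumr -big_split/=; apply: ler_sum => i _.
have := nsqD_ge (H i t *m x i) (H i t *m (y i - x i)) eta0.
rewrite -mulmxDr (addrC (x i)) subrK => /le_trans; apply; rewrite lerD2l -mulrA.
apply: ler_wpM2l; [by rewrite invr_ge0 ltW|]; apply: opnorm_nsq (ltW Hbar0); exact: H_norm.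
Qed.

Lemma cons_form_pert eta t x y : 0 < eta -> (0 < t)%N ->
  (1 - eta) * cons_form t x <=
  cons_form t y + (eta^-1 * (4 * \sum_i \sum_j a i j)) * vsq (y \- x).
Proof.
move=> eta0 t0.
have K : (1 - eta) * cons_form t x <= cons_form t y + eta^-1 * cons_form t (y \- x).
  rewrite /cons_form !mulr_sumr -big_split/=; apply: ler_sum => i _.
  rewrite !mulr_sumr -big_split/=; apply: ler_sum => j _.
  rewrite mulrCA [eta^-1 * _]mulrCA -mulrDr ler_wpM2l// !xSCB.
  set u := xSC (x i) t - xSC (x j) t; set v := xSC (y i) t - xSC (y j) t.
  rewrite (_ : _ - _ - _ = v - u); last by rewrite /u /v; ring.
  have : 0 <= eta^-1 * (eta * u + (v - u)) ^+ 2.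
    by rewrite mulr_ge0 ?sqr_ge0// invr_ge0 ltW.
  have -> : eta^-1 * (eta * u + (v - u)) ^+ 2 =
    eta * u ^+ 2 + 2 * u * (v - u) + eta^-1 * (v - u) ^+ 2 by field; rewrite gt_eqF.
  rewrite [X in _ -> X <= _](_ : _ = v ^+ 2 - (eta * u ^+ 2 + 2 * u * (v - u)) - (v - u) ^+ 2); last by ring.
  have := sqr_ge0 (v - u); lra.
apply: (le_trans K); rewrite lerD2l -mulrA; apply: ler_wpM2l; [by rewrite invr_ge0 ltW|].
rewrite -mulrA [X in _ <= _ * X]mulr_suml mulr_sumr; apply: ler_sum => i _.
rewrite mulr_suml mulr_sumr; apply: ler_sum => j _ /=.
rewrite [leRHS]mulrCA ler_wpM2l//.
have L k : nsq (y k - x k) <= vsq (y \- x).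
  by rewrite /vsq (bigD1 k)//= lerDl sumr_ge0// => l _; exact: nsq_ge0.
have := xSC_sq_le (y i - x i) t; have := xSC_sq_le (y j - x j) t.
have := L i; have := L j; have := sqr_ge0 (xSC (y i - x i) t + xSC (y j - x j) t).
rewrite (_ : (xSC (y i - x i) t + xSC (y j - x j) t) ^+ 2 =
  2 * xSC (y i - x i) t ^+ 2 + 2 * xSC (y j - x j) t ^+ 2
  - (xSC (y i - x i) t - xSC (y j - x j) t) ^+ 2); last by ring.
lra.
Qed.

(** The spectral gap is applied at each time to the selected coordinate of the deviations from the
    mean, which sum to zero over the sensors; [xSC_cycle] then collects the coordinates. *)
Lemma cons_form_cycle k (x : vec) :
  2 * lam * (\sum_i nsq (x i - N%:R^-1 *: \sum_j x j)) <=
  \sum_(0 <= l < n) cons_form (k + l).+1 x.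
Proof.
have Np : 0 < N%:R :> R by rewrite ltr0n.
set xb := N%:R^-1 *: \sum_j x j.
have -> : \sum_i nsq (x i - xb) = \sum_(0 <= l < n) \sum_i xSC (x i - xb) (k + l).+1 ^+ 2.
  by rewrite [RHS]exchange_big/=; apply: eq_bigr => i _; rewrite xSC_cycle.
rewrite mulr_sumr; apply: ler_sum => l _.
have := gap (x := fun i => xSC (x i - xb) (k + l).+1).
have -> : \sum_i xSC (x i - xb) (k + l).+1 = 0.
  have -> : \sum_i xSC (x i - xb) (k + l).+1 = xSC (\sum_i (x i - xb)) (k + l).+1.
    have z0 : xSC (0 : 'cV[R]_n) (k + l).+1 = 0 by rewrite /xSC mulmx0 mxE.
    by apply: (big_ind2 (fun u v => u = xSC v _)) => // u1 v1 u2 v2 -> ->; rewrite xSCD.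
  rewrite sumrB sumr_const card_ord /xb -scaler_nat scalerA mulfV ?gt_eqF// scale1r subrr.
  by rewrite /xSC mulmx0 mxE.
move=> /(_ erefl) /le_trans; apply; rewrite le_eqVlt; apply/orP; left; apply/eqP.
by apply: eq_bigr => i _; apply: eq_bigr => j _; rewrite !xSCB; congr (_ * _); ring.
Qed.

(** Excitation tested on a unit coordinate vector. It guarantees that in [coercivity] the component
    along the mean, not the disagreement, limits the rate. *)
Lemma delta_le : delta <= N%:R * Hbar ^+ 2.
Proof.
pose z : 'cV[R]_n := \col_r (r == Ordinal n0)%:R.
have z1 : nsq z = 1.
  rewrite /nsq (bigD1 (Ordinal n0))//= big1 ?addr0 ?mxE ?eqxx ?expr1n// => r /negbTE r0.
  by rewrite mxE r0 expr0n.
have pp : 0 < p%:R :> R by rewrite ltr0n.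
have := loewner_nsq z (H_pe (leqnn 1)); rewrite z1 mulr1 => /le_trans; apply.
rewrite mulrC ler_pdivrMr// mulr_natr -{2}[p]subn0 -sumr_const_nat; apply: ler_sum => l _.
rewrite mulr_natl -[N in _ *+ N]card_ord -sumr_const; apply: ler_sum => i _.
by rewrite -[leRHS]mulr1 -z1; apply: opnorm_nsq (ltW Hbar0); exact: H_norm.
Qed.

(** At ms = m' / 2 this is at least the constant a of the case with critical edges; at lam ms = 2 n
    Hbar^2 bl it equals delta bl / N, the constant of the other case. *)
Definition coer_rate : R :=
  2 * (delta * bl / N%:R * (lam * ms / (2 * n%:R * Hbar ^+ 2 * bl + lam * ms))).

(* With x_i = xbar + u_i, Young's inequality with the weight
   c = X / (X + y), X = 2 n Hbar^2 bl, y = lam ms, splits the observation form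
   into a part in xbar, bounded below by excitation, and a part in u, absorbed
   by half of the consensus form. *)
Lemma coercivity k (x : vec) : (0 < k)%N ->
  coer_rate * vsq x <=
  2 * bl * (p%:R^-1 * \sum_(0 <= l < p) obs_form (k + l) x) +
  ms * (n%:R^-1 * \sum_(0 <= l < n) cons_form (k + l) x).
Proof.
move=> k0; have Np : 0 < N%:R :> R by rewrite ltr0n.
have np : 0 < n%:R :> R by rewrite ltr0n.
have pp : 0 < p%:R :> R by rewrite ltr0n.
set xb := N%:R^-1 *: \sum_j x j; pose u i := x i - xb.
set U := \sum_i nsq (u i); set Vb := N%:R * nsq xb.
have U0 : 0 <= U by apply: sumr_ge0 => i _; exact: nsq_ge0.
have Vb0 : 0 <= Vb by rewrite mulr_ge0 ?nsq_ge0 ?ltW.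
have VE : vsq x = Vb + U.
  have -> : vsq x = \sum_i (nsq xb + 2 * dotv xb (u i) + nsq (u i)).
    by apply: eq_bigr => i _; rewrite -nsqD /u addrC subrK.
  rewrite !big_split/= sumr_const card_ord -mulr_sumr -[nsq xb *+ N]mulr_natl -/Vb -/U.
  suff -> : \sum_i dotv xb (u i) = 0 by rewrite mulr0 addr0.
  have -> : \sum_i dotv xb (u i) = dotv xb (\sum_i u i).
    have z0 : dotv xb (0 : 'cV[R]_n) = 0 by rewrite /dotv big1// => r _; rewrite [X in _ * X]mxE mulr0.
    by apply: (big_ind2 (fun s v => s = dotv xb v)) => // u1 v1 u2 v2 -> ->; rewrite dotvDr.
  have xbN : xb *+ N = \sum_j x j.
    by rewrite -scaler_nat /xb scalerA mulfV ?gt_eqF// scale1r.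
  rewrite sumrB sumr_const card_ord xbN subrr.
  by rewrite /dotv big1// => r _; rewrite [X in _ * X]mxE mulr0.
set XX := 2 * n%:R * Hbar ^+ 2 * bl; set y := lam * ms.
have H2 : 0 < Hbar ^+ 2 by rewrite exprn_gt0.
have X0 : 0 < XX by rewrite !mulr_gt0.
have y0 : 0 < y by rewrite mulr_gt0.
have Xy0 : 0 < XX + y by rewrite addr_gt0.
pose c := XX / (XX + y).
have c0 : 0 < c by rewrite divr_gt0.
have cons : 2 * lam * U <= \sum_(0 <= l < n) cons_form (k + l) x.
  have := cons_form_cycle k.-1 x; rewrite -/xb -/U.
  by under [X in _ <= X -> _]eq_bigr do rewrite -addSn prednK//.
have obs : (1 - c) * delta * nsq xb - (c^-1 - 1) * Hbar ^+ 2 * U <=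
    p%:R^-1 * \sum_(0 <= l < p) obs_form (k + l) x.
  have pe := loewner_nsq xb (H_pe k0).
  have c1 : 0 <= 1 - c.
    by rewrite subr_ge0 /c ler_pdivrMr// mul1r lerDl ltW.
  have ci : 0 <= c^-1 - 1 by rewrite subr_ge0 invf_ge1// -subr_ge0.
  have S1 l : (1 - c) * \sum_i nsq (H i (k + l)%N *m xb) - (c^-1 - 1) * Hbar ^+ 2 * U
      <= obs_form (k + l) x.
    rewrite lerBlDr /obs_form mulr_sumr -mulrA /U !mulr_sumr -big_split/=.
    apply: ler_sum => i _; have xi : x i = xb + u i by rewrite /u addrC subrK.
    rewrite {1}xi mulmxDr.
    have hu : nsq (H i (k + l)%N *m u i) <= Hbar ^+ 2 * nsq (u i).
      by apply: opnorm_nsq (ltW Hbar0); apply: H_norm; rewrite addn_gt0 k0.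
    have := ler_wpM2l ci hu.
    have := dotv_young (H i (k + l)%N *m xb) (H i (k + l)%N *m u i) c0.
    have := ler_norm (- dotv (H i (k + l)%N *m xb) (H i (k + l)%N *m u i)).
    rewrite normrN (nsqD (H i (k + l)%N *m xb)); lra.
  have : p%:R^-1 * \sum_(0 <= l < p) ((1 - c) * \sum_i nsq (H i (k + l)%N *m xb) -
      (c^-1 - 1) * Hbar ^+ 2 * U) <= p%:R^-1 * \sum_(0 <= l < p) obs_form (k + l) x.
    apply: ler_wpM2l; first by rewrite invr_ge0 ltW.
    by apply: ler_sum => l _; exact: S1.
  apply: le_trans; move: ((c^-1 - 1) * Hbar ^+ 2 * U) => K.
  rewrite sumrB -mulr_sumr sumr_const_nat subn0 mulrBr.
  rewrite (_ : p%:R^-1 * (K *+ p) = K); last by rewrite -(mulr_natl K) mulKf ?gt_eqF.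
  by rewrite lerD2r mulrCA -mulrA; exact: (ler_wpM2l c1 pe).
have E1 : 1 - c = y / (XX + y) by rewrite /c; field; rewrite gt_eqF.
have E2 : c^-1 - 1 = y / XX by rewrite /c; field; rewrite !gt_eqF.
have E3 : 2 * bl * ((y / XX) * Hbar ^+ 2 * U) = y / n%:R * U.
  by rewrite /XX; field; rewrite !gt_eqF.
have E4 : ms * (n%:R^-1 * (2 * lam * U)) = 2 * (y / n%:R * U).
  by rewrite /y; field; rewrite gt_eqF.
have C1 : 2 * bl * ((1 - c) * delta * nsq xb - (c^-1 - 1) * Hbar ^+ 2 * U) <=
    2 * bl * (p%:R^-1 * \sum_(0 <= l < p) obs_form (k + l) x).
  by rewrite ler_wpM2l// mulr_ge0// ltW.
have C2 : ms * (n%:R^-1 * (2 * lam * U)) <=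
    ms * (n%:R^-1 * \sum_(0 <= l < n) cons_form (k + l) x).
  have in0 : 0 <= n%:R^-1 :> R by rewrite invr_ge0 ltW.
  exact: (ler_wpM2l (ltW ms0) (ler_wpM2l in0 cons)).
have E5 : coer_rate * Vb = 2 * bl * ((1 - c) * delta * nsq xb).
  by rewrite /coer_rate -/XX -/y E1 /Vb; field; rewrite !gt_eqF.
(* The half of the consensus form that was not spent on absorbing must still dominate the rate on U;
   this reduces to delta <= N Hbar^2. *)
have E6 : coer_rate * U <= y / n%:R * U.
  rewrite ler_wpM2r// /coer_rate -/XX -/y.
  have -> : 2 * (delta * bl / N%:R * (y / (XX + y))) = (2 * delta * bl / N%:R) / (XX + y) * y.
    by field; rewrite !gt_eqF.
  rewrite [leRHS]mulrC; apply: (ler_wpM2r (ltW y0)); rewrite ler_pdivrMr// [leRHS]mulrC ler_pdivlMr//.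
  have -> : 2 * delta * bl / N%:R * n%:R = delta / N%:R * (2 * n%:R * bl) by field; rewrite gt_eqF.
  apply: (@le_trans _ _ XX); last by rewrite lerDl ltW.
  rewrite /XX (_ : 2 * n%:R * Hbar ^+ 2 * bl = Hbar ^+ 2 * (2 * n%:R * bl)); last by ring.
  apply: ler_wpM2r; first by rewrite !mulr_ge0// ltW.
  by rewrite ler_pdivrMr// mulrC; exact: delta_le.
rewrite VE mulrDr E5; move: C1 C2; rewrite mulrBr E2 E3 E4; lra.
Qed.

End Coercivity.

Section PathwiseDrift.
Context {R : realType} {N n : nat} (m : 'I_N -> nat) (a : 'I_N -> 'I_N -> R)
  (H : forall i : 'I_N, nat -> 'M[R]_(m i, n)) (Hbar delta bl ms lam : R) (p : nat).
Local Notation vec := ('I_N -> 'cV[R]_n).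
Hypothesis a_ge0 : forall i j, 0 <= a i j.
Hypothesis Hbar0 : 0 < Hbar.
Hypothesis H_norm : forall i k, (1 <= k)%N -> opnorm_le (H i k) Hbar.
Hypothesis p0 : (0 < p)%N.
Hypothesis delta0 : 0 < delta.
Hypothesis H_pe : forall k, (1 <= k)%N ->
     loewner_ge_scalar
       (p%:R^-1 *: \sum_(k <= t < k + p) \sum_(i < N) ((H i t)^T *m H i t)) delta.
Hypothesis bl0 : 0 < bl.
Hypothesis ms0 : 0 < ms.
Hypothesis lam0 : 0 < lam.
Hypothesis gap : forall x : 'I_N -> R, \sum_i x i = 0 ->
    2 * lam * \sum_i x i ^+ 2 <= \sum_i \sum_j a i j * (x i - x j) ^+ 2.
Hypothesis N0 : (0 < N)%N.
Hypothesis n0 : (0 < n)%N.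
Let r := @coer_rate R N n Hbar delta bl ms lam.

Lemma coer_rate_gt0 : 0 < r.
Proof.
have Np : 0 < N%:R :> R by rewrite ltr0n.
have np : 0 < n%:R :> R by rewrite ltr0n.
have y0 : 0 < lam * ms by rewrite mulr_gt0.
have X0 : 0 < 2 * n%:R * Hbar ^+ 2 * bl by rewrite !mulr_gt0// exprn_gt0.
rewrite /r /coer_rate mulr_gt0// mulr_gt0//; first by rewrite divr_gt0// mulr_gt0.
by rewrite divr_gt0// addr_gt0.
Qed.

(** C is chosen before the path, the event indicators, the weights and the horizon, so the
    inequality can be integrated over the sample space. One factor 1 - eta pays for freezing the
    state, the other for moving the weight across a window; the last term accounts for leaving the
    event inside a window. *)
Lemma pathwise_drift eta : 0 < eta < 1 -> exists2 C : R, 0 <= C &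
  forall (X : nat -> vec) (e : nat -> bool) (w : nat -> R) (Lb : R) (m0 T : nat),
  (forall k, e k.+1 -> e k) -> (forall k, 0 <= w k) ->
  (forall k l, (0 < k <= l)%N -> w l <= w k) -> (forall k, (0 < k)%N -> w k <= 1) ->
  (forall k, (m0 <= k)%N -> (1 - eta) * w k <= w (k + (p + n))%N) ->
  0 <= Lb -> (forall k, e k -> vsq (X k) <= Lb) -> (0 < m0)%N ->
  (1 - eta) ^+ 2 * r * \sum_(m0 <= k < T) w k * ((e k)%:R * vsq (X k)) <=
  \sum_(m0.+1 <= t < (T + (p + n)).+1) w t * ((e t.-1)%:R *
     (2 * bl * obs_form H t (X t.-1) + ms * cons_form a t (X t.-1)))
  + C * \sum_(m0.+1 <= t < (T + (p + n)).+1) (e t.-1)%:R * vsq (X t \- X t.-1)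
  + r * (Lb * (p + n)%:R).
Proof.
have bl0' := ltW bl0; have ms0' := ltW ms0.
move=> /andP[eta0 eta1]; set P := (p + n)%N.
pose B1 := eta^-1 * Hbar ^+ 2; pose B2 := eta^-1 * (4 * \sum_i \sum_j a i j).
have B10 : 0 <= B1 by rewrite mulr_ge0 ?invr_ge0 ?sqr_ge0// ltW.
have B20 : 0 <= B2.
  rewrite mulr_ge0 ?invr_ge0 ?(ltW eta0)// mulr_ge0//.
  by do 2 (apply: sumr_ge0 => ? _).
exists ((2 * bl * B1 + ms * B2) * P%:R ^+ 2).
  apply: mulr_ge0; last exact: sqr_ge0.
  by apply: addr_ge0; apply: mulr_ge0 => //; apply: mulr_ge0.
move=> X e w Lb m0 T e_anti w0 w_anti w1 w_win Lb0 eLb m00.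
set S1 := \sum_(m0.+1 <= t < (T + P).+1) (e t.-1)%:R * _.
have S10 : 0 <= S1 by apply: sumr_ge0 => t _; rewrite mulr_ge0 ?vsq_ge0.
have e01 : 0 <= eta <= 1 by rewrite !ltW.
have A1 := @window_form_le R N n X e w e_anti w0 w_anti w1 (obs_form H) eta B1
  (obs_form_ge0 H) e01 B10 (fun t x y t0 => obs_form_pert Hbar0 H_norm x y eta0 t0) p P m0 T.
have A2 := @window_form_le R N n X e w e_anti w0 w_anti w1 (cons_form a) eta B2
  (cons_form_ge0 a_ge0) e01 B20 (fun t x y t0 => cons_form_pert a_ge0 x y eta0 t0) n P m0 T.
have {A1} := A1 _; rewrite p0 leq_addr => /(_ isT) A1.
have {A2} := A2 _; rewrite n0 leq_addl => /(_ isT) A2.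
rewrite -/S1 in A1 A2.
set O := \sum_(_ <= t < _) w t * (e t.-1)%:R * _ in A1.
set Cn := \sum_(_ <= t < _) w t * (e t.-1)%:R * _ in A2.
have -> : \sum_(m0.+1 <= t < (T + P).+1) w t * ((e t.-1)%:R *
     (2 * bl * obs_form H t (X t.-1) + ms * cons_form a t (X t.-1))) = 2 * bl * O + ms * Cn.
  by rewrite !mulr_sumr -big_split/=; apply: eq_bigr => t _; ring.
set W1 := \sum_(m0 <= k < T) w (k + P)%N * _ * _ in A1.
set W2 := \sum_(m0 <= k < T) w (k + P)%N * _ * _ in A2.
pose W := \sum_(m0 <= k < T) w (k + P)%N * ((e (k + P)%N)%:R * vsq (X k)).
have r0 : 0 <= r by rewrite ltW// coer_rate_gt0.
have CW : r * W <= 2 * bl * W1 + ms * W2.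
  rewrite !mulr_sumr -big_split/=; apply: ler_sum => k _.
  have := coercivity Hbar0 H_norm p0 H_pe bl0 ms0 lam0 gap N0 n0 (X k) (ltn0Sn k).
  have we : 0 <= w (k + P)%N * (e (k + P)%N)%:R by rewrite mulr_ge0.
  move=> /(ler_wpM2l we); rewrite -/r => Q.
  rewrite mulrCA (mulrCA r) mulrA; apply: (le_trans Q).
  by rewrite le_eqVlt; apply/orP; left; apply/eqP; ring.
have A3 : (1 - eta) * (r * W) <= 2 * bl * O + ms * Cn + (2 * bl * B1 + ms * B2) * P%:R ^+ 2 * S1.
  have q1 := ler_wpM2l (ltW (mulr_gt0 (ltr0n _ 2) bl0)) A1.
  have q2 := ler_wpM2l (ltW ms0) A2.
  have eta1' : 0 <= 1 - eta by lra.
  have := ler_wpM2l eta1' CW; lra.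
have gapS := @indicator_gap_sum R e P m0 T.
(* Weight and indicator at k + P are traded for those at k: the weight costs 1 - eta, and on the
   indices where the event is lost within P steps the term is at most Lb. *)
have exitW : (1 - eta) * \sum_(m0 <= k < T) w k * ((e k)%:R * vsq (X k)) <= W + Lb * P%:R.
  apply: (@le_trans _ _ (W + Lb * \sum_(m0 <= k < T) ((e k)%:R - (e (k + P)%N)%:R))); last first.
    by rewrite lerD2l ler_wpM2l.
  rewrite mulr_sumr mulr_sumr -big_split/=; apply: ler_sum_nat => k /andP[mk kT].
  have wk := w_win k mk; have wp := w1 (k + P)%N (ltn_addr _ (leq_trans m00 mk)).
  have V0 := vsq_ge0 (X k); have ww := w0 (k + P)%N.
  have anti : e (k + P)%N -> e k.
    by elim: (P) => [|l IH]; rewrite ?addn0// addnS => /e_anti.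
  case: (boolP (e k)) => ek; last first.
    have -> : e (k + P)%N = false by apply: contraNF ek; exact: anti.
    by rewrite !mul0r !mulr0 subrr mulr0 addr0.
  have VL := eLb k ek.
  case: (e (k + P)%N); rewrite ?mul1r ?mul0r ?mulr0 ?subrr ?mulr0 ?addr0 ?subr0 ?mulr1 ?add0r.
    by rewrite mulrA ler_wpM2r.
  rewrite mulrA; apply: (@le_trans _ _ (1 * vsq (X k))); last by rewrite mul1r.
  by rewrite ler_wpM2r//; apply: (le_trans wk).
have eta1' : 0 <= 1 - eta by lra.
have f1 : (1 - eta) * r * ((1 - eta) * \sum_(m0 <= k < T) w k * ((e k)%:R * vsq (X k))) <=
    (1 - eta) * r * (W + Lb * P%:R) by rewrite ler_wpM2l// mulr_ge0.
have f2 : (1 - eta) * (r * (Lb * P%:R)) <= r * (Lb * P%:R).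
  rewrite ler_piMl//; [by rewrite mulr_ge0// mulr_ge0// ler0n|lra].
rewrite expr2; lra.
Qed.

End PathwiseDrift.

(** * Weighted descent and the harmonic series *)

Section WeightedDescent.
Variable R : realType.

Lemma natr_ge (x : R) : exists k : nat, x <= k%:R.
Proof. by exists (Num.truncn x).+1; apply/ltW; exact: truncnS_gt. Qed.

Lemma finite_pos_lb (I : finType) (P : pred I) (f : I -> R) :
  (forall i, P i -> 0 < f i) -> exists2 d : R, 0 < d & forall i, P i -> d <= f i.
Proof.
move=> f0; exists (\big[Num.min/1]_(i | P i) f i); first exact: lt_bigmin.
by move=> i Pi; exact: bigmin_le_cond.
Qed.

Lemma finite_eventually (I : finType) (Q : I -> nat -> Prop) :
  (forall i, exists m, forall k, (m <= k)%N -> Q i k) ->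
  exists m, forall k i, (m <= k)%N -> Q i k.
Proof.
move=> /choice[m Hm]; exists (\max_i m i) => k i mk; apply: Hm; apply: leq_trans mk.
exact: leq_bigmax.
Qed.

Lemma harmonic_ge_ln (m l : nat) : (0 < m <= l)%N ->
  ln l%:R - ln m%:R <= \sum_(m <= k < l) k%:R^-1 :> R.
Proof.
move=> /andP[m0]; elim: l => [|l IH]; first by rewrite leqn0 => /eqP e; rewrite e in m0.
rewrite leq_eqVlt => /orP[/eqP <-|]; first by rewrite subrr big_geq.
rewrite ltnS => ml; rewrite big_nat_recr//=; have {}IH := IH ml.
have l0 : 0 < l%:R :> R by rewrite ltr0n; exact: leq_trans ml.
have -> : l.+1%:R = l%:R * (1 + l%:R^-1) :> R by rewrite mulrDr mulr1 mulfV ?gt_eqF// natr1.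
have i0 : 0 < l%:R^-1 :> R by rewrite invr_gt0.
rewrite lnM ?posrE ?addr_gt0// addrAC; apply: lerD => //.
by apply: le_ln1Dx; apply: lt_trans i0; rewrite ltrN10.
Qed.

Lemma harmonic_unbounded (m : nat) (B : R) : exists l, B < \sum_(m <= k < l) k%:R^-1.
Proof.
have [l lB] := natr_ge (expR (ln m.+1%:R + B + 1)); exists (maxn l m.+1).
have le1 : l%:R <= (maxn l m.+1)%:R :> R by rewrite ler_nat leq_maxl.
have lp : 0 < l%:R :> R by apply: lt_le_trans lB; exact: expR_gt0.
have lnl : ln m.+1%:R + B + 1 <= ln (maxn l m.+1)%:R :> R.
  by rewrite -[leLHS]expRK ler_ln ?posrE ?expR_gt0// ?(lt_le_trans lp le1)// (le_trans lB le1).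
have hl := @harmonic_ge_ln m.+1 (maxn l m.+1); rewrite leq_maxr in hl; have {}hl := hl isT.
apply: (@lt_le_trans _ _ (\sum_(m.+1 <= k < maxn l m.+1) k%:R^-1)).
  by apply: lt_le_trans hl; lra.
by apply: sum_nat_widen => // k; rewrite invr_ge0.
Qed.

Lemma powRN_small (s e : R) : 0 < s -> 0 < e -> exists m : nat, forall k, (m < k)%N -> k%:R `^ (- s) <= e.
Proof.
move=> s0 e0; have [m mP] := natr_ge (e^-1 `^ s^-1); exists m => k mk.
have kp : 0 < k%:R :> R by rewrite ltr0n; exact: leq_trans mk.
rewrite powRN -[leRHS]invrK lef_pV2 ?posrE ?invr_gt0// ?powR_gt0//.
have -> : e^-1 = (e^-1 `^ s^-1) `^ s.
  by rewrite -powRrM mulVf ?gt_eqF// powRr1// invr_ge0 ltW.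
apply: ge0_ler_powR; rewrite ?nnegrE ?powR_ge0 ?(ltW s0) ?(ltW kp)//.
by apply: (le_trans mP); rewrite ler_nat ltnW.
Qed.

Lemma sqrt_ln_le_powR (s : R) (l : nat) : 0 < s -> (1 <= l)%N ->
  Num.sqrt (ln l%:R * l%:R `^ s) <= l%:R `^ s / Num.sqrt s.
Proof.
move=> s0 l1; have lp : 1 <= l%:R :> R by rewrite ler1n.
rewrite -[X in _ <= X / _]ger0_norm ?powR_ge0// -sqrtr_sqr -sqrtrV ?(ltW s0)//.
rewrite -sqrtrM ?sqr_ge0// ler_wsqrtr// expr2 mulrAC ler_wpM2r ?powR_ge0//.
exact: ln_le_powR.
Qed.

Variables (h kap : R).
Hypothesis h_half : 1 / 2 < h.
Hypothesis h_le1 : h <= 1.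
Hypothesis kap0 : 0 <= kap.
Hypothesis kaph : kap <= h - 1 / 2.

Let w (t : nat) : R := t%:R `^ (kap - 1).

Lemma weight_anti k l : (0 < k <= l)%N -> w l <= w k.
Proof.
move=> /andP[k0 kl]; rewrite /w -(opprB 1 kap) !powRN lef_pV2 ?posrE ?powR_gt0 ?ltr0n//; last exact: leq_trans kl.
apply: ge0_ler_powR; rewrite ?nnegrE ?ler_nat//; move: kaph h_le1; lra.
Qed.

Lemma weight_le1 k : (0 < k)%N -> w k <= 1.
Proof. by move=> k0; rewrite /w -(opprB 1 kap); apply: powRN_le1 => //; move: kaph h_le1; lra. Qed.

(** As kap >= 0, the weight decays no faster than 1 / k, so a shift by P keeps at least the fraction
    1 / (1 + P / k) >= 1 - P / k. *)
Lemma weight_window (P : nat) (eta : R) : 0 < eta -> exists m2 : nat, forall k, (m2 < k)%N ->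
  (1 - eta) * w k <= w (k + P)%N.
Proof.
move=> eta0; have [m2 m2P] := natr_ge (P%:R / eta); exists m2 => k mk.
have kp : 0 < k%:R :> R by rewrite ltr0n; exact: leq_trans mk.
have Pk : P%:R / k%:R <= eta.
  rewrite ler_pdivrMr// mulrC -ler_pdivrMr//; apply: (le_trans m2P); rewrite ler_nat.
  exact: ltnW.
rewrite /w natrD (_ : k%:R + P%:R = k%:R * (1 + P%:R / k%:R)); last first.
  by field; rewrite gt_eqF.
have u0 : 0 <= P%:R / k%:R :> R by rewrite divr_ge0// ltW.
have u1 : 1 <= 1 + P%:R / k%:R :> R by rewrite lerDl.
have u2 : 0 < 1 + P%:R / k%:R :> R by exact: lt_le_trans u1.
rewrite powRM ?(ltW kp) ?(ltW u2)// mulrC; apply: ler_wpM2l; first exact: powR_ge0.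
apply: (@le_trans _ _ ((1 + P%:R / k%:R) `^ (-1))); last by rewrite ler_powR//; move: kap0; lra.
rewrite powR_inv1 ?(ltW u2)// -[leRHS]mul1r ler_pdivlMr//.
move: Pk u0 eta0; move: (P%:R / k%:R) => y yy y1 eta0; nra.
Qed.

Variables (v dE iE : nat -> R) (L Cn C c r : R) (P m0 : nat).
Hypothesis m0_gt0 : (0 < m0)%N.
Hypothesis v0 : forall k, 0 <= v k.
Hypothesis vL : forall k, v k <= L.
Hypothesis Cn0 : 0 <= Cn.
Hypothesis C0 : 0 <= C.
Hypothesis descent : forall k, v k.+1 + dE k <= v k + Cn * k.+1%:R `^ (- (2 * h)).
Hypothesis incr : forall k, iE k <= Cn * k.+1%:R `^ (- (2 * h)).

Let S l := \sum_(m0 <= k < l) w k * v k.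
Let G := Cn * (1 + (h - 1 / 2)^-1).

Let hh : 0 < h - 1 / 2.
Proof. by move: h_half; lra. Qed.

Let w0 k : 0 <= w k.
Proof. exact: powR_ge0. Qed.

Let S0 l : 0 <= S l.
Proof. by apply: sumr_ge0 => k _; rewrite mulr_ge0. Qed.

Let G0 : 0 <= G.
Proof. by apply: mulr_ge0 => //; apply: addr_ge0 => //; rewrite invr_ge0 (ltW hh). Qed.

Let L0 : 0 <= L.
Proof. exact: le_trans (v0 0) (vL 0). Qed.

Let noise_sum l (s : R) : 1 + (h - 1 / 2) <= s ->
  \sum_(m0.+1 <= t < l.+1) Cn * t%:R `^ (- s) <= G.
Proof.
move=> hs; rewrite -mulr_sumr; apply: ler_wpM2l => //.
apply: le_trans (sum_powR_bounded l hh).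
apply: (@le_trans _ _ (\sum_(m0.+1 <= t < l.+1) t%:R `^ (- (1 + (h - 1 / 2))))).
  apply: ler_sum_nat => t /andP[t1 _]; rewrite ler_powR ?lerN2// ler1n; exact: leq_trans t1.
by apply: sum_nat_widen => // t; exact: powR_ge0.
Qed.

Let incr_sum l : \sum_(m0.+1 <= t < l.+1) iE t.-1 <= G.
Proof.
apply: le_trans (@noise_sum l (2 * h) _); last by move: h_half; lra.
apply: ler_sum_nat => t /andP[t1 _]; have := incr t.-1.
by rewrite prednK//; exact: leq_trans t1.
Qed.

(** Abel summation: multiplying the descent by t^kap costs (t + 1)^kap - t^kap <= kap t^(kap - 1)
    per step, which produces the term kap S. *)
Let descent_sum l : (m0 <= l)%N ->
  \sum_(m0.+1 <= t < l.+1) t%:R `^ kap * dE t.-1 + l%:R `^ kap * v l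
   <= m0%:R `^ kap * v m0 + kap * S l + \sum_(m0.+1 <= t < l.+1) Cn * t%:R `^ (- (2 * h - kap)).
Proof.
elim: l => [|l IH]; first by rewrite leqn0 => /eqP e; move: m0_gt0; rewrite e.
rewrite leq_eqVlt => /orP[/eqP e|].
  by rewrite -e /S !big_geq// mulr0 !addr0 add0r.
rewrite ltnS => ml; have {}IH := IH ml.
rewrite /S big_nat_recr//= [X in _ <= _ + kap * X + _]big_nat_recr//= [X in _ <= _ + X]big_nat_recr//= -/(S l).
have pk0 : 0 <= l.+1%:R `^ kap :> R by exact: powR_ge0.
have st2 := ler_wpM2l pk0 (descent l).
have k01 : 0 <= kap <= 1 by rewrite kap0/=; move: kaph h_le1; lra.
have l0 : (0 < l)%N by exact: leq_trans ml.
have pd := ler_wpM2r (v0 l) (powR_succ_diff k01 l0).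
have E1 : l.+1%:R `^ kap * (Cn * l.+1%:R `^ (- (2 * h))) = Cn * l.+1%:R `^ (- (2 * h - kap)) :> R.
  by rewrite mulrCA -powRD_gt0 ?ltr0n//; congr (_ * _ `^ _); ring.
rewrite mulrDr mulrDr E1 in st2; rewrite -/(w l) mulrBl in pd.
move: IH st2 pd.
move: (l.+1%:R `^ kap * v l.+1) (l.+1%:R `^ kap * dE l) (l%:R `^ kap * _) => x1 x2 x3.
move: (l.+1%:R `^ kap * v l) (\sum_(_ <= _ < _) _ `^ kap * _) (\sum_(_ <= _ < _) Cn * _) (Cn * _) => x4 x5 x6 x7.
move: (m0%:R `^ kap * _) (S l) (w l) (v l) => x8 x9 x10 x11.
lra.
Qed.

Let S_shift l : S (l + P)%N <= S l + P%:R * L.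
Proof.
have wv k : (m0 <= k)%N -> w k * v k <= L.
  move=> mk; rewrite -[leRHS]mul1r.
  by apply: ler_pM => //; apply: weight_le1; exact: leq_trans mk.
have e : \sum_(l <= k < l + P) L = P%:R * L by rewrite sumr_const_nat addKn mulr_natl.
rewrite -e; have [lm|ml] := leqP l m0.
  apply: (@le_trans _ _ (\sum_(l <= k < l + P) L)); last by rewrite lerDr.
  apply: (@le_trans _ _ (\sum_(m0 <= k < l + P) L)).
    by apply: ler_sum_nat => k /andP[mk _]; exact: wv.
  exact: sum_nat_widen.
rewrite /S (big_cat_nat (n := l)) ?leq_addr ?(ltnW ml)//= lerD2l.
by apply: ler_sum_nat => k /andP[mk _]; apply: wv; apply: leq_trans mk; exact: ltnW.
Qed.

(** The drift yields c S and the Abel summation gives back kap S, so S is bounded as soon as kap <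
    c; the extra P terms in the horizon cost a constant. The noise is summable because kap <= h -
    1/2 leaves the exponent 2 h - kap >= 1 + (h - 1/2). *)
Lemma weighted_descent : kap < c ->
  (forall l, c * S l <= \sum_(m0.+1 <= t < (l + P).+1) t%:R `^ kap * dE t.-1
      + C * \sum_(m0.+1 <= t < (l + P).+1) iE t.-1 + r) ->
  exists B : R, forall l, S l <= B.
Proof.
move=> kc EX.
exists ((m0%:R `^ kap * L + kap * (P%:R * L) + G + C * G + r) / (c - kap)) => l.
rewrite ler_pdivlMr ?subr_gt0// mulrBr.
have SD' : \sum_(m0.+1 <= t < (l + P).+1) t%:R `^ kap * dE t.-1 <=
    m0%:R `^ kap * L + kap * S (l + P)%N + G.
  have [mT|Tm] := leqP m0 (l + P)%N; last first.
    rewrite big_geq; last by rewrite ltnS ltnW.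
    by apply: addr_ge0 => //; apply: addr_ge0; apply: mulr_ge0 => //; exact: powR_ge0.
  have s1 := descent_sum mT.
  have s3 : 1 + (h - 1 / 2) <= 2 * h - kap by move: kaph h_half; lra.
  have s2 := noise_sum (l + P)%N s3.
  have s4 : 0 <= (l + P)%:R `^ kap * v (l + P)%N by rewrite mulr_ge0 ?powR_ge0.
  have s5 : m0%:R `^ kap * v m0 <= m0%:R `^ kap * L by rewrite ler_wpM2l ?powR_ge0.
  move: s1 s2 s4 s5; move: (\sum_(_ <= _ < _) _ `^ kap * _) (\sum_(_ <= _ < _) Cn * _) => y1 y2.
  move: (_ * v (l + P)%N) (_ * v m0) (m0%:R `^ kap * L) (kap * S _) (G) => y3 y4 y5 y6 y7.
  lra.
have t1 := EX l; have t2 := ler_wpM2l C0 (incr_sum (l + P)%N); have t3 := ler_wpM2l kap0 (S_shift l).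
move: t1 t2 t3 SD'; rewrite mulrDr [S l * _]mulrC [S l * kap]mulrC.
move: (\sum_(_ <= _ < _) _ `^ kap * _) (C * \sum_(_ <= _ < _) _) (m0%:R `^ kap * L) => z1 z2 z4.
move: (kap * S (l + P)%N) (kap * S l) (kap * (P%:R * L)) (C * G) (G) (_ * S l) => z5 z6 z7 z8 z9 z10.
lra.
Qed.

End WeightedDescent.

(** * Expectations and sigma-algebras *)

Section Expectation.
Context {d : measure_display} {T : measurableType d} {R : realType} (mu : probability T R).
Implicit Types f g u : T -> R.

Definition L1 f := mu.-integrable setT (EFin \o f).
Definition Ex f : R := \int[mu]_x f x.

Lemma L1_meas f : L1 f -> measurable_fun setT f.
Proof. by move=> /integrableP[/measurable_EFinP]. Qed.

Lemma L1_le f g : measurable_fun setT f -> L1 g -> (forall x, `|f x| <= g x) -> L1 f.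
Proof.
move=> mf ig fg; apply: le_integrable ig => //; first exact/measurable_EFinP.
by move=> x _ /=; rewrite lee_fin (le_trans (fg x))// ler_norm.
Qed.

Lemma L1_cst c : L1 (fun=> c).
Proof.
rewrite /L1; have -> : EFin \o (fun=> c : R) = (cst c%:E : T -> \bar R) by [].
by apply: finite_measure_integrable_cst => //; exact: measurableT.
Qed.

Lemma L1_bdd f B : measurable_fun setT f -> (forall x, `|f x| <= B) -> L1 f.
Proof. by move=> mf fB; apply: (L1_le mf (L1_cst B)). Qed.

Lemma L1D f g : L1 f -> L1 g -> L1 (fun x => f x + g x).
Proof. by move=> lf lg; have := integrableD measurableT lf lg. Qed.

Lemma L1Z c f : L1 f -> L1 (fun x => c * f x).
Proof. by move=> lf; have := integrableZl measurableT c lf. Qed.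

Lemma L1B f g : L1 f -> L1 g -> L1 (fun x => f x - g x).
Proof. by move=> lf lg; have := integrableB measurableT lf lg. Qed.

Lemma L1_sum (I : Type) (s : seq I) (P : pred I) (F : I -> T -> R) :
  (forall i, P i -> L1 (F i)) -> L1 (fun x => \sum_(i <- s | P i) F i x).
Proof.
move=> lF; elim: s => [|i s IH].
  have -> : (fun x => \sum_(i <- [::] | P i) F i x) = fun=> 0.
    by apply/funext => x; rewrite big_nil.
  exact: L1_cst.
have -> : (fun x => \sum_(j <- i :: s | P j) F j x) =
    (fun x => (if P i then F i x else 0) + \sum_(j <- s | P j) F j x).
  by apply/funext => x; rewrite big_cons; case: ifP; rewrite ?add0r.
apply: L1D => //; case: (boolP (P i)) => Pi; first exact: lF.
exact: L1_cst.
Qed.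

Lemma L1M u f B : measurable_fun setT u -> (forall x, `|u x| <= B) -> L1 f ->
  L1 (fun x => u x * f x).
Proof.
move=> mu_ uB lf; apply: (@L1_le _ (fun x => B * `|f x|)).
- by apply: measurable_funM => //; exact: L1_meas.
- by apply: L1Z; exact: (integrable_norm lf).
- by move=> x; rewrite normrM ler_wpM2r.
Qed.

Lemma ExD f g : L1 f -> L1 g -> Ex (fun x => f x + g x) = Ex f + Ex g.
Proof. by move=> lf lg; exact: RintegralD. Qed.

Lemma ExB f g : L1 f -> L1 g -> Ex (fun x => f x - g x) = Ex f - Ex g.
Proof. by move=> lf lg; exact: RintegralB. Qed.

Lemma ExZ c f : L1 f -> Ex (fun x => c * f x) = c * Ex f.
Proof. by move=> lf; exact: RintegralZl. Qed.

Lemma Ex_cst c : Ex (fun=> c) = c.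
Proof.
transitivity (c * fine (mu setT)); first exact: Rintegral_cst.
by rewrite probability_setT mulr1.
Qed.

Lemma Ex_le f g : L1 f -> L1 g -> (forall x, f x <= g x) -> Ex f <= Ex g.
Proof. by move=> lf lg fg; apply: le_Rintegral. Qed.

Lemma Ex_ge0 f : (forall x, 0 <= f x) -> 0 <= Ex f.
Proof. by move=> f0; apply: Rintegral_ge0. Qed.

Lemma eq_Ex f g : f =1 g -> Ex f = Ex g.
Proof. by move=> /funext ->. Qed.

Lemma Ex_sum (I : Type) (s : seq I) (P : pred I) (F : I -> T -> R) :
  (forall i, P i -> L1 (F i)) ->
  Ex (fun x => \sum_(i <- s | P i) F i x) = \sum_(i <- s | P i) Ex (F i).
Proof.
move=> lF; elim: s => [|i s IH].
  by rewrite big_nil -[RHS](Ex_cst 0); apply: eq_Ex => x; rewrite big_nil.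
rewrite big_cons; case: ifPn => Pi.
  rewrite -IH -ExD; [|exact: lF|exact: L1_sum].
  by apply: eq_Ex => x; rewrite big_cons Pi.
by rewrite -IH; apply: eq_Ex => x; rewrite big_cons (negbTE Pi).
Qed.

Lemma EFin_Ex f : L1 f -> (Ex f)%:E = (\int[mu]_x (f x)%:E)%E.
Proof. by move=> lf; rewrite /Ex /Rintegral fineK//; exact: integrable_fin_num. Qed.

Lemma measurable_indicR (A : set T) : measurable A -> measurable_fun setT (\1_A : T -> R).
Proof. by move=> mA; exact: measurable_indic. Qed.

Lemma indic_norm_le1 (A : set T) x : `|\1_A x : R| <= 1.
Proof. by rewrite indicE; case: (_ \in _); rewrite ?normr1 ?normr0. Qed.

Lemma L1_indic (A : set T) : measurable A -> L1 (\1_A : T -> R).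
Proof. by move=> mA; apply: (@L1_bdd _ 1); [exact: measurable_indicR|exact: indic_norm_le1]. Qed.

Lemma L1_indicM (A : set T) f : measurable A -> L1 f -> L1 (fun x => \1_A x * f x).
Proof.
by move=> mA lf; apply: (L1M (measurable_indicR mA) (indic_norm_le1 A)).
Qed.

Lemma Ex_indic (A : set T) : measurable A -> (Ex (\1_A : T -> R))%:E = mu A.
Proof.
move=> mA; rewrite EFin_Ex; last exact: L1_indic.
by rewrite integral_indic// setIT.
Qed.

Lemma integral_indicM (A : set T) f : measurable A ->
  (\int[mu]_(x in A) (f x)%:E = \int[mu]_x (\1_A x * f x)%:E)%E.
Proof.
move=> mA; rewrite integral_mkcond; apply: eq_integral => x _.
by rewrite patchE indicE; case: ifPn => xA; rewrite ?mul1r ?mul0r.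
Qed.

(* Layer-cake discretisation of u into floor (m u) / m. *)
Lemma orthogonal_to_bounded (G : set (set T)) (Z u : T -> R) B :
  (forall A, G A -> measurable A) ->
  cond_exp_zero mu G Z -> measurable_wrt G u -> (forall x, `|u x| <= B) ->
  Ex (fun x => u x * Z x) = 0.
Proof.
move=> Gm [lZ Z0] mu_u uB.
have mu_ : measurable_fun setT u.
  by move=> _ Y mY; rewrite setTI; apply: Gm; exact: mu_u.
have B0 : 0 <= B by apply: le_trans (uB point); exact: normr_ge0.
have EA A : G A -> Ex (fun x => \1_A x * Z x) = 0.
  move=> GA; apply/EFin_inj; rewrite EFin_Ex; last by apply: L1_indicM => //; exact: Gm.
  by rewrite -integral_indicM ?Z0//; exact: Gm.
have Gge c : G [set x | c <= u x].
  by have := mu_u `[c, +oo[%classic (measurable_itv _); rewrite /preimage /=; under eq_set do rewrite in_itv/= andbT.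
pose D m (x : T) : R := - B + (2 * B / m.+1%:R) *
  \sum_(1 <= i < m.+2) \1_[set x | - B + 2 * B * (i%:R / m.+1%:R) <= u x] x.
have D_L1 m : L1 (fun x => D m x * Z x).
  have -> : (fun x => D m x * Z x) = (fun x => - B * Z x + (2 * B / m.+1%:R) *
   \sum_(1 <= i < m.+2) (\1_[set x | - B + 2 * B * (i%:R / m.+1%:R) <= u x] x * Z x)).
    by apply/funext => x; rewrite /D mulrDl -(mulrA (2 * B / _)) mulr_suml.
  apply: L1D; first exact: L1Z.
  by apply: L1Z; apply: L1_sum => i _; apply: L1_indicM => //; exact: Gm.
have D_Ex m : Ex (fun x => D m x * Z x) = 0.
  have -> : (fun x => D m x * Z x) = (fun x => - B * Z x + (2 * B / m.+1%:R) *
   \sum_(1 <= i < m.+2) (\1_[set x | - B + 2 * B * (i%:R / m.+1%:R) <= u x] x * Z x)).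
    by apply/funext => x; rewrite /D mulrDl -(mulrA (2 * B / _)) mulr_suml.
  have ls : L1 (fun x => \sum_(1 <= i < m.+2)
      (\1_[set x | - B + 2 * B * (i%:R / m.+1%:R) <= u x] x * Z x)).
    by apply: L1_sum => i _; apply: L1_indicM => //; exact: Gm.
  rewrite ExD; [|exact: L1Z|exact: L1Z].
  rewrite !ExZ// Ex_sum; last by move=> i _; apply: L1_indicM => //; exact: Gm.
  rewrite big1 => [|i _]; last exact: EA.
  have GT : G setT by have := Gge (- B); rewrite (_ : [set x | _] = setT)//;
    apply/seteqP; split => // x _ /=; have := uB x; rewrite ler_norml => /andP[].
  have <- : Ex (fun x => \1_setT x * Z x) = Ex Z.
    by apply: eq_Ex => x; rewrite indicT mul1r.
  by rewrite EA// !mulr0 addr0.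
have close m x : `|u x - D m x| <= 2 * B / m.+1%:R.
  have mp : 0 < m.+1%:R :> R by rewrite ltr0n.
  have := uB x; rewrite ler_norml => /andP[u1 u2].
  have [B0'|Bn0] := eqVneq B 0.
    rewrite /D B0' mulr0 !mul0r addr0 oppr0 subr0; have -> : u x = 0 by lra.
    by rewrite normr0.
  have Bp : 0 < B by rewrite lt_def Bn0.
  pose y := (u x + B) * m.+1%:R / (2 * B).
  have y0 : 0 <= y by rewrite divr_ge0 ?mulr_ge0//; lra.
  have ym : y <= m.+1%:R.
    by rewrite ler_pdivrMr ?mulr_gt0// mulrC ler_wpM2l//; lra.
  (* The number of thresholds i in 1..m+1 below y is the integer part of y, so u and its
     discretisation differ by at most one step 2 B / (m + 1). *)
  pose cnt : R := \sum_(1 <= i < m.+2) (nat_of_bool (i%:R <= y))%:R.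
  have -> : D m x = - B + 2 * B / m.+1%:R * cnt.
    congr (_ + _ * _); apply: eq_bigr => i _; rewrite indicE; congr ((nat_of_bool _)%:R).
    apply/idP/idP => [/set_mem/=|iy].
      rewrite /y ler_pdivlMr ?mulr_gt0// => h.
      have -> : i%:R * (2 * B) = (2 * B * (i%:R / m.+1%:R)) * m.+1%:R :> R.
        by field; rewrite gt_eqF.
      by apply: ler_wpM2r => //; rewrite -lerBlDr addrC.
    apply/mem_set => /=; move: iy; rewrite /y ler_pdivlMr ?mulr_gt0// -ler_pdivrMr//.
    have -> : i%:R * (2 * B) / m.+1%:R = 2 * B * (i%:R / m.+1%:R) :> R by ring.
    by rewrite -lerBlDr addrC.
  have [k /andP[k1 k2]] : exists k : nat, k%:R <= y < k.+1%:R.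
    by exists (Num.truncn y); exact: truncn_itv.
  have km : (k <= m.+1)%N by rewrite -(ler_nat R) (le_trans k1).
  have -> : cnt = k%:R.
    rewrite /cnt (big_cat_nat (n := k.+1))//= [X in X + _](eq_big_nat _ _ (F2 := fun=> 1)); last first.
      move=> i /andP[_ ik]; rewrite (_ : (i%:R <= y)%R = true)//.
      by apply: le_trans k1; rewrite ler_nat.
    rewrite sumr_const_nat subSS subn0 big1_seq ?addr0// => i /andP[_].
    rewrite mem_index_iota => /andP[ki _]; rewrite leNgt (_ : (y < i%:R)%R = true)//.
    by apply: lt_le_trans k2 _; rewrite ler_nat.
  have -> : u x - (- B + 2 * B / m.+1%:R * k%:R) = 2 * B / m.+1%:R * (y - k%:R).
    by rewrite /y; field; rewrite gt_eqF//= gt_eqF.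
  have c0 : 0 <= 2 * B / m.+1%:R by rewrite divr_ge0// mulr_ge0.
  rewrite normrM ger0_norm// ler_piMr// ger0_norm; first by move: k2; rewrite -natr1; lra.
  by rewrite subr_ge0.
have lu : L1 (fun x => u x * Z x) by exact: (L1M mu_ uB).
have lnZ : L1 (fun x => `|Z x|) by exact: (integrable_norm lZ).
have bound m : `|Ex (fun x => u x * Z x)| <= 2 * B / m.+1%:R * Ex (fun x => `|Z x|).
  have ld : L1 (fun x => u x * Z x - D m x * Z x) by exact: L1B.
  rewrite -[X in `|X|]subr0 -(D_Ex m) -ExB// -ExZ//.
  apply: le_trans (le_normr_Rintegral measurableT ld) _.
  apply: Ex_le; [exact: (integrable_norm ld)|exact: L1Z|] => x.
  by rewrite -mulrBl normrM ler_wpM2r.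
apply/eqP; rewrite -normr_le0; apply/ler_addgt0Pr => e e0; rewrite add0r.
set K := 2 * B * Ex (fun x => `|Z x|).
have K0 : 0 <= K by rewrite !mulr_ge0// Ex_ge0.
have [m mK] : exists m : nat, K / e < m.+1%:R.
  exists (Num.truncn (K / e)); exact: truncnS_gt.
apply: (le_trans (bound m)).
rewrite mulrAC -/K ler_pdivrMr ?ltr0n//.
by move: mK; rewrite ltr_pdivrMr// mulrC => /ltW.
Qed.

(** Monotone convergence: the extended sum has integral at most C, hence is finite almost
    everywhere. *)
Lemma ae_bounded_sums (f : nat -> T -> R) C :
  (forall k x, 0 <= f k x) -> (forall k, L1 (f k)) ->
  (forall m, \sum_(0 <= k < m) Ex (f k) <= C) ->
  {ae mu, forall x, exists M : R, forall m, \sum_(0 <= k < m) f k x <= M}.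
Proof.
move=> f0 lf fC; pose g x := (\sum_(0 <= k <oo) (f k x)%:E)%E.
have mf k : measurable_fun setT (fun x => (f k x)%:E).
  by apply/measurable_EFinP; exact: L1_meas.
have ig : mu.-integrable setT g.
  apply/integrableP; split.
    by apply: ge0_emeasurable_sum => // k x _ _; rewrite lee_fin.
  under eq_integral => x _.
    rewrite gee0_abs; last by apply: nneseries_ge0 => k _ _; rewrite lee_fin.
    over.
  rewrite /g integral_nneseries//; last by move=> k x _; rewrite lee_fin.
  apply: (@le_lt_trans _ _ C%:E); last exact: ltry.
  apply: lime_le; first by apply: is_cvg_nneseries => k _ _; apply: integral_ge0 => x _; rewrite lee_fin.
  apply: nearW => m; rewrite (eq_bigr (fun k => (Ex (f k))%:E)) => [|k _]; last by rewrite EFin_Ex.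
  by rewrite sumEFin lee_fin.
have := integrable_ae measurableT ig; apply: filterS => x /(_ I) gx.
exists (fine (g x)) => m; rewrite -lee_fin fineK// -sumEFin.
by apply: nneseries_lim_ge => k _; rewrite lee_fin.
Qed.

(** B is an arbitrary set. The null superset is the intersection over j of unions of covers with
    total mass at most 1 / (j + 1). *)
Lemma negligible_small (B : set T) :
  (forall e : R, 0 < e -> exists A : nat -> set T, [/\ forall k, measurable (A k),
     B `<=` \bigcup_k A k & forall m, \sum_(0 <= k < m) Ex (\1_(A k)) <= e]) ->
  mu.-negligible B.
Proof.
move=> H; have {}H (j : nat) : exists A : nat -> set T, [/\ forall k, measurable (A k),
     B `<=` \bigcup_k A k & forall m, \sum_(0 <= k < m) Ex (\1_(A k)) <= j.+1%:R^-1].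
  by apply: H; rewrite invr_gt0 ltr0n.
have [A HA] := choice H; pose U j := \bigcup_k A j k.
have mU j : measurable (U j) by apply: bigcupT_measurable => k; have [] := HA j.
exists (\bigcap_j U j); split; first exact: bigcapT_measurable.
  apply/eqP; rewrite eq_le measure_ge0 andbT; apply/lee_addgt0Pr => e e0; rewrite add0e.
  have [j je] : exists j : nat, j.+1%:R^-1 <= e.
    exists (Num.truncn e^-1); rewrite -[leRHS]invrK lef_pV2 ?posrE ?ltr0n ?invr_gt0//.
    by apply/ltW; exact: truncnS_gt.
  apply: (@le_trans _ _ (mu (U j))).
    by apply: le_measure; rewrite ?inE//; [exact: bigcapT_measurable|move=> x /(_ j); exact].
  apply: (@le_trans _ _ (j.+1%:R^-1)%:E); last by rewrite lee_fin.
  have [mA _ sA] := HA j.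
  apply: (le_trans (measure_sigma_subadditive mu mA (mU j) (@subset_refl _ _))).
  apply: lime_le; first exact: is_cvg_nneseries.
  apply: nearW => m; rewrite (eq_bigr (fun k => (Ex (\1_(A j k)))%:E)) => [|k _]; last by rewrite Ex_indic.
  by rewrite sumEFin lee_fin.
by move=> x Bx j _; have [_ sB _] := HA j; exact: sB.
Qed.

End Expectation.

Section GeneratedSigmaAlgebras.
Context {d : measure_display} {T : measurableType d} {R : realType}.
Implicit Types (fs gs : set (T -> R)) (f : T -> R) (A : set T).

(** The generators inside [sigma_of], named so that [g_sigma_algebraType] turns the generated
    sigma-algebra into a measurable type and measurability relative to it becomes
    [measurable_fun]. *)
Definition sigma_gens fs : set (set T) :=
  [set A | exists f, fs f /\ exists B : set R, measurable B /\ A = f @^-1` B].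

Lemma sigma_of_sigma_algebra fs : sigma_algebra setT (sigma_of fs).
Proof. exact: smallest_sigma_algebra. Qed.

Lemma sigma_of_least fs (G : set (set T)) : sigma_algebra setT G ->
  sigma_gens fs `<=` G -> sigma_of fs `<=` G.
Proof. by move=> sG fG; apply: smallest_sub. Qed.

Lemma sigma_of_mono fs gs : fs `<=` gs -> sigma_of fs `<=` sigma_of gs.
Proof.
move=> fg; apply: sigma_of_least; first exact: sigma_of_sigma_algebra.
move=> A [f [ff [B [mB ->]]]]; apply: sub_gen_smallest.
by exists f; split; [exact: fg|exists B].
Qed.

Lemma sigma_of_measurable fs A : (forall f, fs f -> measurable_fun setT f) ->
  sigma_of fs A -> measurable A.
Proof.
move=> mfs; apply: sigma_of_least A; first exact: sigma_algebra_measurable.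
move=> A [f [ff [B [mB ->]]]].
by rewrite -[X in measurable X]setTI; exact: mfs.
Qed.

Lemma sigma_of_gen fs f : fs f -> measurable_wrt (sigma_of fs) f.
Proof. by move=> ff B mB; apply: sub_gen_smallest; exists f; split => //; exists B. Qed.

Lemma measurable_wrtS (G G' : set (set T)) f : G `<=` G' ->
  measurable_wrt G f -> measurable_wrt G' f.
Proof. by move=> GG' mf B mB; apply: GG'; exact: mf. Qed.

Lemma measurable_wrtP fs f : measurable_wrt (sigma_of fs) f <->
  measurable_fun setT (f : g_sigma_algebraType (sigma_gens fs) -> R).
Proof.
split=> [mf _ B mB|mf B mB].
  by rewrite setTI; exact: mf.
by have := mf measurableT B mB; rewrite setTI.
Qed.

Lemma sigma_of_measurableE fs A : sigma_of fs A <->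
  measurable (A : set (g_sigma_algebraType (sigma_gens fs))).
Proof. by []. Qed.

End GeneratedSigmaAlgebras.

(** * Conditional probabilities by freezing the past *)

Section Freezing.
Context {d d1 : measure_display} {T : measurableType d} {S1 : measurableType d1}
  {R : realType} (mu : probability T R).

(** Independence on rectangles makes the joint law of (Y, D) the product law; its value on S is
    computed by integrating the sections over the law of Y. *)
Lemma freezing (Y : T -> S1) (D : T -> R) (S : set (S1 * R)) :
  measurable_fun setT Y -> measurable_fun setT D -> measurable S ->
  (forall A B, measurable A -> measurable B ->
     (mu (Y @^-1` A `&` D @^-1` B) = mu (Y @^-1` A) * mu (D @^-1` B))%E) ->
  (mu [set om | S (Y om, D om)] = \int[mu]_om mu [set om' | S (Y om, D om')])%E.
Proof.
move=> mY mD mS ind.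
pose Y' : {mfun T >-> S1} := mfun_Sub (mem_set mY).
pose D' : {mfun T >-> R} := mfun_Sub (mem_set mD).
have mZ : measurable_fun setT (fun om => (Y om, D om)) by exact: measurable_fun_pair.
pose Z' : {mfun T >-> (S1 * R)%type} := mfun_Sub (mem_set mZ).
have := @product_measure_unique _ _ _ _ R (distribution mu Y') (distribution mu D')
  (distribution mu Z') _ S mS.
move=> /(_ _)/wrap[]; first by move=> A B mA mB; exact: ind.
rewrite /product_measure1 ge0_integral_distribution//; last exact: measurable_fun_xsection.
move=> E; transitivity (distribution mu Z' S); first by [].
rewrite -E; apply: eq_integral => om _ /=; congr (mu _).
by apply/seteqP; split => om' /=; rewrite /xsection/= inE.
Qed.

End Freezing.

Section LaplaceDither.
Context {d : measure_display} {T : measurableType d} {R : realType} (mu : probability T R).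
Variable D : T -> R.
Hypothesis mD : measurable_fun setT D.
Hypothesis D_laplace : forall x, mu [set om | D om <= x] = (laplace_cdf x)%:E.

Let mDle c : measurable [set om | D om <= c].
Proof.
rewrite (_ : mkset _ = D @^-1` `]-oo, c]%classic); last first.
  by apply/seteqP; split => om /=; rewrite in_itv.
by rewrite -[X in measurable X]setTI; apply: mD.
Qed.

Let mDlt c : measurable [set om | D om < c].
Proof.
rewrite (_ : mkset _ = D @^-1` `]-oo, c[%classic); last first.
  by apply/seteqP; split => om /=; rewrite in_itv.
by rewrite -[X in measurable X]setTI; apply: mD.
Qed.

Lemma laplace_gt c : mu [set om | c < D om] = (laplace_cdf (- c))%:E.
Proof.
have -> : [set om | c < D om] = ~` [set om | D om <= c].
  by apply/seteqP; split => om /=; rewrite ltNge => /negP.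
by rewrite probability_setC ?D_laplace//; rewrite laplace_cdfN.
Qed.

(** The law has no atom: F is 1-Lipschitz, so the mass of D <= c - e is within e of F(c). *)
Lemma laplace_lt c : mu [set om | D om < c] = (laplace_cdf c)%:E.
Proof.
apply/eqP; rewrite eq_le; apply/andP; split.
  rewrite -D_laplace; apply: le_measure; rewrite ?inE//.
  by move=> om /= /ltW.
apply/lee_addgt0Pr => e e0; apply: (@le_trans _ _ ((laplace_cdf (c - e))%:E + e%:E)%E).
  rewrite -EFinD lee_fin; have := @laplace_cdf_lip R c (c - e); rewrite gerBl ltW// => /(_ isT).
  lra.
rewrite leeD2r// -D_laplace; apply: le_measure; rewrite ?inE//.
by move=> om /=; lra.
Qed.

Variable fs : set (T -> R).
Hypothesis mfs : forall f, fs f -> measurable_fun setT f.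
Hypothesis D_indep : forall A B, sigma_of fs A -> measurable B ->
  (mu (A `&` D @^-1` B) = mu A * mu (D @^-1` B))%E.
Variables (x : T -> R) (b C : R).
Hypothesis mx : measurable_wrt (sigma_of fs) x.
Hypothesis b0 : 0 < b.

Let mxT : measurable_fun setT x.
Proof.
move=> _ B mB; rewrite setTI; apply: (sigma_of_measurable mfs); exact: mx.
Qed.

Let frozen (h : T -> R) (P : R -> R -> bool) :
  measurable [set z : R * R | P z.1 z.2] ->
  measurable_fun setT h -> (forall om, 0 <= h om <= 1) ->
  (forall om, mu [set om' | P (x om) (D om')] = (h om)%:E) ->
  cond_exp_zero mu (sigma_of fs) (fun om => (P (x om) (D om))%:R - h om).
Proof.
move=> mP mh h01 hE.
have mPx : measurable [set om | P (x om) (D om)].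
  have mp : measurable_fun setT (fun om => (x om, D om)) by exact: measurable_fun_pair.
  by have := mp measurableT _ mP; rewrite setTI.
have PE : (fun om => (P (x om) (D om))%:R) = (\1_[set om | P (x om) (D om)] : T -> R).
  by apply/funext => om; rewrite indicE mem_setE.
have lP : L1 mu (fun om => (P (x om) (D om))%:R) by rewrite PE; exact: L1_indic.
have lh : L1 mu h.
  apply: (@L1_bdd _ _ _ _ _ 1) => // om; have /andP[? ?] := h01 om.
  by rewrite ger0_norm.
split; first exact: L1B.
move=> A GA; have mA := sigma_of_measurable mfs GA.
rewrite integral_indicM//.
have -> : (fun om => (\1_A om * ((P (x om) (D om))%:R - h om))%:E) =
   (fun om => (\1_A om * (P (x om) (D om))%:R - \1_A om * h om)%:E).
  by apply/funext => om; rewrite mulrBr.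
have lAP : L1 mu (fun om => \1_A om * (P (x om) (D om))%:R) by exact: L1_indicM.
have lAh : L1 mu (fun om => \1_A om * h om) by exact: L1_indicM.
rewrite -EFin_Ex; last exact: L1B.
rewrite ExB//; congr (_%:E); apply/eqP; rewrite subr_eq0; apply/eqP.
apply: EFin_inj; rewrite [RHS]EFin_Ex//.
(* Pairing x with the indicator of the test event A encodes A and the trigger together as one set of
   values of (Y, D), to which [freezing] applies. *)
pose Y om : R * R := (\1_A om, x om).
have mYG : measurable_fun setT (Y : g_sigma_algebraType (sigma_gens fs) -> R * R).
  apply: measurable_fun_pair; last exact/measurable_wrtP.
  exact: measurable_indic.
have mY : measurable_fun setT Y.
  by apply: measurable_fun_pair => //; exact: measurable_indicR.
pose S : set ((R * R) * R) := [set z | 0 < z.1.1 /\ P z.1.2 z.2].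
have mS : measurable S.
  have -> : S = [set z | 0 < z.1.1] `&` (fun z : (R * R) * R => (z.1.2, z.2)) @^-1` [set z : R * R | P z.1 z.2].
    by [].
  have m11 : measurable_fun setT (fun z : (R * R) * R => z.1.1).
    by apply: measurableT_comp => //; exact: measurable_fst.
  have m12 : measurable_fun setT (fun z : (R * R) * R => z.1.2).
    by apply: measurableT_comp => //; exact: measurable_fst.
  apply: measurableI.
    rewrite (_ : mkset _ = (fun z : (R * R) * R => z.1.1) @^-1` `]0, +oo[%classic); last first.
      by apply/seteqP; split => z /=; rewrite in_itv/= andbT.
    by rewrite -[X in measurable X]setTI; exact: m11.
  have mp : measurable_fun setT (fun z : (R * R) * R => (z.1.2, z.2)).
    by apply: measurable_fun_pair => //; exact: measurable_snd.
  by rewrite -[X in measurable X]setTI; exact: mp.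
have ind A' B' : measurable A' -> measurable B' ->
    (mu (Y @^-1` A' `&` D @^-1` B') = mu (Y @^-1` A') * mu (D @^-1` B'))%E.
  move=> mA' mB'; apply: D_indep => //.
  by have := mYG measurableT A' mA'; rewrite setTI.
have := freezing mY mD mS ind.
have -> : [set om | S (Y om, D om)] = A `&` [set om | P (x om) (D om)].
  apply/seteqP; split => om /=; rewrite /S /Y /= indicE.
    by case: (boolP (om \in A)) => [/set_mem ? []//|_ [] /=]; rewrite ltxx.
  by move=> [/mem_set -> ?]; split => //; rewrite ltr01.
move=> E; transitivity (mu (A `&` [set om | P (x om) (D om)])).
  rewrite -Ex_indic; last exact: measurableI.
  by congr (_%:E); apply: eq_Ex => om; rewrite -[X in _ * X]/((fun om => (P (x om) (D om))%:R) om) PE indicI.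
rewrite E; apply: eq_integral => om _; rewrite /S /Y /= indicE.
case: (boolP (om \in A)) => omA.
  rewrite mul1r -hE; congr (mu _); apply/seteqP; split => om' /=; last by split.
  by case.
rewrite mul0r (_ : mkset _ = set0) ?measure0//; apply/seteqP; split => om' //=.
by rewrite ltxx => -[].
Qed.

Let mF (c : R) (s : R) : measurable_fun setT (fun om => laplace_cdf ((s * x om - c) / b)).
Proof.
apply: (@measurableT_comp _ _ _ _ _ _ (@laplace_cdf R)); first exact: measurable_laplace_cdf.
apply: measurable_funM => //; apply: measurable_funB => //.
exact: measurable_funM.
Qed.

Lemma trigger_pos_cond_exp : cond_exp_zero mu (sigma_of fs)
  (fun om => (C < x om + b * D om)%R%:R - laplace_cdf ((x om - C) / b)).
Proof.
apply: (frozen (P := fun s y => C < s + b * y)).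
- rewrite (_ : mkset _ = (fun z : R * R => z.1 + b * z.2) @^-1` `]C, +oo[%classic); last first.
    by apply/seteqP; split => z /=; rewrite in_itv/= andbT.
  rewrite -[X in measurable X]setTI.
  have mm : measurable_fun setT (fun z : R * R => z.1 + b * z.2).
    by apply: measurable_funD => //; apply: measurable_funM.
  exact: mm.
- have := mF C 1; apply: eq_measurable_fun => om _; by rewrite mul1r.
- by move=> om; rewrite laplace_cdf_ge0 laplace_cdf_le1.
- move=> om; rewrite (_ : [set om' | _] = [set om' | (C - x om) / b < D om']).
    by rewrite laplace_gt -mulNr opprB.
  by apply/seteqP; split => om' /=; rewrite ltr_pdivrMr// ltrBlDl mulrC.
Qed.

Lemma trigger_neg_cond_exp : cond_exp_zero mu (sigma_of fs)
  (fun om => (x om + b * D om < - C)%R%:R - laplace_cdf ((- x om - C) / b)).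
Proof.
apply: (frozen (P := fun s y => s + b * y < - C)).
- rewrite (_ : mkset _ = (fun z : R * R => z.1 + b * z.2) @^-1` `]-oo, (- C)[%classic); last first.
    by apply/seteqP; split => z /=; rewrite in_itv/=.
  rewrite -[X in measurable X]setTI.
  have mm : measurable_fun setT (fun z : R * R => z.1 + b * z.2).
    by apply: measurable_funD => //; apply: measurable_funM.
  exact: mm.
- have := mF C (-1); apply: eq_measurable_fun => om _; by rewrite mulN1r.
- by move=> om; rewrite laplace_cdf_ge0 laplace_cdf_le1.
- move=> om; rewrite (_ : [set om' | _] = [set om' | D om' < (- x om - C) / b]).
    by rewrite laplace_lt.
  by apply/seteqP; split => om' /=; rewrite ltr_pdivlMr// (mulrC (D om')); lra.
Qed.

End LaplaceDither.

(** * Independence of the next dither from the past *)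

Section DitherIndependence.
Context {d : measure_display} {T : measurableType d} {R : realType} (mu : probability T R).
Variables (N : nat) (m : 'I_N -> nat)
  (W : forall i : 'I_N, nat -> T -> 'cV[R]_(m i)) (D : 'I_N -> nat -> T -> R).
Hypothesis W_meas : forall i k (r : 'I_(m i)), measurable_fun setT (fun om => W i k om r 0).
Hypothesis D_meas : forall i k, measurable_fun setT (D i k).
Hypothesis indep : mutually_independent mu
     (fun o : option ('I_N * nat) =>
        match o with
        | None => sigmaWall W
        | Some (i, k) => sigma_of [set D i k.+1]
        end).

(** A pi-system whose generated sigma-algebra contains [filtF] at time k: one event of the whole
    noise sequence and one event per dither. The pair (i, t) stands for the dither at time t + 1, as
    in the independence hypothesis. *)
Let cyl k : set (set T) := [set A | exists (A0 : set T) (f : 'I_N * nat -> set T),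
  [/\ sigmaWall W A0, forall q, sigma_of [set D q.1 q.2.+1] (f q) &
      A = A0 `&` \big[setI/setT]_(q <- [seq (i, t) | i <- enum 'I_N, t <- iota 0 k]) f q]].

Let mWall A : sigmaWall W A -> measurable A.
Proof. by apply: sigma_of_measurable => f [i [t [r [_ ->]]]]. Qed.

Let mDs i k A : sigma_of [set D i k] A -> measurable A.
Proof. by apply: sigma_of_measurable => f ->. Qed.

Let sigT fs : sigma_of (fs : set (T -> R)) setT.
Proof.
have [s0 sC _] := sigma_of_sigma_algebra fs.
by rewrite -(setD0 setT); exact: sC.
Qed.

Let sigI fs A B : sigma_of (fs : set (T -> R)) A -> sigma_of fs B -> sigma_of fs (A `&` B).
Proof.
move=> sA sB; have mA := (sigma_of_measurableE fs A).1 sA.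
exact: (measurableI _ _ mA ((sigma_of_measurableE fs B).1 sB)).
Qed.

Let bigI_in (J : seq ('I_N * nat)) (f : 'I_N * nat -> set T) om :
  (\big[setI/setT]_(q <- J) f q) om <-> (forall q, q \in J -> f q om).
Proof. by rewrite -bigcap_seq; split=> H q; exact: H. Qed.

Let cyl_measurable k A : cyl k A -> measurable A.
Proof.
move=> [A0 [f [sA0 sf ->]]]; apply: measurableI; first exact: mWall.
by apply: bigsetI_measurable => q _; apply: mDs (sf q).
Qed.

Let cyl_setI k : setI_closed (cyl k).
Proof.
move=> A B [A0 [f [sA0 sf ->]]] [B0 [g [sB0 sg ->]]].
exists (A0 `&` B0), (fun q => f q `&` g q); split; [exact: sigI|by move=> q; exact: sigI|].
apply/seteqP; split => om /=; rewrite !bigI_in.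
  by move=> [[? Hf] [? Hg]]; split => // q qJ; split; [exact: Hf|exact: Hg].
by move=> [[? ?] H]; split; split => // q qJ; have [] := H q qJ.
Qed.

Let cyl_T k : cyl k setT.
Proof.
exists setT, (fun=> setT); split; [exact: sigT|by move=> q; exact: sigT|].
by rewrite big1// setTI.
Qed.

Let filtF_cyl k : filtF W D k `<=` <<s cyl k >>.
Proof.
apply: sigma_of_least; first exact: smallest_sigma_algebra.
move=> A [f [Hf [B [mB ->]]]]; apply: sub_gen_smallest.
case: Hf => [[i [t [r [/andP[t1 tk] fE]]]]|[i [t [/andP[t1 tk] fE]]]].
  exists (f @^-1` B), (fun=> setT); split; [|by move=> q; exact: sigT|by rewrite big1// setIT].
  by apply: sigma_of_gen => //; exists i, t, r.
exists setT, (fun q => if q == (i, t.-1) then f @^-1` B else setT); split; first exact: sigT.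
  move=> q; case: eqP => [->|_] /=; last exact: sigT.
  by apply: sigma_of_gen => //=; rewrite prednK.
rewrite setTI; apply/seteqP; split => om; rewrite bigI_in.
  by move=> fB q _; case: eqP.
move=> /(_ (i, t.-1)); rewrite eqxx; apply.
apply/allpairsP; exists (i, t.-1); split => //=; first by rewrite mem_enum.
by rewrite mem_iota/= add0n prednK.
Qed.

(** The restriction of mu to the dither event and mu scaled by the mass of that event are finite
    measures; mutual independence makes them agree on the pi-system, hence on the past. *)
Lemma dither_indep_past j k A B : filtF W D k A -> measurable B ->
  (mu (A `&` D j k.+1 @^-1` B) = mu A * mu (D j k.+1 @^-1` B))%E.
Proof.
move=> FA mB; set Dj := D j k.+1 @^-1` B.
have mDj : measurable Dj by rewrite -[Dj]setTI; exact: D_meas.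
have sDj : sigma_of [set D j k.+1] Dj by exact: sigma_of_gen.
pose c := fine (mu Dj); have cE : mu Dj = c%:E by rewrite /c fineK// fin_num_measure.
have c0 : 0 <= c by rewrite fine_ge0.
pose m1 := mrestr mu mDj; pose m2 := mscale (NngNum c0) mu.
suff : m1 A = m2 A by rewrite /m1 /m2 /mrestr /mscale/= cE muleC.
apply: (@g_sigma_algebra_measure_unique _ R T (cyl k) _ (fun=> setT)).
- exact: cyl_measurable.
- by move=> _; exact: cyl_T.
- by apply/seteqP; split => // om _; exists 0%N.
- exact: cyl_setI.
- move=> _ [A0 [f [sA0 sf ->]]].
  set J := [seq (i, t) | i <- enum 'I_N, t <- iota 0 k].
  have uJ : uniq J by apply: allpairs_uniq; rewrite ?enum_uniq ?iota_uniq// => -[? ?] [? ?] _ _ [-> ->].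
  pose J1 : seq (option ('I_N * nat)) := None :: [seq Some q | q <- J].
  pose E o := match o with None => A0 | Some q => if q == (j, k) then Dj else f q end.
  have nJ : (j, k) \notin J.
    apply/allpairsP => -[[i t] /= [_ ti [_ kt]]].
    by move: ti; rewrite mem_iota -kt add0n ltnn.
  have uJ1 : uniq J1.
    rewrite /J1 /= map_inj_uniq ?uJ ?andbT; last by move=> ? ? [].
    by apply/mapP => -[].
  have nJ1 : Some (j, k) \notin J1.
    by rewrite inE/= mem_map// => ? ? [].
  have EG o : match o with None => sigmaWall W | Some (i, k0) => sigma_of [set D i k0.+1] end (E o).
    case: o => [[i t]|//] /=; case: eqP => [[-> ->]//|_]; exact: (sf (i, t)).
  have bigE : \big[setI/setT]_(o <- J1) E o = A0 `&` \big[setI/setT]_(q <- J) f q.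
    rewrite /J1 big_cons big_map; congr (_ `&` _); apply: eq_big_seq => q qJ /=.
    by case: eqP => // qE; move: nJ; rewrite -qE qJ.
  have I1 := indep uJ1 (fun o _ => EG o).
  have uJ2 : uniq (Some (j, k) :: J1) by rewrite cons_uniq nJ1 uJ1.
  have I2 := indep uJ2 (fun o _ => EG o).
  rewrite big_cons [X in _ = X]big_cons bigE /= eqxx in I2; rewrite bigE in I1.
  transitivity (mu (Dj `&` (A0 `&` \big[setI/setT]_(q <- J) f q))).
    by rewrite /m1 /mrestr [in RHS]setIC.
  by rewrite I2 cE -I1.
- by move=> _; change (mu (setT `&` Dj) < +oo)%E; rewrite setTI cE ltry.
- exact: filtF_cyl.
Qed.

Lemma filtF_measurable k A : filtF W D k A -> measurable A.
Proof.
by apply: sigma_of_measurable => f [[i [t [r [_ ->]]]]|[i [t [_ ->]]]].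
Qed.

Lemma filtF_mono k l : (k <= l)%N -> filtF W D k `<=` filtF W D l.
Proof.
move=> kl; apply: sigma_of_mono => f [[i [t [r [/andP[t1 tk] ->]]]]|[i [t [/andP[t1 tk] ->]]]].
  by left; exists i, t, r; rewrite t1 (leq_trans tk kl).
by right; exists i, t; rewrite t1 (leq_trans tk kl).
Qed.

Lemma filtFw_mono k l : (k <= l)%N -> filtFw W k `<=` filtFw W l.
Proof.
move=> kl; apply: sigma_of_mono => f [i [t [r [/andP[t1 tk] ->]]]].
by exists i, t, r; rewrite t1 (leq_trans tk kl).
Qed.

Lemma filtFw_sub k : filtFw W k `<=` filtF W D k.
Proof. by apply: sigma_of_mono => f Hf; left. Qed.

End DitherIndependence.

(** * One step of the algorithm *)

Section MeasurableWrtClosure.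
Context {d : measure_display} {T : measurableType d} {R : realType} (fs : set (T -> R)).
Implicit Types f g : T -> R.
Local Notation mw := (@measurable_wrt d T R (sigma_of fs)).

Lemma mw_cst c : mw (fun=> c).
Proof. by apply/measurable_wrtP; exact: measurable_cst. Qed.

Lemma mw_eq f g : f =1 g -> mw g -> mw f.
Proof. by move=> /funext ->. Qed.

Lemma mwD f g : mw f -> mw g -> mw (fun x => f x + g x).
Proof. by move=> /measurable_wrtP mf /measurable_wrtP mg; apply/measurable_wrtP; exact: measurable_funD. Qed.

Lemma mwM f g : mw f -> mw g -> mw (fun x => f x * g x).
Proof. by move=> /measurable_wrtP mf /measurable_wrtP mg; apply/measurable_wrtP; exact: measurable_funM. Qed.

Lemma mw_comp (h : R -> R) f : measurable_fun setT h -> mw f -> mw (fun x => h (f x)).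
Proof. by move=> mh mf B mB; apply: (mf (h @^-1` B)); rewrite -[X in measurable X]setTI; exact: mh. Qed.

Lemma mwZ c f : mw f -> mw (fun x => c * f x).
Proof. by move=> mf; apply: mwM => //; exact: mw_cst. Qed.

Lemma mwN f : mw f -> mw (fun x => - f x).
Proof. by move=> mf; apply: mw_comp => //; exact: oppr_measurable. Qed.

Lemma mwB f g : mw f -> mw g -> mw (fun x => f x - g x).
Proof. by move=> mf mg; apply: mwD => //; exact: mwN. Qed.

Lemma mw_sum (I : Type) (s : seq I) (P : pred I) (F : I -> T -> R) :
  (forall i, P i -> mw (F i)) -> mw (fun x => \sum_(i <- s | P i) F i x).
Proof.
move=> mF; elim: s => [|i s IH].
  by under eq_fun do rewrite big_nil; exact: mw_cst.
under eq_fun do rewrite big_cons.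
by case: (boolP (P i)) => Pi //; apply: mwD => //; exact: mF.
Qed.

Lemma mw_sqr f : mw f -> mw (fun x => f x ^+ 2).
Proof. by move=> mf; under eq_fun do rewrite expr2; exact: mwM. Qed.

Lemma mw_indic (A : set T) : sigma_of fs A -> mw (\1_A : T -> R).
Proof. by move=> sA; apply/measurable_wrtP; apply: measurable_indic. Qed.

Lemma mw_le f c : mw f -> sigma_of fs [set x | f x <= c].
Proof.
move=> mf; rewrite (_ : mkset _ = f @^-1` `]-oo, c]%classic); first exact: mf.
by apply/seteqP; split => x /=; rewrite in_itv.
Qed.

Lemma mw_lt0 f g : mw f -> mw g -> mw (fun x => (f x < g x)%R%:R).
Proof.
move=> mf mg; have mh := mwB mg mf.
rewrite (_ : (fun x => _) = \1_((fun x => g x - f x) @^-1` `]0, +oo[%classic)); last first.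
  apply/funext => x; rewrite indicE; congr ((nat_of_bool _)%:R).
  apply/idP/idP => [fg|/set_mem/=]; last by rewrite in_itv/= andbT subr_gt0.
  by apply/mem_set => /=; rewrite in_itv/= andbT subr_gt0.
by apply: mw_indic; exact: mh.
Qed.

Lemma mw_measurable f : (forall g, fs g -> measurable_fun setT g) -> mw f ->
  measurable_fun setT f.
Proof.
by move=> mfs mf _ B mB; rewrite setTI; apply: (sigma_of_measurable mfs); exact: mf.
Qed.

End MeasurableWrtClosure.

Section Trigger.
Context {R : realType} {N n : nat} (nu b : 'I_N -> 'I_N -> R) (dd : 'I_N -> nat -> R).
Implicit Types (prev : 'I_N -> 'cV[R]_n).

Definition trig_pos prev i j k : bool :=
  CSC nu b i j k < xSC (prev i) k + b i j * dd i k.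
Definition trig_neg prev i j k : bool :=
  xSC (prev i) k + b i j * dd i k < - CSC nu b i j k.

Variables (i j : 'I_N) (k : nat).
Hypothesis C0 : 0 <= CSC nu b i j k.

(** For C >= 0 the two one-sided triggers are disjoint and each fixes the sign of the bit. Each is a
    half-line condition on the dither, so its conditional probability is a value of F. *)
Lemma shatSC_trig prev :
  shatSC nu b dd prev i j k = (trig_pos prev i j k)%:R - (trig_neg prev i j k)%:R.
Proof.
rewrite /shatSC /sendsSC /sSC /trig_pos /trig_neg; set y := _ + _; set C := CSC _ _ _ _ _.
case: (leP 0 y) => y0.
  rewrite ger0_norm//; have -> : (y < - C) = false by apply/negbTE; rewrite -leNgt (le_trans _ y0)// oppr_le0.
  by case: (ltP C y) => Cy; rewrite subr0// (le_lt_trans C0 Cy).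
rewrite ltr0_norm//; have -> : (C < y) = false by apply/negbTE; rewrite -leNgt (le_trans (ltW y0)).
by rewrite ltrNr; case: ifP => Cy; rewrite sub0r ?oppr0//; rewrite ltNge (ltW y0).
Qed.

Lemma sendsSC_trig prev :
  (sendsSC nu b dd prev i j k)%:R = (trig_pos prev i j k)%:R + (trig_neg prev i j k)%:R :> R.
Proof.
rewrite /sendsSC /trig_pos /trig_neg; set y := _ + _; set C := CSC _ _ _ _ _.
case: (leP 0 y) => y0.
  rewrite ger0_norm//; have -> : (y < - C) = false by apply/negbTE; rewrite -leNgt (le_trans _ y0)// oppr_le0.
  by rewrite addr0.
rewrite ltr0_norm//; have -> : (C < y) = false by apply/negbTE; rewrite -leNgt (le_trans (ltW y0)).
by rewrite ltrNr add0r.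
Qed.

Lemma shatSC_sq prev : (shatSC nu b dd prev i j k : R) ^+ 2 = (sendsSC nu b dd prev i j k)%:R.
Proof.
rewrite /shatSC /sSC; case: ifP => _; last by rewrite expr0n.
by case: ifP => _; rewrite ?sqrrN expr1n.
Qed.

(** The conditional probability of a message in state x. [GSC] is the difference of the same two
    terms, that is, the conditional mean of the received symbol. *)
Definition psend (x : R) : R :=
  laplace_cdf ((x - CSC nu b i j k) / b i j) + laplace_cdf ((- x - CSC nu b i j k) / b i j).

Hypothesis b0 : 0 < b i j.

Lemma psend_ge0 x : 0 <= psend x.
Proof. by rewrite addr_ge0 ?laplace_cdf_ge0. Qed.

Lemma psend_le1 x : psend x <= 1.
Proof.
have A : laplace_cdf ((x - CSC nu b i j k) / b i j) <= laplace_cdf (x / b i j).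
  by apply: laplace_cdf_nd; rewrite ler_pM2r ?invr_gt0// gerBl.
have B : laplace_cdf ((- x - CSC nu b i j k) / b i j) <= laplace_cdf (- (x / b i j)).
  by apply: laplace_cdf_nd; rewrite -[- (x / _)]mulNr ler_pM2r ?invr_gt0// gerBl.
by rewrite laplace_cdfN in B; rewrite /psend; lra.
Qed.

Lemma GSC_sq_le x : GSC nu b i j k x ^+ 2 <= psend x.
Proof.
have := psend_le1 x; have p0 := psend_ge0 x; rewrite /GSC; move: p0; rewrite /psend.
have := laplace_cdf_ge0 ((x - CSC nu b i j k) / b i j).
have := laplace_cdf_ge0 ((- x - CSC nu b i j k) / b i j).
move: (laplace_cdf _) (laplace_cdf _) => u v u0 v0 uv0 uv1.
have : 0 <= u * v by rewrite mulr_ge0.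
have : (u + v) * (u + v) <= u + v by rewrite ler_piMr.
rewrite expr2; nra.
Qed.

(** The threshold is scaled so that exp(-C / b) = k^(-nu); the bound F(u) <= exp(u) / 2 lets this
    factor come out. *)
Lemma psend_le_cosh x : (0 < k)%N ->
  psend x <= (expR (x / b i j) + expR (- (x / b i j))) / 2 * k%:R `^ (- nu i j).
Proof.
move=> k0; have kp : 0 < k%:R :> R by rewrite ltr0n.
have E y : laplace_cdf ((y - CSC nu b i j k) / b i j) <= expR (y / b i j) / 2 * k%:R `^ (- nu i j).
  apply: (le_trans (laplace_cdf_le_expR _)).
  rewrite /powR gt_eqF// mulrAC -expRD ler_pM2r// ler_expR /CSC.
  by rewrite le_eqVlt; apply/orP; left; apply/eqP; field; rewrite gt_eqF.
have := E x; have := E (- x); rewrite /psend mulNr; lra.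
Qed.

(** Both shifted copies of F are evaluated within (X + C) / b of 0, where the density is at least
    exp(-(X + C) / b) / 2. The two halves add up, and exp(-C / b) is again k^(-nu). *)
Lemma GSC_slope x y X : (0 < k)%N -> `|x| <= X -> `|y| <= X ->
  expR (- (X / b i j)) / b i j * k%:R `^ (- nu i j) * (x - y) ^+ 2 <=
  (x - y) * (GSC nu b i j k x - GSC nu b i j k y).
Proof.
move=> k0; have kp : 0 < k%:R :> R by rewrite ltr0n.
wlog yx : x y / y <= x => [H|] xX yX.
  case: (leP y x) => [yx|/ltW xy]; first exact: H.
  rewrite -(opprB y x) sqrrN mulNr -mulrN opprB; exact: H.
have X0 : 0 <= X by exact: le_trans xX.
set C := CSC nu b i j k.
have nb u : `|u| <= X + C -> `|u / b i j| <= (X + C) / b i j.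
  by move=> uX; rewrite normrM normfV (gtr0_norm b0) ler_pM2r ?invr_gt0.
have na u s : `|u| <= X -> s = 1 \/ s = -1 -> `|s * u - C| <= X + C.
  move=> uX s1; apply: (le_trans (ler_normB _ _)); rewrite normrM (ger0_norm C0) lerD2r.
  by case: s1 => ->; rewrite ?normrN normr1 mul1r.
have d1 := @laplace_cdf_diff R ((x - C) / b i j) ((y - C) / b i j) ((X + C) / b i j).
have d2 := @laplace_cdf_diff R ((- y - C) / b i j) ((- x - C) / b i j) ((X + C) / b i j).
have {}d1 : (x - y) / b i j * (expR (- ((X + C) / b i j)) / 2) <=
    laplace_cdf ((x - C) / b i j) - laplace_cdf ((y - C) / b i j).
  rewrite (_ : (x - y) / b i j = (x - C) / b i j - (y - C) / b i j); last by field; rewrite gt_eqF.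
  apply: d1; first by rewrite ler_pM2r ?invr_gt0// lerD2r.
    by apply: nb; have := na x 1 xX (or_introl erefl); rewrite mul1r.
  by apply: nb; have := na y 1 yX (or_introl erefl); rewrite mul1r.
have {}d2 : (x - y) / b i j * (expR (- ((X + C) / b i j)) / 2) <=
    laplace_cdf ((- y - C) / b i j) - laplace_cdf ((- x - C) / b i j).
  rewrite (_ : (x - y) / b i j = (- y - C) / b i j - (- x - C) / b i j); last by field; rewrite gt_eqF.
  apply: d2; first by rewrite ler_pM2r ?invr_gt0// lerD2r lerN2.
    by apply: nb; have := na y (-1) yX (or_intror erefl); rewrite mulN1r.
  by apply: nb; have := na x (-1) xX (or_intror erefl); rewrite mulN1r.
have EX : expR (- ((X + C) / b i j)) = expR (- (X / b i j)) * k%:R `^ (- nu i j).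
  rewrite /powR gt_eqF// -expRD; congr expR; rewrite /C /CSC; field.
  by rewrite gt_eqF.
have G : (x - y) / b i j * expR (- ((X + C) / b i j)) <= GSC nu b i j k x - GSC nu b i j k y.
  by rewrite /GSC -/C; lra.
have xy0 : 0 <= x - y by rewrite subr_ge0.
have := ler_wpM2l xy0 G; rewrite EX; apply: le_trans.
by rewrite le_eqVlt; apply/orP; left; apply/eqP; ring.
Qed.

End Trigger.

Section ZeroMean.
Context {d : measure_display} {T : measurableType d} {R : realType} (mu : probability T R).
Implicit Types f g : T -> R.

Definition zero_mean f := L1 mu f /\ Ex mu f = 0.

Lemma zero_mean_sum (I : Type) (s : seq I) (P : pred I) (F : I -> T -> R) :
  (forall i, P i -> zero_mean (F i)) -> zero_mean (fun x => \sum_(i <- s | P i) F i x).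
Proof.
move=> zF; split; first by apply: L1_sum => i /zF[].
by rewrite Ex_sum => [|i /zF[]//]; rewrite big1// => i /zF[].
Qed.

Lemma zero_meanZ c f : zero_mean f -> zero_mean (fun x => c * f x).
Proof. by move=> [lf f0]; split; [exact: L1Z|rewrite ExZ// f0 mulr0]. Qed.

Lemma zero_meanD f g : zero_mean f -> zero_mean g -> zero_mean (fun x => f x + g x).
Proof. by move=> [lf f0] [lg g0]; split; [exact: L1D|rewrite ExD// f0 g0 addr0]. Qed.

Lemma zero_meanB f g : zero_mean f -> zero_mean g -> zero_mean (fun x => f x - g x).
Proof. by move=> [lf f0] [lg g0]; split; [exact: L1B|rewrite ExB// f0 g0 subr0]. Qed.

Lemma zero_meanM fs u Z B : (forall f, fs f -> measurable_fun setT f) ->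
  cond_exp_zero mu (sigma_of fs) Z -> measurable_wrt (sigma_of fs) u ->
  (forall x, `|u x| <= B) -> zero_mean (fun x => u x * Z x).
Proof.
move=> mfs cZ mu_ uB; split.
  by apply: L1M uB _; [exact: mw_measurable mfs mu_|case: cZ].
by apply: orthogonal_to_bounded cZ mu_ uB => A; exact: sigma_of_measurable.
Qed.

End ZeroMean.

Section Step.
Context {R : realType} {N n : nat} (a : 'I_N -> 'I_N -> R) (m : 'I_N -> nat)
  (H : forall i : 'I_N, nat -> 'M[R]_(m i, n)) (theta : 'cV[R]_n)
  (nu b : 'I_N -> 'I_N -> R) (alpha : 'I_N -> 'I_N -> nat -> R) (beta : 'I_N -> nat -> R)
  (w : forall i : 'I_N, nat -> 'cV[R]_(m i)) (dd : 'I_N -> nat -> R).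
Hypothesis a_sym : forall i j, a i j = a j i.
Implicit Types (prev : 'I_N -> 'cV[R]_n) (i j : 'I_N) (k : nat).

(** Extended by 0 off the edges, so that sums over all ordered pairs can be exchanged and
    symmetrised. *)
Definition ew k i j : R := if 0 < a i j then alpha i j k * a i j else 0.

Definition consensus_inc k prev i : R :=
  \sum_j ew k i j * (shatSC nu b dd prev j i k - GSC nu b i j k (xSC (prev i) k)).

Lemma stepSC_inc k prev i :
  stepSC a H theta nu b alpha beta w dd k prev i - prev i =
  consensus_inc k prev i *: phiSC R n k +
  beta i k *: ((H i k)^T *m (w i k - H i k *m (prev i - theta))).
Proof.
rewrite /stepSC /= addrC !addrA addNr add0r; congr (_ + _); last first.
  by congr (_ *: (_ *m _)); rewrite mulmxBr opprB addrCA addrA.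
congr (_ *: _); rewrite /consensus_inc big_mkcond; apply: eq_bigr => j _; rewrite /ew.
by case: ifP; rewrite ?mul0r.
Qed.

Definition step_drift k prev : R :=
  \sum_i \sum_j ew k i j * ((xSC (prev i) k - xSC (prev j) k) *
     (GSC nu b i j k (xSC (prev i) k) - GSC nu b i j k (xSC (prev j) k))) +
  2 * \sum_i beta i k * nsq (H i k *m (prev i - theta)).

Definition dither_noise k prev j i : R :=
  ((trig_pos nu b dd prev j i k)%:R - laplace_cdf ((xSC (prev j) k - CSC nu b j i k) / b j i)) -
  ((trig_neg nu b dd prev j i k)%:R - laplace_cdf ((- xSC (prev j) k - CSC nu b j i k) / b j i)).

Definition step_mart k prev : R :=
  2 * \sum_i \sum_j ew k i j * (xSC (prev i - theta) k * dither_noise k prev j i) +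
  2 * \sum_i beta i k * dotv (H i k *m (prev i - theta)) (w i k).

Section AtTime.
Variable k : nat.
Hypothesis alpha_sym : forall i j, 0 < a i j -> alpha i j k = alpha j i k.
Hypothesis nu_sym : forall i j, 0 < a i j -> nu i j = nu j i.
Hypothesis b_sym : forall i j, 0 < a i j -> b i j = b j i.
Hypothesis C0 : forall i j, 0 < a i j -> 0 <= CSC nu b i j k.

Let ew_sym i j : ew k i j = ew k j i.
Proof. by rewrite /ew (a_sym j i); case: ifP => // aij; rewrite alpha_sym. Qed.

Let G_sym i j x : 0 < a i j -> GSC nu b j i k x = GSC nu b i j k x.
Proof. by move=> aij; rewrite /GSC /CSC (nu_sym aij) (b_sym aij). Qed.

(** The square is expanded around the old error. Adding and subtracting the conditional mean G(x_j)
    of the received symbol splits the consensus term into centred dither noise and a deterministic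
    part, which symmetry turns into the drift. *)
Lemma step_expansion prev :
  vsq (stepSC a H theta nu b alpha beta w dd k prev \- (fun=> theta)) =
  vsq (prev \- (fun=> theta)) - step_drift k prev + step_mart k prev +
  vsq (stepSC a H theta nu b alpha beta w dd k prev \- prev).
Proof.
set new := stepSC a H theta nu b alpha beta w dd k prev.
have E1 : vsq (new \- (fun=> theta)) = vsq (prev \- (fun=> theta)) +
    2 * \sum_i dotv (prev i - theta) (new i - prev i) + vsq (new \- prev).
  rewrite /vsq mulr_sumr -!big_split/=; apply: eq_bigr => i _.
  by rewrite -nsqD; congr nsq; rewrite [RHS]addrC addrA subrK.
rewrite E1; congr (_ + _); rewrite -addrA; congr (_ + _).
have E2 i : dotv (prev i - theta) (new i - prev i) =
    \sum_j ew k i j * (xSC (prev i - theta) k * dither_noise k prev j i) +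
    \sum_j ew k i j * (xSC (prev i - theta) k *
       (GSC nu b i j k (xSC (prev j) k) - GSC nu b i j k (xSC (prev i) k))) +
    (beta i k * dotv (H i k *m (prev i - theta)) (w i k)
     - beta i k * nsq (H i k *m (prev i - theta))).
  rewrite stepSC_inc dotvDr !dotvZr dotv_mul dotvBr -nsqE mulrBr; congr (_ + _).
  rewrite dotvC -xSCE /consensus_inc mulr_suml -big_split/=; apply: eq_bigr => j _.
  rewrite /ew; case: ifP => aij; last by rewrite !mul0r addr0.
  have aji : 0 < a j i by rewrite a_sym.
  rewrite shatSC_trig; last exact: C0.
  rewrite /dither_noise -(G_sym (xSC (prev j) k) aij) /GSC; ring.
(* Exchanging i and j and averaging turns x_i (G(x_j) - G(x_i)) into - (x_i - x_j) (G(x_i) - G(x_j))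
   / 2; theta cancels in the difference. *)
have E3 : 2 * \sum_i \sum_j ew k i j * (xSC (prev i - theta) k *
       (GSC nu b i j k (xSC (prev j) k) - GSC nu b i j k (xSC (prev i) k))) =
  - \sum_i \sum_j ew k i j * ((xSC (prev i) k - xSC (prev j) k) *
     (GSC nu b i j k (xSC (prev i) k) - GSC nu b i j k (xSC (prev j) k))).
  set S := \sum_i \sum_j _.
  have S' : S = \sum_i \sum_j ew k i j * (xSC (prev j - theta) k *
       (GSC nu b i j k (xSC (prev i) k) - GSC nu b i j k (xSC (prev j) k))).
    rewrite /S exchange_big; apply: eq_bigr => i _; apply: eq_bigr => j _.
    rewrite /= ew_sym /ew; case: ifP => aij; last by rewrite !mul0r.
    by rewrite !(G_sym _ aij).
  rewrite mulr_natl mulr2n {1}S' /S -big_split -sumrN/=; apply: eq_bigr => i _.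
  rewrite -big_split -sumrN/=; apply: eq_bigr => j _; rewrite !xSCB; ring.
rewrite (eq_bigr _ (fun i _ => E2 i)) !big_split/= !mulrDr E3 /step_drift /step_mart sumrN.
ring.
Qed.

Variable Hbar : R.
Hypothesis Hbar0 : 0 < Hbar.
Hypothesis H_norm : forall i, opnorm_le (H i k) Hbar.
Hypothesis b0 : forall i j, 0 < a i j -> 0 < b i j.

Lemma sum_sqr_le (c : 'I_N -> R) : (\sum_j c j) ^+ 2 <= N%:R * \sum_j c j ^+ 2.
Proof.
have := @nsq_sum_le R 1 N (fun l => \col__ (if insub l is Some j then c j else 0)).
rewrite !big_mkord.
have E (z : 'cV[R]_1) : nsq z = z 0 0 ^+ 2 by rewrite /nsq big_ord1.
rewrite E summxE; under eq_bigr do rewrite mxE valK.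
by under [X in _ <= _ * X]eq_bigr do rewrite E mxE valK.
Qed.

(** The square of a received symbol is the sending indicator, and G^2 is at most the sending
    probability. Keeping the probability here, instead of bounding the symbol by 1, yields the noise
    order k^(-2 gamma - nu) and hence h. *)
Lemma step_inc_bound prev :
  vsq (stepSC a H theta nu b alpha beta w dd k prev \- prev) <=
  \sum_i (4 * N%:R * (\sum_j ew k i j ^+ 2 *
     ((sendsSC nu b dd prev j i k)%:R + psend nu b i j k (xSC (prev i) k)))
   + 4 * Hbar ^+ 2 * beta i k ^+ 2 * nsq (w i k)
   + 4 * Hbar ^+ 4 * beta i k ^+ 2 * nsq (prev i - theta)).
Proof.
rewrite /vsq; apply: ler_sum => i _; rewrite /= stepSC_inc.
apply: (le_trans (nsqD_le _ _)); rewrite !nsqZ.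
have A1 : 2 * (consensus_inc k prev i ^+ 2 * nsq (phiSC R n k)) <= 4 * N%:R * (\sum_j ew k i j ^+ 2 *
     ((sendsSC nu b dd prev j i k)%:R + psend nu b i j k (xSC (prev i) k))).
  apply: (@le_trans _ _ (2 * consensus_inc k prev i ^+ 2)).
    by rewrite ler_wpM2l// ler_piMr ?sqr_ge0// phiSC_nsq_le1.
  have := sum_sqr_le (fun j => ew k i j * (shatSC nu b dd prev j i k - GSC nu b i j k (xSC (prev i) k))).
  rewrite -/(consensus_inc k prev i) => S.
  have S2 : \sum_j (ew k i j * (shatSC nu b dd prev j i k - GSC nu b i j k (xSC (prev i) k))) ^+ 2 <=
     \sum_j 2 * (ew k i j ^+ 2 * ((sendsSC nu b dd prev j i k)%:R + psend nu b i j k (xSC (prev i) k))).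
    apply: ler_sum => j _; rewrite exprMn [leRHS]mulrCA.
    case: (boolP (0 < a i j)) => aij; last by rewrite /ew (negbTE aij) expr0n/= !mul0r.
    rewrite ler_wpM2l ?sqr_ge0// -(shatSC_sq nu b dd j i k prev).
    have := GSC_sq_le (C0 aij) (b0 aij) (xSC (prev i) k).
    move: (shatSC _ _ _ _ _ _ _) (GSC _ _ _ _ _ _) (psend _ _ _ _ _ _) => s g q.
    have := sqr_ge0 (s + g); rewrite !expr2; lra.
  rewrite -mulr_sumr in S2.
  have := ler_wpM2l (ler0n R N) S2; lra.
have A2 : nsq ((H i k)^T *m (w i k - H i k *m (prev i - theta))) <=
    Hbar ^+ 2 * (2 * nsq (w i k) + 2 * (Hbar ^+ 2 * nsq (prev i - theta))).
  apply: (le_trans (opnorm_tr_nsq _ (H_norm i) Hbar0)).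
  rewrite ler_wpM2l ?sqr_ge0//; apply: (le_trans (nsqD_le _ _)); rewrite nsqN lerD2l ler_wpM2l//.
  exact: opnorm_nsq (H_norm i) (ltW Hbar0).
have := ler_wpM2l (sqr_ge0 (beta i k)) A2.
have -> : Hbar ^+ 4 = Hbar ^+ 2 * Hbar ^+ 2 by rewrite -exprD.
lra.
Qed.

End AtTime.
End Step.

(** * The stochastic recursion *)

Section SC.
Context (R : realType) (disp : measure_display) (T : measurableType disp)
  (mu : probability T R) (N : nat) (a : 'I_N -> 'I_N -> R).
Hypothesis a_ge0 : forall i j, 0 <= a i j.
Hypothesis a_sym : forall i j, a i j = a j i.
Context (n : nat) (theta : 'cV[R]_n) (m : 'I_N -> nat)
  (H : forall i : 'I_N, nat -> 'M[R]_(m i, n))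
  (W : forall i : 'I_N, nat -> T -> 'cV[R]_(m i))
  (D : 'I_N -> nat -> T -> R) (Hbar : R).
Hypothesis Hbar0 : 0 < Hbar.
Hypothesis H_norm : forall i k, (1 <= k)%N -> opnorm_le (H i k) Hbar.
Hypothesis W_meas : forall i k (r : 'I_(m i)), measurable_fun setT (fun om => W i k om r 0).
Hypothesis W_mds : forall i k (r : 'I_(m i)), (1 <= k)%N ->
     cond_exp_zero mu (filtF W D k.-1) (fun om => W i k om r 0).
Context (rho : R) (Y : 'I_N -> nat -> T -> R).
Hypothesis rho2 : 2 < rho.
Hypothesis Y_cond : forall i k, (1 <= k)%N ->
          is_cond_exp_nonneg mu (filtFw W k.-1)
            (fun om => vnorm (W i k om) `^ rho) (Y i k).
Hypothesis D_meas : forall i k, measurable_fun setT (D i k).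
Hypothesis D_lap : forall i k (x : R), (1 <= k)%N ->
     mu [set om | D i k om <= x] = (laplace_cdf x)%:E.
Hypothesis indep : mutually_independent mu
     (fun o : option ('I_N * nat) =>
        match o with
        | None => sigmaWall W
        | Some (i, k) => sigma_of [set D i k.+1]
        end).
Context (th0 : 'I_N -> 'cV[R]_n) (nu b : 'I_N -> 'I_N -> R)
  (alpha : 'I_N -> 'I_N -> nat -> R) (beta : 'I_N -> nat -> R).
Hypothesis Hnu : forall i j, 0 < a i j -> 0 <= nu i j /\ nu i j = nu j i.
Hypothesis Hb : forall i j, 0 < a i j -> 0 < b i j /\ b i j = b j i.
Hypothesis Halpha : forall i j k, 0 < a i j -> (1 <= k)%N ->
     0 < alpha i j k /\ alpha i j k = alpha j i k.
Hypothesis Hbeta : forall i k, (1 <= k)%N -> 0 < beta i k.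

(* The suffix P marks processes on the sample space. Step k.+1 is the one leaving
   the state at time k, so incP, driftP, zetaP and pP at index k belong to
   iteration k.+1 of the algorithm. *)
Definition estP k om : 'I_N -> 'cV[R]_n :=
  estSC a H theta th0 nu b alpha beta (fun i' k' => W i' k' om) (fun i' k' => D i' k' om) k.
Definition errP k om : 'I_N -> 'cV[R]_n := estP k om \- (fun=> theta).
Definition VP k om : R := vsq (errP k om).
Definition incP k om : R := vsq (estP k.+1 om \- estP k om).
Definition driftP k om : R := step_drift a H theta nu b alpha beta k.+1 (estP k om).
Definition zetaP i j k om : R := (sendsSC nu b (fun i' k' => D i' k' om) (estP k om) i j k.+1)%:R.
Definition pP i j k om : R := psend nu b i j k.+1 (xSC (estP k om i) k.+1).

Local Notation mF k := (@measurable_wrt disp T R (filtF W D k)).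

Definition fsF k : set (T -> R) :=
  [set f | (exists i t r, (1 <= t <= k)%N /\ f = fun om => W i t om r 0) \/
           (exists i t, (1 <= t <= k)%N /\ f = D i t)].

Lemma fsF_meas k f : fsF k f -> measurable_fun setT f.
Proof. by move=> [[i [t [r [_ ->]]]]|[i [t [_ ->]]]]. Qed.

Lemma CSC_ge0 i j k : 0 < a i j -> (0 < k)%N -> 0 <= CSC nu b i j k.
Proof.
move=> aij k0; rewrite !mulr_ge0//; [by case: (Hnu aij)|by apply/ltW; case: (Hb aij)|].
by rewrite ln_ge0// ler1n.
Qed.

Lemma a_edge_sym i j : 0 < a i j -> 0 < a j i.
Proof. by rewrite a_sym. Qed.

Lemma xSC_mw k l (f : T -> 'I_N -> 'cV[R]_n) i :
  (forall r, mF k (fun om => f om i r 0)) -> mF k (fun om => xSC (f om i) l).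
Proof.
move=> mf; under eq_fun do rewrite xSCE.
by apply: mw_sum => r _; apply: mwZ.
Qed.

Lemma estP_mw k : forall i r, mF k (fun om => estP k om i r 0).
Proof.
elim: k => [|k IH] i r; first exact: mw_cst.
have sub : filtF W D k `<=` filtF W D k.+1 by exact: filtF_mono.
have mest i' r' : mF k.+1 (fun om => estP k om i' r' 0) by exact: measurable_wrtS (IH i' r').
have mW i' r' : mF k.+1 (fun om => W i' k.+1 om r' 0).
  by apply: sigma_of_gen; left; exists i', k.+1, r'; rewrite leqnn.
have mD i' : mF k.+1 (D i' k.+1).
  by apply: sigma_of_gen; right; exists i', k.+1; rewrite leqnn.
have mx i' : mF k.+1 (fun om => xSC (estP k om i') k.+1) by exact: xSC_mw.
have -> : (fun om => estP k.+1 om i r 0) = (fun om => estP k om i r 0 +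
   (\sum_j ew a alpha k.+1 i j * ((shatSC nu b (fun i' k' => D i' k' om) (estP k om) j i k.+1) -
       GSC nu b i j k.+1 (xSC (estP k om i) k.+1)) * phiSC R n k.+1 r 0
   + beta i k.+1 * \sum_s H i k.+1 s r * (W i k.+1 om s 0 - \sum_q H i k.+1 s q * (estP k om i q 0 - theta q 0)))).
  apply/funext => om; rewrite -[LHS](subrK (estP k om i r 0)) addrC; congr (_ + _).
  have := stepSC_inc a H theta nu b alpha beta (fun i' k' => W i' k' om) (fun i' k' => D i' k' om)
    k.+1 (estP k om) i.
  move=> /(congr1 (fun M : 'cV[R]_n => M r 0)); rewrite [LHS]mxE [X in _ + X = _ -> _]mxE => ->.
  rewrite mxE; congr (_ + _); first by rewrite mxE /consensus_inc mulr_suml.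
  rewrite mxE; congr (_ * _); rewrite mxE; apply: eq_bigr => s _; rewrite mxE; congr (_ * _).
  rewrite !mxE; congr (_ - _); apply: eq_bigr => q _; by rewrite !mxE.
apply: mwD => //; apply: mwD.
  apply: mw_sum => j _; rewrite /ew; case: ifP => aij; last first.
    by rewrite (_ : (fun om => _) = fun=> 0); [exact: mw_cst|apply/funext => om; rewrite !mul0r].
  have Cij := CSC_ge0 (a_edge_sym aij) (ltn0Sn k).
  apply: mwM; last exact: mw_cst.
  apply: mwZ; apply: mwB.
    apply: (mw_eq (fun om => shatSC_trig (fun i' k' => D i' k' om) Cij (estP k om))).
    have my : mF k.+1 (fun om => xSC (estP k om j) k.+1 + b j i * D j k.+1 om).
      by apply: mwD => //; exact: mwZ.
    apply: mwB; apply: mw_lt0 => //; exact: mw_cst.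
  rewrite /GSC; apply: mwB; apply: (mw_comp (measurable_laplace_cdf));
    apply: mwM; try exact: mw_cst; apply: mwB; try exact: mw_cst; by [exact: mx|exact: mwN].
apply: mwZ; apply: mw_sum => s _; apply: mwZ; apply: mwB => //.
by apply: mw_sum => q _; apply: mwZ; apply: mwB => //; exact: mw_cst.
Qed.
Arguments estP_mw : clear implicits.

Lemma errP_mw k i r : mF k (fun om => errP k om i r 0).
Proof.
rewrite /errP; under eq_fun do rewrite !mxE.
by apply: mwB; [exact: estP_mw|exact: mw_cst].
Qed.
Arguments errP_mw : clear implicits.

Lemma VP_mw k : mF k (VP k).
Proof. by apply: mw_sum => i _; apply: mw_sum => r _; apply: mw_sqr; exact: errP_mw. Qed.
Arguments VP_mw : clear implicits.

Lemma xP_mw k i : mF k (fun om => xSC (estP k om i) k.+1).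
Proof. by apply: xSC_mw => r; exact: estP_mw. Qed.
Arguments xP_mw : clear implicits.

Lemma pP_mw i j k : mF k (pP i j k).
Proof.
apply: mwD; apply: (mw_comp (measurable_laplace_cdf)); apply: mwM; try exact: mw_cst;
  apply: mwB; try exact: mw_cst; by [exact: xP_mw|apply: mwN; exact: xP_mw].
Qed.
Arguments pP_mw : clear implicits.

Lemma mF_meas k f : mF k f -> measurable_fun setT f.
Proof. by apply: mw_measurable; exact: fsF_meas. Qed.

Lemma dither_cond j i k : 0 < a j i ->
  cond_exp_zero mu (filtF W D k) (fun om =>
    (trig_pos nu b (fun i' k' => D i' k' om) (estP k om) j i k.+1)%:R
     - laplace_cdf ((xSC (estP k om j) k.+1 - CSC nu b j i k.+1) / b j i)) /\
  cond_exp_zero mu (filtF W D k) (fun om =>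
    (trig_neg nu b (fun i' k' => D i' k' om) (estP k om) j i k.+1)%:R
     - laplace_cdf ((- xSC (estP k om j) k.+1 - CSC nu b j i k.+1) / b j i)).
Proof.
move=> aji; have [b0 _] := Hb aji.
have ind A B : filtF W D k A -> measurable B ->
    (mu (A `&` D j k.+1 @^-1` B) = mu A * mu (D j k.+1 @^-1` B))%E.
  exact: dither_indep_past.
have lap x : mu [set om | D j k.+1 om <= x] = (laplace_cdf x)%:E by exact: D_lap.
split.
  have := @trigger_pos_cond_exp _ _ _ _ _ (D_meas j k.+1) lap (fsF k) (@fsF_meas k) ind _ _ (CSC nu b j i k.+1) (xP_mw k j) b0.
  exact.
have := @trigger_neg_cond_exp _ _ _ _ _ (D_meas j k.+1) lap (fsF k) (@fsF_meas k) ind _ _ (CSC nu b j i k.+1) (xP_mw k j) b0.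
exact.
Qed.

Lemma zeta_compensated i j k (u : T -> R) B : 0 < a i j -> mF k u ->
  (forall om, `|u om| <= B) ->
  [/\ L1 mu (fun om => u om * zetaP i j k om), L1 mu (fun om => u om * pP i j k om) &
      Ex mu (fun om => u om * zetaP i j k om) = Ex mu (fun om => u om * pP i j k om)].
Proof.
move=> aij mu_ uB; have [cp cn] := dither_cond k aij.
have Cij := CSC_ge0 aij (ltn0Sn k); have [b0 _] := Hb aij.
have z : zero_mean mu (fun om => u om * zetaP i j k om - u om * pP i j k om).
  have := zero_meanD (zero_meanM (@fsF_meas k) cp mu_ uB) (zero_meanM (@fsF_meas k) cn mu_ uB).
  congr (zero_mean mu _); apply/funext => om; rewrite /zetaP (sendsSC_trig _ Cij) /pP /psend; ring.
have lp : L1 mu (fun om => u om * pP i j k om).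
  apply: (@L1_bdd _ _ _ _ _ B); first by apply: (@mF_meas k); apply: mwM => //; exact: pP_mw.
  move=> om; rewrite normrM (ger0_norm (psend_ge0 _ _ _ _ _ _)); apply: (le_trans _ (uB om)).
  by rewrite ler_piMr// psend_le1.
have lz : L1 mu (fun om => u om * zetaP i j k om).
  have := L1D z.1 lp; congr (L1 mu _); apply/funext => om; ring.
split => //; apply/eqP; rewrite -subr_eq0 -ExB//; apply/eqP; exact: z.2.
Qed.

Lemma VP_ge0 l om : 0 <= VP l om.
Proof. exact: vsq_ge0. Qed.

Section OneStep.
Variables (k : nat) (E A : set T) (K Bd : R).
Hypothesis FE : filtF W D k E.
Hypothesis EA : E `<=` A.
Hypothesis FA : filtFw W k A.
Hypothesis A_Y : forall om i, A om -> Y i k.+1 om <= K.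
Hypothesis E_V : forall om, E om -> VP k om <= Bd.
Hypothesis K0 : 0 <= K.
Hypothesis Bd0 : 0 <= Bd.

Lemma E_measurable : measurable E.
Proof. exact: filtF_measurable FE. Qed.

Lemma A_measurable : measurable A.
Proof. by have FA' := @filtFw_sub _ _ _ _ _ W D k A FA; exact: filtF_measurable FA'. Qed.

Lemma nsqW_meas i : measurable_fun setT (fun om => nsq (W i k.+1 om)).
Proof.
by apply: measurable_sum => r; apply: measurable_funX.
Qed.

(** Since rho > 2, the square of the norm is at most 1 plus its power rho, whose integral over A is
    that of the conditional moment, at most K there. *)
Lemma nsqW_L1 i : L1 mu (fun om => \1_A om * nsq (W i k.+1 om)) /\
  Ex mu (fun om => \1_A om * nsq (W i k.+1 om)) <= 1 + K.
Proof.
have [mY [Y0 YE]] := Y_cond i (ltn0Sn k).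
have mYT : measurable_fun setT (Y i k.+1).
  apply: mF_meas; apply: measurable_wrtS mY; exact: filtFw_sub.
have lY : L1 mu (fun om => \1_A om * Y i k.+1 om).
  apply: (@L1_bdd _ _ _ _ _ K).
    by apply: measurable_funM => //; exact: measurable_indicR A_measurable.
  move=> om; rewrite indicE; case: (boolP (om \in A)) => [/set_mem omA|_].
    by rewrite mul1r ger0_norm// A_Y.
  by rewrite mul0r normr0.
have EY : (Ex mu (fun om => \1_A om * Y i k.+1 om)) <= K.
  rewrite -[leRHS](Ex_cst mu); apply: Ex_le => //; first exact: L1_cst.
  move=> om; rewrite indicE; case: (boolP (om \in A)) => [/set_mem omA|_].
    by rewrite mul1r A_Y.
  by rewrite mul0r.
have mv : measurable_fun setT (fun om => vnorm (W i k.+1 om) `^ rho).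
  apply: (measurableT_comp (measurable_powR rho)).
  rewrite (_ : (fun om => _) = (fun om => nsq (W i k.+1 om) `^ 2^-1)).
    exact: (measurableT_comp (measurable_powR _) (nsqW_meas i)).
  by apply/funext => om; rewrite powR12_sqrt ?nsq_ge0.
have IE : (\int[mu]_om (\1_A om * (vnorm (W i k.+1 om) `^ rho))%:E =
           \int[mu]_om (\1_A om * Y i k.+1 om)%:E)%E.
  by rewrite -(integral_indicM mu (Y i k.+1) A_measurable) YE// (integral_indicM mu _ A_measurable).
have lv : L1 mu (fun om => \1_A om * (vnorm (W i k.+1 om) `^ rho)).
  apply/integrableP; split.
    by apply/measurable_EFinP; apply: measurable_funM => //; exact: measurable_indicR A_measurable.
  under eq_integral do rewrite gee0_abs ?lee_fin ?mulr_ge0 ?powR_ge0//.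
  by rewrite /= IE -EFin_Ex// ltry.
have sqle om : nsq (W i k.+1 om) <= 1 + vnorm (W i k.+1 om) `^ rho.
  rewrite -vnorm_sq; set v := vnorm _; have v0 : 0 <= v by exact: vnorm_ge0.
  case: (leP v 1) => v1.
    have : v ^+ 2 <= 1 by rewrite expr_le1.
    have := powR_ge0 v rho; lra.
  have : v ^+ 2 <= v `^ rho by rewrite -powR_mulrn//; exact: (ler_powR (ltW v1) (ltW rho2)).
  lra.
have lb : L1 mu (fun om => \1_A om + \1_A om * (vnorm (W i k.+1 om) `^ rho)).
  by apply: L1D => //; exact: L1_indic A_measurable.
have le_b om : \1_A om * nsq (W i k.+1 om) <= \1_A om + \1_A om * (vnorm (W i k.+1 om) `^ rho).
  by rewrite -{2}[\1_A om]mulr1 -mulrDr ler_wpM2l.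
have ln : L1 mu (fun om => \1_A om * nsq (W i k.+1 om)).
  apply: (L1_le _ lb); first by apply: measurable_funM; [exact: measurable_indicR A_measurable|exact: nsqW_meas].
  by move=> om; rewrite ger0_norm// mulr_ge0// nsq_ge0.
split=> //; apply: (le_trans (Ex_le ln lb le_b)).
rewrite ExD//; last exact: L1_indic A_measurable.
apply: lerD.
  rewrite -[leRHS](Ex_cst mu); apply: Ex_le; [exact: L1_indic A_measurable|exact: L1_cst|].
  by move=> om; apply: (le_trans (ler_norm _)); exact: indic_norm_le1.
by apply: le_trans EY; rewrite -lee_fin !EFin_Ex// IE.
Qed.

(** The moment identity holds on events of [filtFw], whereas E also involves the dithers; by
    nonnegativity E may be enlarged to A. *)
Lemma nsqWE_L1 i : L1 mu (fun om => \1_E om * nsq (W i k.+1 om)) /\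
  Ex mu (fun om => \1_E om * nsq (W i k.+1 om)) <= 1 + K.
Proof.
have [lA eA] := nsqW_L1 i.
have le_ om : \1_E om * nsq (W i k.+1 om) <= \1_A om * nsq (W i k.+1 om).
  rewrite ler_wpM2r ?nsq_ge0// !indicE ler_nat.
  by case: (boolP (om \in E)) => // /set_mem/EA/mem_set ->.
have lE : L1 mu (fun om => \1_E om * nsq (W i k.+1 om)).
  apply: (L1_le _ lA); first by apply: measurable_funM; [exact: measurable_indicR E_measurable|exact: nsqW_meas].
  by move=> om; rewrite ger0_norm// mulr_ge0// nsq_ge0.
by split => //; exact: le_trans (Ex_le lE lA le_) eA.
Qed.

Lemma E_bounded (f : T -> R) : (forall om, f om ^+ 2 <= VP k om) ->
  forall om, `|\1_E om * f om| <= 1 + Bd.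
Proof.
move=> fV om; rewrite indicE; case: (boolP (om \in E)) => [/set_mem omE|_].
  rewrite mul1r; have := E_V omE; have := fV om => f1 f2.
  have := sqr_ge0 (`|f om| - 1); have := sqr_ge0 (f om).
  by rewrite sqrrB1 real_normK ?num_real// mulr2n; lra.
by rewrite mul0r normr0 addr_ge0.
Qed.

Lemma err_le_V om i : nsq (estP k om i - theta) <= VP k om.
Proof. by rewrite /VP /vsq (bigD1 i)//= lerDl sumr_ge0// => j _; exact: nsq_ge0. Qed.

Lemma step_mart_zero : zero_mean mu (fun om => \1_E om *
  step_mart a H theta nu b alpha beta (fun i' k' => W i' k' om) (fun i' k' => D i' k' om)
    k.+1 (estP k om)).
Proof.
have -> : (fun om => \1_E om *
  step_mart a H theta nu b alpha beta (fun i' k' => W i' k' om) (fun i' k' => D i' k' om)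
    k.+1 (estP k om)) = (fun om =>
  2 * (\sum_i \sum_j ew a alpha k.+1 i j *
    (\1_E om * xSC (estP k om i - theta) k.+1 *
       dither_noise nu b (fun i' k' => D i' k' om) k.+1 (estP k om) j i)) +
  2 * (\sum_i beta i k.+1 * \sum_s
     ((\1_E om * (H i k.+1 *m (estP k om i - theta)) s 0) * W i k.+1 om s 0))).
  apply/funext => om; rewrite /step_mart mulrDr mulrCA; congr (_ * _ + _).
    rewrite mulr_sumr; apply: eq_bigr => i _; rewrite mulr_sumr; apply: eq_bigr => j _; ring.
  rewrite mulrCA; congr (_ * _); rewrite mulr_sumr; apply: eq_bigr => i _.
  rewrite mulrCA; congr (_ * _); rewrite mulr_sumr; apply: eq_bigr => s _; ring.
have mxi i : mF k (fun om => \1_E om * xSC (estP k om i - theta) k.+1).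
  apply: mwM; first exact: mw_indic.
  rewrite (_ : (fun om => _) = fun om => xSC (estP k om i) k.+1 - xSC theta k.+1); last first.
    by apply/funext => om; rewrite xSCB.
  by apply: mwB; [exact: xP_mw|exact: mw_cst].
have bxi i om : `|\1_E om * xSC (estP k om i - theta) k.+1| <= 1 + Bd.
  apply: (E_bounded (f := fun om => xSC (estP k om i - theta) k.+1)) => om'.
  exact: le_trans (xSC_sq_le _ _) (err_le_V om' i).
apply: zero_meanD; apply: zero_meanZ; apply: zero_mean_sum => i _.
  apply: zero_mean_sum => j _; case: (boolP (0 < a i j)) => aij; last first.
    rewrite /ew (negbTE aij); under eq_fun do rewrite mul0r.
    by split; [exact: L1_cst|exact: Ex_cst].
  apply: zero_meanZ; rewrite /dither_noise; under eq_fun do rewrite mulrBr.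
  have [cp cn] := dither_cond k (a_edge_sym aij).
  by apply: zero_meanB; [exact: zero_meanM (@fsF_meas k) cp (mxi i) (bxi i)|
                         exact: zero_meanM (@fsF_meas k) cn (mxi i) (bxi i)].
apply: zero_meanZ; apply: zero_mean_sum => s _.
pose g om := (H i k.+1 *m (estP k om i - theta)) s 0.
have mg : mF k (fun om => \1_E om * g om).
  apply: mwM; first exact: mw_indic.
  apply: (mw_eq (fun om => mxE _ _ _ _)).
  by apply: mw_sum => q _; apply: mwZ; exact: errP_mw.
have bg om : `|\1_E om * g om| <= 1 + Hbar ^+ 2 * Bd.
  rewrite indicE; case: (boolP (om \in E)) => [/set_mem omE|_]; last first.
    by rewrite mul0r normr0 addr_ge0// mulr_ge0 ?sqr_ge0.
  rewrite mul1r; have g1 : g om ^+ 2 <= Hbar ^+ 2 * Bd.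
    apply: (@le_trans _ _ (nsq (H i k.+1 *m (estP k om i - theta)))).
      by rewrite /nsq (bigD1 s)//= lerDl sumr_ge0// => q _; exact: sqr_ge0.
    apply: (le_trans (opnorm_nsq _ (H_norm i (ltn0Sn k)) (ltW Hbar0))).
    rewrite ler_wpM2l ?sqr_ge0//; exact: le_trans (err_le_V om i) (E_V omE).
  have := sqr_ge0 (`|g om| - 1); have := sqr_ge0 (g om).
  by rewrite sqrrB1 real_normK ?num_real// mulr2n; lra.
exact: zero_meanM (@fsF_meas k) (W_mds s (ltn0Sn k)) mg bg.
Qed.

Lemma VP_meas l : measurable_fun setT (VP l).
Proof. exact: mF_meas (VP_mw l). Qed.

Lemma incP_meas : measurable_fun setT (incP k).
Proof.
apply: measurable_sum => i; apply: measurable_sum => r; apply: measurable_funX.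
rewrite (_ : (fun om => _) = fun om => estP k.+1 om i r 0 - estP k om i r 0); last first.
  by apply/funext => om; rewrite !mxE.
by apply: measurable_funB; [exact: (mF_meas (estP_mw k.+1 i r))|exact: (mF_meas (estP_mw k i r))].
Qed.

Lemma ind_ge0 om : 0 <= (\1_E om : R).
Proof. by rewrite indicE ler0n. Qed.

Lemma VE_L1 : L1 mu (fun om => \1_E om * VP k om).
Proof.
apply: (@L1_bdd _ _ _ _ _ Bd); first by apply: measurable_funM; [exact: measurable_indicR E_measurable|exact: VP_meas].
move=> om; rewrite indicE; case: (boolP (om \in E)) => [/set_mem omE|_].
  by rewrite mul1r ger0_norm ?VP_ge0// E_V.
by rewrite mul0r normr0.
Qed.

Variable pb : 'I_N -> 'I_N -> R.
Hypothesis pb_bound : forall i j om, 0 < a i j -> E om -> pP i j k om <= pb i j /\ pP j i k om <= pb i j.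

Hypothesis pb_ge0 : forall i j, 0 < a i j -> 0 <= pb i j.

(** The noise budget of one step on E. The bound [pb] on the sending probabilities is 1 for general
    step sizes and of order k^(-nu) for polynomial ones; 8 N is 4 N twice, once for the indicator
    and once for its probability. *)
Definition noise_const : R :=
  \sum_i (8 * N%:R * (\sum_j ew a alpha k.+1 i j ^+ 2 * pb i j)
          + 4 * Hbar ^+ 2 * beta i k.+1 ^+ 2 * (1 + K)).

Lemma inc_bound : L1 mu (fun om => \1_E om * incP k om) /\
  Ex mu (fun om => \1_E om * incP k om) <=
  noise_const + 4 * Hbar ^+ 4 * (\sum_i beta i k.+1 ^+ 2) * Ex mu (fun om => \1_E om * VP k om).
Proof.
pose g i om := 4 * N%:R * (\sum_j ew a alpha k.+1 i j ^+ 2 *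
     (\1_E om * zetaP j i k om + \1_E om * pP i j k om))
   + 4 * Hbar ^+ 2 * beta i k.+1 ^+ 2 * (\1_E om * nsq (W i k.+1 om))
   + 4 * Hbar ^+ 4 * beta i k.+1 ^+ 2 * (\1_E om * VP k om).
have Ez i j : 0 < a i j -> [/\ L1 mu (fun om => \1_E om * zetaP j i k om),
    L1 mu (fun om => \1_E om * pP i j k om) &
    Ex mu (fun om => \1_E om * zetaP j i k om) = Ex mu (fun om => \1_E om * pP j i k om) /\
    L1 mu (fun om => \1_E om * pP j i k om)].
  move=> aij; have mi : mF k (\1_E : T -> R) by exact: mw_indic.
  have [l1 l2 e1] := zeta_compensated (a_edge_sym aij) mi (indic_norm_le1 E).
  have [l3 l4 e2] := zeta_compensated aij mi (indic_norm_le1 E).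
  by split; [exact: l1|exact: l4|split; [exact: e1|exact: l2]].
have Ep i j q : 0 < a i j -> L1 mu (fun om => \1_E om * q om) -> (forall om, E om -> q om <= pb i j) ->
    Ex mu (fun om => \1_E om * q om) <= pb i j.
  move=> aij lq qb; rewrite -[leRHS](Ex_cst mu); apply: Ex_le => //; first exact: L1_cst.
  move=> om; rewrite indicE; case: (boolP (om \in E)) => [/set_mem omE|_].
    by rewrite mul1r qb.
  by rewrite mul0r pb_ge0.
have lgs i j : L1 mu (fun om => ew a alpha k.+1 i j ^+ 2 *
     (\1_E om * zetaP j i k om + \1_E om * pP i j k om)).
  case: (boolP (0 < a i j)) => aij; last first.
    by rewrite /ew (negbTE aij); under eq_fun do rewrite expr0n mul0r; exact: L1_cst.
  by have [l1 l2 _] := Ez i j aij; apply: L1Z; exact: L1D.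
have lg i : L1 mu (g i).
  apply: L1D; last exact: L1Z VE_L1.
  apply: L1D; last by apply: L1Z; case: (nsqWE_L1 i).
  by apply: L1Z; apply: L1_sum.
have le_g om : \1_E om * incP k om <= \sum_i g i om.
  apply: (@le_trans _ _ (\1_E om * (\sum_i (4 * N%:R * (\sum_j ew a alpha k.+1 i j ^+ 2 *
     (zetaP j i k om + pP i j k om))
   + 4 * Hbar ^+ 2 * beta i k.+1 ^+ 2 * nsq (W i k.+1 om)
   + 4 * Hbar ^+ 4 * beta i k.+1 ^+ 2 * nsq (estP k om i - theta))))).
    rewrite ler_wpM2l//; apply: step_inc_bound => //.
    - by move=> i j aij; exact: CSC_ge0.
    - by move=> i; exact: H_norm.
    - by move=> i j aij; case: (Hb aij).
  rewrite mulr_sumr; apply: ler_sum => i _; rewrite /g !mulrDr; apply: lerD.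
    rewrite le_eqVlt; apply/orP; left; apply/eqP; congr (_ + _); last by ring.
    rewrite !mulr_sumr; apply: eq_bigr => j _; ring.
  rewrite [leLHS]mulrCA; apply: ler_wpM2l; last by apply: ler_wpM2l; [exact: ind_ge0|exact: err_le_V].
  by apply: mulr_ge0 (sqr_ge0 _); apply: mulr_ge0 => //; apply: exprn_ge0; exact: ltW.
have linc : L1 mu (fun om => \1_E om * incP k om).
  apply: (L1_le _ (L1_sum (index_enum 'I_N) (fun i (_ : true) => lg i))).
    by apply: measurable_funM; [exact: measurable_indicR E_measurable|exact: incP_meas].
  by move=> om; rewrite ger0_norm ?mulr_ge0 ?vsq_ge0.
split=> //; apply: (le_trans (Ex_le linc (L1_sum (index_enum 'I_N) (fun i (_ : true) => lg i)) le_g)).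
rewrite Ex_sum// /noise_const mulr_sumr mulr_suml -big_split/=; apply: ler_sum => i _.
have lW := (nsqWE_L1 i).1.
have l1 : L1 mu (fun om => 4 * N%:R * (\sum_j ew a alpha k.+1 i j ^+ 2 *
     (\1_E om * zetaP j i k om + \1_E om * pP i j k om))).
  by apply: L1Z; apply: L1_sum.
rewrite /g ExD; [|by apply: L1D => //; exact: L1Z|exact: L1Z VE_L1].
rewrite ExD//; last exact: L1Z.
rewrite !ExZ//; [|exact: VE_L1|by apply: L1_sum]; rewrite lerD2r; apply: lerD; last first.
  apply: ler_wpM2l (nsqWE_L1 i).2.
  by apply: mulr_ge0 (sqr_ge0 _); apply: mulr_ge0 => //; exact: sqr_ge0.
rewrite (_ : 8 * N%:R = 4 * N%:R * 2 :> R); last by ring.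
rewrite -[leRHS]mulrA; apply: ler_wpM2l; first by rewrite mulr_ge0.
rewrite Ex_sum// mulr_sumr; apply: ler_sum => j _.
case: (boolP (0 < a i j)) => aij; last first.
  rewrite /ew (negbTE aij) expr0n mul0r mulr0; under eq_Ex do rewrite mul0r.
  by rewrite Ex_cst.
have [l2 l3 [e l4]] := Ez i j aij.
rewrite ExZ; last exact: L1D.
rewrite mulrCA ler_wpM2l ?sqr_ge0// ExD// e.
have q1 := Ep i j _ aij l4 (fun om omE => (pb_bound aij omE).2).
have q2 := Ep i j _ aij l3 (fun om omE => (pb_bound aij omE).1).
have pb2 : pb i j + pb i j <= 2 * pb i j by rewrite mulr_natl mulr2n.
exact: le_trans (lerD q1 q2) pb2.
Qed.

(** Integrability of the drift is read off the expansion itself, all of whose other terms are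
    integrable on E. *)
Lemma step_identity : [/\ L1 mu (fun om => \1_E om * VP k.+1 om),
  L1 mu (fun om => \1_E om * driftP k om) &
  Ex mu (fun om => \1_E om * VP k.+1 om) = Ex mu (fun om => \1_E om * VP k om)
   - Ex mu (fun om => \1_E om * driftP k om) + Ex mu (fun om => \1_E om * incP k om)].
Proof.
have [linc _] := inc_bound; have [lm m0] := step_mart_zero.
have exp_ om : VP k.+1 om = VP k om - driftP k om +
    step_mart a H theta nu b alpha beta (fun i' k' => W i' k' om) (fun i' k' => D i' k' om)
      k.+1 (estP k om) + incP k om.
  apply: step_expansion => //.
  - by move=> i j aij; case: (Halpha aij (ltn0Sn k)).
  - by move=> i j aij; case: (Hnu aij).
  - by move=> i j aij; case: (Hb aij).
  - by move=> i j aij; exact: CSC_ge0.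
have lb : L1 mu (fun om => 2 * (\1_E om * VP k om) + 2 * (\1_E om * incP k om)).
  by apply: L1D; apply: L1Z => //; exact: VE_L1.
have l1 : L1 mu (fun om => \1_E om * VP k.+1 om).
  apply: (L1_le _ lb); first by apply: measurable_funM; [exact: measurable_indicR E_measurable|exact: VP_meas].
  move=> om; rewrite ger0_norm; last by rewrite mulr_ge0 ?VP_ge0 ?ind_ge0.
  have -> : 2 * (\1_E om * VP k om) + 2 * (\1_E om * incP k om) =
      \1_E om * (2 * VP k om + 2 * incP k om) by ring.
  apply: ler_wpM2l; first exact: ind_ge0.
  rewrite /VP /incP /vsq !mulr_sumr -big_split/=; apply: ler_sum => i _.
  apply: le_trans (nsqD_le _ _); rewrite le_eqVlt; apply/orP; left; apply/eqP; congr nsq.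
  by rewrite /errP /= [RHS]addrC addrA subrK.
have E1 : (fun om => \1_E om * driftP k om) = (fun om => (\1_E om * VP k om + \1_E om *
   step_mart a H theta nu b alpha beta (fun i' k' => W i' k' om) (fun i' k' => D i' k' om)
      k.+1 (estP k om) + \1_E om * incP k om) - \1_E om * VP k.+1 om).
  by apply/funext => om; rewrite exp_; ring.
have l2 : L1 mu (fun om => \1_E om * VP k om + \1_E om *
   step_mart a H theta nu b alpha beta (fun i' k' => W i' k' om) (fun i' k' => D i' k' om)
      k.+1 (estP k om)) by apply: L1D => //; exact: VE_L1.
have l3 : L1 mu (fun om => (\1_E om * VP k om + \1_E om *
   step_mart a H theta nu b alpha beta (fun i' k' => W i' k' om) (fun i' k' => D i' k' om)
      k.+1 (estP k om)) + \1_E om * incP k om) by exact: L1D.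
have l4 : L1 mu (fun om => \1_E om * driftP k om) by rewrite E1; exact: L1B.
split => //; rewrite E1 ExB// ExD// ExD// ?m0; last exact: VE_L1.
move: (Ex mu (fun om => \1_E om * VP k.+1 om)) (Ex mu (fun om => \1_E om * VP k om))
  (Ex mu (fun om => \1_E om * incP k om)) => x y z; ring.
Qed.

End OneStep.

Lemma driftP_ge0 k om : 0 <= driftP k om.
Proof.
apply: addr_ge0; last first.
  by rewrite mulr_ge0// sumr_ge0// => i _; rewrite mulr_ge0 ?nsq_ge0// ltW// Hbeta.
apply: sumr_ge0 => i _; apply: sumr_ge0 => j _.
rewrite /ew; case: ifP => aij; last by rewrite mul0r.
have [al0 _] := Halpha aij (ltn0Sn k); have [b0 _] := Hb aij.
apply: mulr_ge0; first by rewrite mulr_ge0// ltW.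
have := @GSC_slope R N nu b i j k.+1 (CSC_ge0 aij (ltn0Sn k)) b0 (xSC (estP k om i) k.+1)
  (xSC (estP k om j) k.+1) (`|xSC (estP k om i) k.+1| + `|xSC (estP k om j) k.+1|) isT.
rewrite lerDl lerDr !normr_ge0 => /(_ isT isT); apply: le_trans.
apply: mulr_ge0 (sqr_ge0 _); apply: mulr_ge0 (powR_ge0 _ _).
by apply: divr_ge0; [exact: expR_ge0|exact: ltW].
Qed.

(** * Localisation events and exits from them *)

Section Localised.
Variables (K : R) (ell : nat -> R).
Hypothesis K0 : 0 <= K.
Hypothesis ell0 : forall k, 0 <= ell k.

(* [Ev k] lies in [filtF k]: Y at time k + 1 is a conditional moment given time k. *)
Definition AY k : set T := [set om | forall i s, (1 <= s <= k)%N -> Y i s om <= K].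
Definition Ev k : set T :=
  [set om | AY k.+1 om /\ forall s, (s <= k)%N -> VP s om <= ell s].
Definition exitE k : set T := Ev k `&` [set om | ell k.+1 < VP k.+1 om].

Lemma sigma_of_setT fs : sigma_of (fs : set (T -> R)) setT.
Proof. exact: (@measurableT _ (g_sigma_algebraType (sigma_gens fs))). Qed.

Lemma sigma_of_setI fs A B : sigma_of (fs : set (T -> R)) A -> sigma_of fs B -> sigma_of fs (A `&` B).
Proof. exact: (@measurableI _ (g_sigma_algebraType (sigma_gens fs))). Qed.

Lemma AY_filt k : filtFw W k (AY k.+1).
Proof.
elim: k => [|k IH].
all: pose S l := [set om | forall i, Y i l.+1 om <= K].
all: have FS l : filtFw W l (S l) by
  have -> : S l = \big[setI/setT]_(i <- index_enum 'I_N) [set om | Y i l.+1 om <= K];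
  [rewrite -bigcap_seq; apply/seteqP; split => [om H1 i _|om H1 i]; [exact: H1|by apply: H1; exact: mem_index_enum]|
   apply: (big_ind (filtFw W l)); [exact: sigma_of_setT|by move=> ? ?; exact: sigma_of_setI|
     move=> i _; apply: mw_le; have [+ _] := Y_cond i (ltn0Sn l); exact]].
- have -> : AY 1 = S 0%N; last exact: FS.
  apply/seteqP; split => om /= H1 i; first by apply: H1.
  by case=> // s /andP[_]; rewrite ltnS leqn0 => /eqP ->; exact: H1.
have -> : AY k.+2 = AY k.+1 `&` S k.+1; last first.
  apply: sigma_of_setI; last exact: FS.
  exact: (filtFw_mono (leqnSn k)).
apply/seteqP; split => om /=.
  move=> H1; split=> [i s /andP[s1 s2]|i]; last by apply: H1; rewrite leqnn.
  by apply: H1; rewrite s1 (leq_trans s2).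
move=> [H1 H2] i s /andP[s1]; rewrite leq_eqVlt => /orP[/eqP -> //|s2].
by apply: H1; rewrite s1.
Qed.
Arguments AY_filt : clear implicits.

Lemma Ev_filt k : filtF W D k (Ev k).
Proof.
have -> : Ev k = AY k.+1 `&` \big[setI/setT]_(s <- iota 0 k.+1) [set om | VP s om <= ell s].
  rewrite -bigcap_seq; apply/seteqP; split => om [H1 H2]; split => // s.
    change (s \in iota 0 k.+1 -> VP s om <= ell s).
    by rewrite mem_iota add0n ltnS => sk; exact: H2.
  move=> sk; apply: H2; change (is_true (s \in iota 0 k.+1)).
  by rewrite mem_iota add0n ltnS.
apply: sigma_of_setI; first exact: filtFw_sub (AY_filt k).
rewrite big_seq; apply: (big_ind (filtF W D k)); [exact: sigma_of_setT|by move=> ? ?; exact: sigma_of_setI|].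
move=> s; rewrite mem_iota add0n ltnS => /andP[_ sk].
apply: (filtF_mono sk); apply: mw_le; exact: VP_mw.
Qed.
Arguments Ev_filt : clear implicits.

Lemma Ev_meas k : measurable (Ev k).
Proof. exact: filtF_measurable (Ev_filt k). Qed.

Lemma Ev_anti k : Ev k.+1 `<=` Ev k.
Proof.
move=> om [H1 H2]; split=> [i s /andP[s1 s2]|s sk].
  by apply: H1; rewrite s1 (leq_trans s2).
by apply: H2; rewrite (leq_trans sk).
Qed.

Lemma exitE_meas k : measurable (exitE k).
Proof.
apply: measurableI; first exact: Ev_meas.
rewrite (_ : mkset _ = VP k.+1 @^-1` `]ell k.+1, +oo[%classic); last first.
  by apply/seteqP; split => om /=; rewrite in_itv/= andbT.
by rewrite -[X in measurable X]setTI; apply: (mF_meas (VP_mw k.+1)).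
Qed.

Definition vE k := Ex mu (fun om => \1_(Ev k) om * VP k om).

Lemma vE_ge0 k : 0 <= vE k.
Proof. by apply: Ex_ge0 => om; rewrite mulr_ge0 ?VP_ge0// indicE ler0n. Qed.

Section LocStep.
Variables (k : nat) (pb : 'I_N -> 'I_N -> R).
Hypothesis pb_ge0 : forall i j, 0 < a i j -> 0 <= pb i j.
Hypothesis pb_bound : forall i j om, 0 < a i j -> Ev k om -> pP i j k om <= pb i j /\ pP j i k om <= pb i j.

Let EvA : Ev k `<=` AY k.+1.
Proof. by move=> om []. Qed.

Let AY_Y om i : AY k.+1 om -> Y i k.+1 om <= K.
Proof. by move=> H1; apply: H1; rewrite leqnn. Qed.

Let Ev_V om : Ev k om -> VP k om <= ell k.
Proof. by move=> [_]; apply. Qed.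

Lemma VEv_L1 : L1 mu (fun om => \1_(Ev k) om * VP k om).
Proof. exact: (VE_L1 (Ev_filt k) Ev_V (ell0 k)). Qed.

(** The event at time k contains the disjoint union of the event at k + 1 and the exit, and on the
    exit V exceeds the level: this charges each exit to the descent. Paths lost because the moment
    bound fails are dropped, as V >= 0. *)
Lemma loc_step :
  [/\ L1 mu (fun om => \1_(Ev k) om * driftP k om),
      L1 mu (fun om => \1_(Ev k) om * incP k om),
      Ex mu (fun om => \1_(Ev k) om * incP k om) <=
        noise_const k K pb + 4 * Hbar ^+ 4 * (\sum_i beta i k.+1 ^+ 2) * vE k &
      vE k.+1 + ell k.+1 * Ex mu (\1_(exitE k)) + Ex mu (fun om => \1_(Ev k) om * driftP k om)
      <= vE k + Ex mu (fun om => \1_(Ev k) om * incP k om)].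
Proof.
have [linc ib] := inc_bound (Ev_filt k) EvA (AY_filt k) AY_Y Ev_V K0 (ell0 k) pb_bound pb_ge0.
have [lV ld E] := step_identity (Ev_filt k) EvA (AY_filt k) AY_Y Ev_V K0 (ell0 k) pb_bound pb_ge0.
split=> //.
suff : vE k.+1 + ell k.+1 * Ex mu (\1_(exitE k)) <= Ex mu (fun om => \1_(Ev k) om * VP k.+1 om).
  by rewrite E => h; rewrite -lerBrDr; apply: (le_trans h); rewrite addrAC.
have lx : L1 mu (\1_(exitE k) : T -> R) by exact: L1_indic (exitE_meas k).
have Fk1 : L1 mu (fun om => \1_(Ev k.+1) om * VP k.+1 om).
  by apply: (VE_L1 (Ev_filt k.+1) _ (ell0 k.+1)) => om []; move=> _; apply.
rewrite /vE -ExZ// -ExD//; last exact: L1Z.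
apply: Ex_le => //; first by apply: L1D => //; exact: L1Z.
move=> om; rewrite !indicE.
case: (boolP (om \in Ev k.+1)) => [/set_mem E1|_].
  have -> : om \in Ev k by apply/mem_set; exact: Ev_anti.
  have -> : (om \in exitE k) = false.
    apply/negbTE; apply/negP => /set_mem[_ /=]; rewrite ltNge => /negP; apply.
    by case: E1 => _; apply.
  by rewrite mulr0 addr0.
rewrite mul0r add0r; case: (boolP (om \in exitE k)) => [/set_mem[/mem_set -> /= /ltW]|_].
  by rewrite mulr1 mul1r.
by rewrite mulr0 mulr_ge0 ?VP_ge0 ?ler0n.
Qed.

End LocStep.
End Localised.

Hypothesis Hi : forall i j, 0 < a i j -> (\sum_(1 <= k <oo) ((alpha i j k) ^+ 2)%:E < +oo)%E.
Hypothesis Hii : forall i, (\sum_(1 <= k <oo) ((beta i k) ^+ 2)%:E < +oo)%E.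

Lemma ew_bsum i j : bsum (fun k => ew a alpha k.+1 i j ^+ 2).
Proof.
rewrite /ew; case: (boolP (0 < a i j)) => aij; last first.
  by apply: bsum_le bsum0 => k; rewrite expr0n.
apply: (@bsum_le _ _ (fun k => a i j ^+ 2 * alpha i j k.+1 ^+ 2)).
  by move=> k; rewrite exprMn mulrC.
apply: bsumZ; first exact: sqr_ge0.
by apply: (eseries_bsum (u := fun k => alpha i j k ^+ 2)) => [k|]; [exact: sqr_ge0|exact: Hi].
Qed.

Lemma beta_bsum : bsum (fun k => \sum_i beta i k.+1 ^+ 2).
Proof.
apply: bsum_sum => i.
by apply: (eseries_bsum (u := fun k => beta i k ^+ 2)) => [k|]; [exact: sqr_ge0|exact: Hii].
Qed.

Lemma noise_bsum K : 0 <= K -> bsum (fun k => noise_const k K (fun _ _ => 1)).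
Proof.
move=> K0; apply: bsum_sum => i; apply: bsumD.
  apply: bsumZ; first by rewrite mulr_ge0.
  apply: bsum_sum => j; apply: bsum_le (ew_bsum i j) => k; by rewrite mulr1.
apply: (@bsum_le _ _ (fun k => (4 * Hbar ^+ 2 * (1 + K)) * \sum_i beta i k.+1 ^+ 2)).
  move=> k; rewrite mulrAC ler_wpM2l//.
    by rewrite mulr_ge0 ?addr_ge0// mulr_ge0// sqr_ge0.
  by rewrite (bigD1 i)//= lerDl sumr_ge0// => j _; exact: sqr_ge0.
apply: bsumZ beta_bsum.
by rewrite mulr_ge0 ?addr_ge0// mulr_ge0// sqr_ge0.
Qed.

Lemma noise_const_ge0 k K pb : 0 <= K -> (forall i j, 0 < a i j -> 0 <= pb i j) ->
  0 <= noise_const k K pb.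
Proof.
move=> K0 pb0; apply: sumr_ge0 => i _; apply: addr_ge0.
  apply: mulr_ge0; first by rewrite mulr_ge0.
  apply: sumr_ge0 => j _; rewrite /ew; case: ifP => aij; last by rewrite expr0n mul0r.
  by apply: mulr_ge0 (pb0 _ _ aij); exact: sqr_ge0.
by apply: mulr_ge0; [apply: mulr_ge0; [apply: mulr_ge0 => //|]; exact: sqr_ge0|rewrite addr_ge0].
Qed.

Lemma pP_le1 i j k om : 0 < a i j -> pP i j k om <= 1 /\ pP j i k om <= 1.
Proof.
move=> aij; have aji := a_edge_sym aij.
split; apply: psend_le1; try exact: CSC_ge0; by [case: (Hb aij)|case: (Hb aji)].
Qed.

Definition growth_coeff k : R := 4 * Hbar ^+ 4 * (\sum_i beta i k.+1 ^+ 2).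

Lemma growth_coeff_ge0 k : 0 <= growth_coeff k.
Proof.
apply: mulr_ge0; first by rewrite mulr_ge0// exprn_ge0// ltW.
by apply: sumr_ge0 => i _; exact: sqr_ge0.
Qed.

Lemma loc_step_general K ell k : 0 <= K -> (forall k, 0 <= ell k) ->
  vE K ell k.+1 + ell k.+1 * Ex mu (\1_(exitE K ell k)) <=
  (1 + growth_coeff k) * vE K ell k + noise_const k K (fun _ _ => 1).
Proof.
move=> K0 ell0.
have pb1 i j om : 0 < a i j -> Ev K ell k om -> pP i j k om <= 1 /\ pP j i k om <= 1.
  by move=> aij _; exact: pP_le1.
have [_ _ ib st] := loc_step K0 ell0 (fun _ _ _ => ler01) pb1.
have d0 : 0 <= Ex mu (fun om => \1_(Ev K ell k) om * driftP k om).
  by apply: Ex_ge0 => om; rewrite mulr_ge0 ?driftP_ge0// indicE ler0n.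
rewrite -/(growth_coeff k) in ib; move: ib st d0.
move: (Ex mu (fun om => _ * driftP _ _)) (Ex mu (fun om => _ * incP _ _)) => x y.
move: (ell _ * _) (vE K ell k.+1) (vE K ell k) (noise_const _ _ _) (growth_coeff k) => z v1 v0 r c.
lra.
Qed.

Lemma VP0 om : VP 0 om = vsq (th0 \- (fun=> theta)).
Proof. by []. Qed.

Lemma exit_first K (L : nat -> R) om : (forall i k, (1 <= k)%N -> Y i k om <= K) ->
  VP 0 om <= L 0%N -> (exists k, L k < VP k om) -> exists k, exitE K L k om.
Proof.
move=> YK V0 [k0 ex].
pose P k := L k < VP k om.
have exP : exists k, P k by exists k0.
case: (ex_minnP exP) => -[|k] Pk kmin; first by move: Pk; rewrite /P ltNge V0.
exists k; split => //; split=> [i s /andP[s1 _]|s sk]; first exact: YK.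
rewrite leNgt; apply/negP => Ps; have := kmin s Ps; by rewrite ltnNge sk.
Qed.

Lemma VP_bounded_ae K : 0 <= K -> {ae mu, forall om,
  (forall i k, (1 <= k)%N -> Y i k om <= K) -> exists L : R, forall k, VP k om <= L}.
Proof.
move=> K0.
suff : mu.-negligible [set om | (forall i k, (1 <= k)%N -> Y i k om <= K) /\
    ~ exists L : R, forall k, VP k om <= L].
  apply: negligibleS => om /= H1; apply: contrapT => H2; apply: H1 => H3.
  by apply: contrapT => H4; apply: H2.
have [Cc cC] : bsum growth_coeff.
  by apply: bsumZ beta_bsum; rewrite mulr_ge0// exprn_ge0// ltW.
have [Cr rC] := noise_bsum K0.
set V0 := vsq (th0 \- (fun=> theta)).
have Cr0 : 0 <= Cr by apply: le_trans (rC 0%N); rewrite big_geq.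
have V00 : 0 <= V0 by exact: vsq_ge0.
apply: negligible_small => e e0.
pose C := expR Cc * (V0 + Cr); have C0' : 0 <= C by rewrite mulr_ge0 ?expR_ge0// addr_ge0.
(* The total exit probability is at most C / L <= e; the summand V0 places the initial state below
   the level. *)
pose L := V0 + C / e + 1.
have Ce0 : 0 <= C / e by rewrite divr_ge0// ltW.
have L0 : 0 < L by rewrite /L ltr_wpDl// addr_ge0.
exists (fun k => exitE K (fun=> L) k); split; first by move=> k; exact: exitE_meas.
  move=> om /= [YK nb]; have [k ek] : exists k, exitE K (fun=> L) k om.
    apply: exit_first => //; first by rewrite VP0 -/V0 /L -addrA lerDl addr_ge0.
    apply: contrapT => nex; apply: nb; exists L => k; rewrite leNgt; apply/negP => Lk.
    by apply: nex; exists k.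
  by exists k.
move=> l.
have := @exit_sum_bound _ (vE K (fun=> L)) (fun k => Ex mu (\1_(exitE K (fun=> L) k))) growth_coeff
  (fun k => noise_const k K (fun _ _ => 1)) L Cc Cr.
have v0le : vE K (fun=> L) 0 <= V0.
  rewrite -[leRHS](Ex_cst mu); apply: Ex_le; [|exact: L1_cst|].
    by apply: VEv_L1 => k; exact: ltW.
  move=> om; rewrite VP0 -/V0 indicE; case: (om \in _); by rewrite ?mul1r ?mul0r.
move=> /(_ _ _ growth_coeff_ge0 _ (ltW L0)) H1.
have {}H1 := H1 (fun k => vE_ge0 _ _ _) (fun k => Ex_ge0 _ (fun om => _)).
have ex0 k om : 0 <= (\1_(exitE K (fun=> L) k) om : R) by rewrite indicE ler0n.
have := H1 ex0 (fun k => noise_const_ge0 _ K0 (fun _ _ _ => ler01))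
  (fun k => loc_step_general _ K0 (fun=> ltW L0)) cC rC l.
move=> H2; have : L * \sum_(0 <= k < l) Ex mu (\1_(exitE K (fun=> L) k)) <= C.
  by apply: (le_trans H2); rewrite /C ler_wpM2l ?expR_ge0// lerD2r.
rewrite -ler_pdivlMl// mulrC => /le_trans; apply.
rewrite ler_pdivrMr// -ler_pdivrMl// mulrC /L; lra.
Qed.

Lemma zetaP_mw i j k : 0 < a i j -> mF k.+1 (zetaP i j k).
Proof.
move=> aij; have Cij := CSC_ge0 aij (ltn0Sn k).
apply: (mw_eq (fun om => sendsSC_trig (fun i' k' => D i' k' om) Cij (estP k om))).
have my : mF k.+1 (fun om => xSC (estP k om i) k.+1 + b i j * D i k.+1 om).
  apply: mwD.
    apply: measurable_wrtS (xP_mw k i); exact: (filtF_mono (leqnSn k)).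
  by apply: mwZ; apply: sigma_of_gen; right; exists i, k.+1; rewrite leqnn.
apply: mwD; apply: mw_lt0 => //; exact: mw_cst.
Qed.

Lemma zetaP_01 i j k om : zetaP i j k om = 0 \/ zetaP i j k om = 1.
Proof. by rewrite /zetaP; case: (sendsSC _ _ _ _ _ _ _); [right|left]. Qed.

Lemma pP_ge0 i j k om : 0 <= pP i j k om.
Proof. exact: psend_ge0. Qed.

(** * Messages compared with their compensator *)

Section ZetaBound.
Variables (K L : R) (ell : nat -> R) (i j : 'I_N).
Hypothesis K0 : 0 <= K.
Hypothesis ell0 : forall k, 0 <= ell k.
Hypothesis ellL : forall k, ell k <= L.
Hypothesis aij : 0 < a i j.

(** The logarithm of one supermartingale factor, with the Poisson compensator exp(lam) - 1. Off the
    event the factor is 1, so the process is frozen once the path has left. *)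
Let g lam t om : R :=
  \1_(Ev K ell t) om * (lam * zetaP i j t om - (expR lam - 1) * pP i j t om).
Let Zx lam l om : R := expR (\sum_(0 <= t < l) g lam t om).

Let g_mw lam t : mF t.+1 (g lam t).
Proof.
have sub := filtF_mono (W := W) (D := D) (leqnSn t).
apply: mwM; first by apply: mw_indic; apply: sub; exact: Ev_filt.
apply: mwB; apply: mwZ; first exact: zetaP_mw.
by apply: measurable_wrtS (pP_mw i j t).
Qed.

Let Zx_mw lam l : mF l (Zx lam l).
Proof.
apply: (@mw_comp _ _ _ _ _ _ (@measurable_expR R)).
suff H1 l0 : (l0 <= l)%N -> mF l (fun om => \sum_(0 <= t < l0) g lam t om) by exact: H1.
elim: l0 => [_|l0 IH l0l].
  by apply: (@mw_eq _ _ _ _ _ (fun=> 0)) (mw_cst _) => om; rewrite big_geq.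
apply: (@mw_eq _ _ _ _ _ (fun om => \sum_(0 <= t < l0) g lam t om + g lam l0 om)).
  by move=> om; rewrite big_nat_recr.
apply: mwD; first by apply: IH; exact: ltnW.
by apply: measurable_wrtS (@g_mw lam l0); exact: filtF_mono.
Qed.

Let g_le lam t om : 0 <= lam -> g lam t om <= lam.
Proof.
move=> l0; have e0 : 0 <= expR lam - 1 by have := expR_ge1Dx lam; lra.
have q0 : 0 <= (expR lam - 1) * pP i j t om by rewrite mulr_ge0// pP_ge0.
rewrite /g indicE; case: (om \in _); rewrite ?mul1r ?mul0r//.
by case: (zetaP_01 i j t om) => ->; rewrite ?mulr0 ?mulr1; lra.
Qed.

Let Zx_bound lam l om : 0 <= lam -> `|Zx lam l om| <= expR (lam *+ l).
Proof.
move=> l0; rewrite ger0_norm ?expR_ge0// ler_expR.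
rewrite -[l in leRHS]subn0 -sumr_const_nat; apply: ler_sum => t _; exact: g_le.
Qed.

Let mZx lam l : measurable_fun setT (Zx lam l).
Proof. exact: (mF_meas (@Zx_mw lam l)). Qed.

Let Zx_L1 lam l : 0 <= lam -> L1 mu (Zx lam l).
Proof. by move=> l0; exact: (L1_bdd mu (mZx lam l) (fun om => Zx_bound l om l0)). Qed.

(* E[exp(lam zeta) | past] = 1 + (e^lam - 1) p <= exp((e^lam - 1) p). *)
Let Zx_Ex lam l : 0 <= lam -> Ex mu (Zx lam l) <= 1.
Proof.
move=> l0; elim: l => [|l IH].
  rewrite (_ : Zx lam 0 = fun=> 1) ?Ex_cst//.
  by apply/funext => om; rewrite /Zx big_geq// expR0.
apply: le_trans IH.
set q := expR lam - 1; have q0 : 0 <= q by rewrite /q; have := expR_ge1Dx lam; lra.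
pose u om := Zx lam l om * \1_(Ev K ell l) om * expR (- (q * pP i j l om)).
have e1 om : expR (- (q * pP i j l om)) <= 1.
  by rewrite -[leRHS]expR0 ler_expR oppr_le0 mulr_ge0// pP_ge0.
have mu_ : mF l u.
  apply: mwM; first by apply: mwM; [exact: Zx_mw|apply: mw_indic; exact: Ev_filt].
  apply: (@mw_comp _ _ _ _ _ (fun om => - (q * pP i j l om)) (@measurable_expR R)); apply: mwN; apply: mwZ; exact: pP_mw.
have ub om : `|u om| <= expR (lam *+ l).
  rewrite /u !normrM -[leRHS]mulr1 -[expR (lam *+ l) * 1]mulr1.
  apply: ler_pM => //; last by rewrite ger0_norm ?expR_ge0.
  by apply: ler_pM => //; [exact: Zx_bound|exact: indic_norm_le1].
have [lz lp ez] := zeta_compensated aij mu_ ub.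
have lu : L1 mu u by apply: (L1_bdd mu (mF_meas mu_)) ub.
have lc : L1 mu (fun om => Zx lam l om - \1_(Ev K ell l) om * Zx lam l om).
  by apply: L1B; [exact: Zx_L1|apply: L1_indicM; [exact: Ev_meas|exact: Zx_L1]].
have lZE : L1 mu (fun om => \1_(Ev K ell l) om * Zx lam l om).
  by apply: L1_indicM; [exact: Ev_meas|exact: Zx_L1].
have -> : Ex mu (Zx lam l.+1) = Ex mu (fun om =>
    (Zx lam l om - \1_(Ev K ell l) om * Zx lam l om) + (u om + q * (u om * zetaP i j l om))).
  apply: eq_Ex => om; rewrite /Zx big_nat_recr//= expRD -/(Zx lam l om) /u /g indicE.
  case: (om \in _); last by rewrite /= !(mul0r, mulr0, expR0, addr0, subr0, mulr1).
  rewrite !mul1r mulr1 subrr add0r -/q expRD.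
  case: (zetaP_01 i j l om) => ->; rewrite ?mulr0 ?mulr1 ?expR0 ?mul1r ?addr0//.
  by rewrite /q; ring.
rewrite ExD//; last by apply: L1D => //; exact: L1Z.
rewrite [X in _ + X](ExD lu (L1Z q lz)) (ExZ q lz) ez -(ExZ q lp) -(ExD lu (L1Z q lp)).
rewrite -(ExD lc (L1D lu (L1Z q lp))).
apply: Ex_le; [by apply: L1D => //; apply: L1D => //; exact: L1Z|exact: Zx_L1|] => om.
rewrite -lerBrDl subKr [leRHS]mulrC.
have -> : u om + q * (u om * pP i j l om) = Zx lam l om * \1_(Ev K ell l) om *
    (expR (- (q * pP i j l om)) * (1 + q * pP i j l om)) by rewrite /u; ring.
rewrite ler_piMr//; first by rewrite mulr_ge0 ?expR_ge0// indicE ler0n.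
rewrite expRN mulrC ler_pdivrMr ?expR_gt0// mul1r; exact: expR_ge1Dx.
Qed.

Let nu0 : 0 <= nu i j.
Proof. by case: (Hnu aij). Qed.

Let b0 : 0 < b i j.
Proof. by case: (Hb aij). Qed.

Lemma Ev_x_bound t om i' : Ev K ell t om -> `|xSC (estP t om i') t.+1| <= norm1 theta + (1 + L).
Proof.
move=> [_ /(_ t (leqnn t))] Vt.
have -> : estP t om i' = theta + errP t om i' by rewrite /errP /= addrC subrK.
rewrite xSCD; apply: (le_trans (ler_normD _ _)); apply: lerD; first exact: xSC_norm1_le.
have := xSC_sq_le (errP t om i') t.+1; set x := xSC _ _ => x2.
have : nsq (errP t om i') <= VP t om.
  by rewrite /VP /vsq (bigD1 i')//= lerDl sumr_ge0// => l _; exact: nsq_ge0.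
have := sqr_ge0 (`|x| - 1); rewrite sqrrB1 real_normK ?num_real// mulr2n.
have := ellL t; have := sqr_ge0 x; lra.
Qed.

Definition pbar : R := expR ((norm1 theta + (1 + L)) / b i j).

Lemma Ev_pP_bound t om : Ev K ell t om -> pP i j t om <= pbar * t.+1%:R `^ (- nu i j).
Proof.
move=> Et; have xb := Ev_x_bound i Et.
apply: (le_trans (@psend_le_cosh R N nu b i j t.+1 b0 _ isT)).
apply: ler_wpM2r; first exact: powR_ge0.
set x := xSC _ _ in xb *; rewrite /pbar; move: xb; rewrite ler_norml => /andP[x1 x2].
have A1 : expR (x / b i j) <= expR ((norm1 theta + (1 + L)) / b i j).
  by rewrite ler_expR ler_pM2r ?invr_gt0.
have A2 : expR (- (x / b i j)) <= expR ((norm1 theta + (1 + L)) / b i j).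
  by rewrite ler_expR -[- (x / _)]mulNr ler_pM2r ?invr_gt0// lerNl.
rewrite ler_pdivrMr// mulr_natr mulr2n; exact: lerD.
Qed.

Lemma sum_pP_bound l om : nu i j < 1 -> (forall k, Ev K ell k om) ->
  \sum_(0 <= t < l) pP i j t om <= pbar / (1 - nu i j) * l%:R `^ (1 - nu i j).
Proof.
move=> nu1 Eom.
have := @sum_powRN_le R (nu i j) l; rewrite nu0 nu1 => /(_ isT) S.
apply: (@le_trans _ _ (pbar * \sum_(1 <= t < l.+1) t%:R `^ (- nu i j))).
  rewrite big_add1/= mulr_sumr; apply: ler_sum => t _; exact: Ev_pP_bound.
rewrite -mulrA ler_wpM2l ?expR_ge0//; apply: (le_trans S).
by rewrite mulrC.
Qed.

(** The Chernoff parameter for horizon l: it balances lam^2 l^(1 - nu), the second-order part of the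
    compensator, against the ln l paid for all horizons at once. The factor 1 - nu gives lam <= 1
    through ln x <= x^e / e. *)
Let lamk (l : nat) : R := Num.sqrt ((1 - nu i j) * ln l%:R / l%:R `^ (1 - nu i j)).

(** Each horizon l has its own parameter. The variables Zx / l^2 have summable means, so almost
    surely they are bounded by one constant M1; taking logarithms gives lam Sz - (exp(lam) - 1) Sp
    <= ln M1 + 2 ln l, and division by lam gives the deviation. *)
Lemma zeta_sum_bound : nu i j < 1 -> {ae mu, forall om, (forall k, Ev K ell k om) ->
  exists M : R, 0 <= M /\ forall l, (2 <= l)%N ->
    \sum_(0 <= t < l) zetaP i j t om <=
    \sum_(0 <= t < l) pP i j t om + M * Num.sqrt (ln l%:R * l%:R `^ (1 - nu i j))}.
Proof.
move=> nu1; have n1 : 0 < 1 - nu i j by rewrite subr_gt0.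
have lamk0 l : 0 <= lamk l by exact: sqrtr_ge0.
pose f l om := l.+1%:R `^ (- (1 + 1)) * Zx (lamk l.+1) l.+1 om.
have := @ae_bounded_sums _ _ _ mu f (1 + 1^-1).
move=> /(_ _ _ _)/wrap[].
- by move=> l om; rewrite mulr_ge0 ?powR_ge0 ?expR_ge0.
- by move=> l; apply: L1Z; exact: Zx_L1.
- move=> l; apply: le_trans (sum_powR_bounded l (@ltr01 R)).
  rewrite big_add1/=; apply: ler_sum => t _; rewrite ExZ; last exact: Zx_L1.
  by rewrite -[leRHS]mulr1 ler_wpM2l ?powR_ge0// Zx_Ex.
apply: filterS => om [M0 HM0] Eom.
pose M1 := Num.max M0 1; have M10 : 0 < M1 by rewrite lt_max ltr01 orbT.
have lM0 : 0 <= ln M1 by rewrite ln_ge0// le_max lexx orbT.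
have fM l : f l om <= M1.
  have := HM0 l.+1; rewrite big_nat_recr//= => H1.
  have : 0 <= \sum_(0 <= k < l) f k om.
    by apply: sumr_ge0 => k _; rewrite mulr_ge0 ?powR_ge0 ?expR_ge0.
  by move=> H2; rewrite le_max; apply/orP; left; lra.
pose cp := pbar / (1 - nu i j).
have cp0 : 0 <= cp by rewrite divr_ge0 ?expR_ge0// ltW.
have ln2 : 0 < ln (2 : R) by rewrite ln_gt0// ltr1n.
(* The three summands come from ln M1, made a multiple of ln l by l >= 2, from the weight l^(-2),
   and from the quadratic term of exp(lam) - 1 with [sum_pP_bound]; the denominator comes from
   [lamk]. *)
pose M := (ln M1 / ln 2 + 2 + expR 1 * cp * (1 - nu i j)) / Num.sqrt (1 - nu i j).
have s0 : 0 < Num.sqrt (1 - nu i j) by rewrite sqrtr_gt0.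
have M_ge0 : 0 <= M.
  apply: divr_ge0; last exact: ltW.
  apply: addr_ge0; first by rewrite addr_ge0// divr_ge0// ltW.
  by apply: mulr_ge0 (ltW n1); apply: mulr_ge0; [exact: expR_ge0|].
exists M; split=> // l l2.
case: l l2 => // l l2; have lp : 0 < l.+1%:R :> R by rewrite ltr0n.
have l1 : 1 <= l.+1%:R :> R by rewrite ler1n.
have lnl : ln 2 <= ln l.+1%:R :> R by rewrite ler_ln ?posrE// ler_nat.
have lnp : 0 < ln l.+1%:R :> R by exact: lt_le_trans lnl.
set p1 := l.+1%:R `^ (1 - nu i j); have p10 : 0 < p1 by exact: powR_gt0.
set lam := lamk l.+1.
have lamE : lam ^+ 2 = (1 - nu i j) * ln l.+1%:R / p1.
  rewrite /lam /lamk sqr_sqrtr//; apply: divr_ge0 (ltW p10).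
  exact: mulr_ge0 (ltW n1) (ltW lnp).
have lam0 : 0 < lam by rewrite /lam /lamk sqrtr_gt0 divr_gt0// mulr_gt0.
have lam1 : lam <= 1.
  rewrite -(@expr_le1 _ 2) ?(ltW lam0)// lamE ler_pdivrMr// mul1r -ler_pdivlMl// mulrC.
  exact: ln_le_powR.
set Sz := \sum_(0 <= t < l.+1) zetaP i j t om; set Sp := \sum_(0 <= t < l.+1) pP i j t om.
have Sp_le : Sp <= cp * p1 by exact: sum_pP_bound.
have Sp0 : 0 <= Sp by apply: sumr_ge0 => t _; exact: pP_ge0.
have ineq : lam * Sz - (expR lam - 1) * Sp <= ln M1 + 2 * ln l.+1%:R.
  have := fM l; rewrite /f -/lam /Zx.
  have -> : \sum_(0 <= t < l.+1) g lam t om = lam * Sz - (expR lam - 1) * Sp.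
    rewrite !mulr_sumr -sumrB; apply: eq_bigr => t _; rewrite /g indicE.
    by rewrite (mem_set (Eom t)) mul1r.
  have -> : - (1 + 1) = - 2%:R :> R by rewrite mulr2n.
  rewrite (powR_invn _ (ltW lp)) mulrC ler_pdivrMr; last exact: exprn_gt0.
  move=> H1.
  rewrite -ler_expR expRD lnK ?posrE// (_ : 2 * ln _ = ln (l.+1%:R ^+ 2)); last by rewrite lnXn// mulr_natl.
  by rewrite lnK// posrE exprn_gt0.
have eq1 : expR lam - 1 <= lam + lam ^+ 2 * expR 1.
  have := expR_quad lam; rewrite (gtr0_norm lam0).
  have : lam ^+ 2 * expR lam <= lam ^+ 2 * expR 1 by rewrite ler_wpM2l ?sqr_ge0// ler_expR.
  lra.
have main : lam * (Sz - Sp) <= (ln M1 / ln 2 + 2 + expR 1 * cp * (1 - nu i j)) * ln l.+1%:R.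
  have a1 := ler_wpM2r Sp0 eq1.
  have a2 : lam ^+ 2 * expR 1 * Sp <= expR 1 * cp * (1 - nu i j) * ln l.+1%:R.
    apply: (@le_trans _ _ (lam ^+ 2 * expR 1 * (cp * p1))).
      by rewrite ler_wpM2l// mulr_ge0 ?sqr_ge0 ?expR_ge0.
    rewrite lamE le_eqVlt; apply/orP; left; apply/eqP; field; by rewrite gt_eqF.
  have a3 : ln M1 <= ln M1 / ln 2 * ln l.+1%:R.
    by rewrite mulrAC ler_pdivlMr// ler_wpM2l.
  move: ineq a1 a2 a3; move: (expR lam) => el; move: (lam ^+ 2 * expR 1) => z.
  move: (ln M1 / ln 2) (expR 1 * cp * (1 - nu i j)) (ln l.+1%:R) => y1 y2 y3.
  lra.
rewrite -lerBlDl.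
have E : M * Num.sqrt (ln l.+1%:R * p1) =
    ((ln M1 / ln 2 + 2 + expR 1 * cp * (1 - nu i j)) * ln l.+1%:R) / lam.
  have sl : Num.sqrt (ln l.+1%:R * p1) = ln l.+1%:R * Num.sqrt (1 - nu i j) / lam.
    apply/eqP; rewrite -(@eqrXn2 _ 2)//; last by rewrite divr_ge0// ?mulr_ge0 ?(ltW lnp) ?(ltW s0) ?(ltW lam0).
    rewrite sqr_sqrtr; last by rewrite mulr_ge0 ?ltW.
    rewrite exprMn exprMn exprVn lamE sqr_sqrtr ?(ltW n1)//; apply/eqP; field.
    by rewrite !gt_eqF.
  rewrite sl /M; field; by rewrite !gt_eqF.
by rewrite E ler_pdivlMr// mulrC.
Qed.

End ZetaBound.

Lemma BSC_zetaP i j l om :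
  BSC a H theta th0 nu b alpha beta (fun i' k' => W i' k' om) (fun i' k' => D i' k' om) i j l =
  l%:R^-1 * \sum_(0 <= t < l) zetaP i j t om.
Proof. by rewrite /BSC big_add1. Qed.

(** The threshold is 0, so the sending probability is F(x / b) + F(-x / b) = 1. Silence remains
    possible when x + b d = 0, hence the null set for each time. *)
Lemma data_rate_one i j : 0 < a i j -> nu i j = 0 ->
  {ae mu, forall om, forall k, (1 <= k)%N ->
     BSC a H theta th0 nu b alpha beta (fun i' k' => W i' k' om) (fun i' k' => D i' k' om) i j k = 1}.
Proof.
move=> aij nu0.
have p1 k om : pP i j k om = 1.
  rewrite /pP /psend /CSC nu0 !mul0r !subr0 mulNr laplace_cdfN; ring.
have aek k : {ae mu, forall om, zetaP i j k om = 1}.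
  have u1 (om : T) : `|1 : R| <= 1 by rewrite normr1.
  have m1 : mF k (fun=> 1) by exact: mw_cst.
  have [lz lp e] := zeta_compensated aij m1 u1.
  pose S := [set om | zetaP i j k om <= 0].
  have mS : measurable S.
    have mz : mF k.+1 (zetaP i j k) by exact: zetaP_mw.
    exact: (filtF_measurable W_meas D_meas (mw_le 0 mz)).
  have ES : Ex mu (\1_S : T -> R) = 0.
    have -> : Ex mu (\1_S : T -> R) = Ex mu (fun om => 1 - 1 * zetaP i j k om).
      apply: eq_Ex => om; rewrite indicE; case: (zetaP_01 i j k om) => z.
        by rewrite mem_set /S/= z// mulr0 subr0.
      by rewrite memNset /S/= z ?ler10// mulr1 subrr.
    rewrite ExB// ?Ex_cst; last exact: L1_cst.
    rewrite e; have -> : Ex mu (fun om => 1 * pP i j k om) = 1; last by rewrite subrr.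
    by rewrite -[RHS](Ex_cst mu); apply: eq_Ex => om; rewrite p1 mulr1.
  exists S; split => //; first by rewrite -Ex_indic// ES.
  move=> om /= nz; case: (zetaP_01 i j k om) => z; last by [].
  by rewrite /S /= z.
have := ae_foralln aek; apply: filterS => om z1 k k0.
rewrite BSC_zetaP (eq_bigr (fun=> 1)) => [|t _]; last exact: z1.
by rewrite sumr_const_nat subn0 -mulr_natr mul1r mulVf// pnatr_eq0 -lt0n.
Qed.

Hypothesis Y_bounded : {ae mu, forall om, exists M : R, forall i k, (1 <= k)%N -> Y i k om <= M}.

(** The levels are natural numbers so that almost sure statements proved for fixed levels can be
    intersected over countably many. *)
Lemma Ev_exhaust : {ae mu, forall om, exists K L : nat, forall k, Ev K%:R (fun=> L%:R) k om}.
Proof.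
have := ae_foralln (fun K : nat => VP_bounded_ae (ler0n R K)) => HV.
move: Y_bounded HV; apply: filterS2 => om [M YM] HVom.
have [K MK] := natr_ge M.
have YK i k : (1 <= k)%N -> Y i k om <= K%:R by move=> k1; exact: le_trans (YM i k k1) MK.
have [L0 VL] := HVom K YK; have [L L0L] := natr_ge L0.
exists K, L => k; split=> [i s /andP[s1 _]|s _]; first exact: YK.
exact: le_trans (VL s) L0L.
Qed.

Lemma data_rate_O i j : 0 < a i j -> nu i j < 1 ->
  {ae mu, forall om, exists M : R, forall k, (1 <= k)%N ->
     `| BSC a H theta th0 nu b alpha beta (fun i' k' => W i' k' om) (fun i' k' => D i' k' om) i j k |
     <= M * (k%:R `^ (- nu i j))}.
Proof.
move=> aij nu1; have [nu0 _] := Hnu aij.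
have n1 : 0 < 1 - nu i j by rewrite subr_gt0.
have HZ := ae_foralln (fun K : nat => ae_foralln (fun L : nat =>
  @zeta_sum_bound K%:R L%:R (fun=> L%:R) i j (fun=> lexx _) aij nu1)).
move: Ev_exhaust HZ; apply: filterS2 => om [K [L Eom]] /(_ K L Eom) [M0 [M00 HM0]].
set cp := pbar L%:R i j / (1 - nu i j).
have cp0 : 0 <= cp by rewrite divr_ge0 ?expR_ge0// ltW.
pose M := 1 + cp + M0 / Num.sqrt (1 - nu i j).
have s0 : 0 <= M0 / Num.sqrt (1 - nu i j) by rewrite divr_ge0 ?sqrtr_ge0.
exists M => k k1; rewrite BSC_zetaP.
have kp : 0 < k%:R :> R by rewrite ltr0n.
rewrite ger0_norm; last first.
  apply: mulr_ge0; first by rewrite invr_ge0 ltW.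
  by apply: sumr_ge0 => t _; case: (zetaP_01 i j t om) => ->.
have pk : k%:R * k%:R `^ (- nu i j) = k%:R `^ (1 - nu i j) :> R.
  by rewrite powRD_gt0// powRr1 ?ltW.
rewrite mulrC ler_pdivrMr// -mulrA [X in _ <= _ * X]mulrC pk.
have p0 : 0 <= k%:R `^ (1 - nu i j) :> R by exact: powR_ge0.
(* The deviation bound starts at 2; the summand 1 in M covers k = 1, where the rate is at most 1. *)
case: (ltnP 1 k) => k2; last first.
  have -> : k = 1%N by apply/eqP; rewrite eqn_leq k2.
  rewrite big_nat1 powR1 mulr1; apply: (@le_trans _ _ 1); last by rewrite /M; lra.
  by case: (zetaP_01 i j 0 om) => ->.
apply: (le_trans (HM0 k k2)).
have a1 := sum_pP_bound (fun=> lexx L%:R) aij k nu1 Eom.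
have a2 := ler_wpM2l M00 (sqrt_ln_le_powR n1 k1).
have a3 := lerD a1 a2; apply: (le_trans a3); rewrite -/cp /M !mulrDl mul1r.
by rewrite -addrA ler_wpDl// lerD2l mulrA mulrAC.
Qed.

Lemma nu_lt1 i j : (\sum_(1 <= k <oo) zSC a nu alpha beta k = +oo)%E -> 0 < a i j -> nu i j < 1.
Proof.
move=> Hz aij; rewrite ltNge; apply/negP => nu1.
have z_ge0 k : (1 <= k)%N -> (0 <= zSC a nu alpha beta k)%E.
  move=> k1; rewrite /zSC le_min; apply/andP; split.
    apply: (big_ind (fun x => 0 <= x)%E) => //; first by move=> x y x0 y0; rewrite le_min x0.
    move=> i' _; apply: (big_ind (fun x => 0 <= x)%E) => //; first by move=> x y x0 y0; rewrite le_min x0.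
    move=> j' aij'; rewrite lee_fin divr_ge0 ?powR_ge0//; apply/ltW.
    by case: (Halpha aij' k1).
  apply: (big_ind (fun x => 0 <= x)%E) => //; first by move=> x y x0 y0; rewrite le_min x0.
  by move=> i' _; rewrite lee_fin ltW// Hbeta.
(* AM-GM: alpha / k^nu <= alpha / k <= alpha^2 + k^-2 *)
have z_le k : (1 <= k)%N -> (zSC a nu alpha beta k <= ((alpha i j k) ^+ 2 + k%:R `^ (- (1 + 1)))%:E)%E.
  move=> k1; rewrite /zSC ge_min; apply/orP; left.
  apply: (le_trans (bigmin_le _ i _)).
  apply: (le_trans (bigmin_le_cond _ _ aij)); rewrite lee_fin.
  have [al0 _] := Halpha aij k1.
  have kR : 1 <= k%:R :> R by rewrite ler1n.
  have -> : k%:R `^ (- (1 + 1)) = (k%:R^-1) ^+ 2 :> R.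
    by rewrite -[in - _](@mulr2n R 1) powRN powR_mulrn// exprVn.
  have : alpha i j k / k%:R `^ nu i j <= alpha i j k * k%:R^-1.
    apply: ler_wpM2l (ltW al0) _ _ _; rewrite -powRN -[leRHS]powR_inv1//.
    by apply: ler_powR => //; rewrite lerN2.
  move=> /le_trans; apply; have := sqr_ge0 (alpha i j k - k%:R^-1).
  have : 0 <= alpha i j k * k%:R^-1 by rewrite mulr_ge0 ?invr_ge0// ltW.
  move: (alpha i j k) (k%:R^-1) => x y; rewrite sqrrB mulr2n; lra.
have [C1 HC1] := @eseries_bsum _ (fun k => alpha i j k ^+ 2) (fun k => sqr_ge0 _) (Hi aij).
suff : (\sum_(1 <= k <oo) zSC a nu alpha beta k <= (C1 + (1 + 1^-1))%:E)%E by rewrite Hz leye_eq.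
apply: lime_le; first by apply: is_cvg_nneseries => k k1 _; exact: z_ge0.
apply: nearW => -[|l]; first by rewrite big_geq// lee_fin; have := HC1 0%N; rewrite big_geq//; lra.
apply: (@le_trans _ _ (\sum_(1 <= k < l.+1) ((alpha i j k) ^+ 2 + k%:R `^ (- (1 + 1)))%:E)%E).
  by rewrite !big_nat; apply: lee_sum => k /andP[k1 _]; exact: z_le.
rewrite sumEFin lee_fin big_split/=; apply: lerD.
  by have := HC1 l; rewrite big_add1.
exact: sum_powR_bounded.
Qed.

(** * Polynomial step sizes *)

Section Polynomial.
Variables (gamma : 'I_N -> 'I_N -> R) (h : R).
Hypothesis alpha_poly : forall i j k, 0 < a i j -> (1 <= k)%N ->
  alpha i j k = alpha i j 1%N / (k%:R `^ gamma i j).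
Hypothesis beta_poly : forall i k, (1 <= k)%N -> beta i k = beta i 1%N / k%:R.
Hypothesis nugamma : forall i j, 0 < a i j -> nu i j + gamma i j <= 1.
Hypothesis h_le : forall i j, 0 < a i j -> h <= nu i j / 2 + gamma i j.
Hypothesis h_half : 1 / 2 < h.
Hypothesis h_le1 : h <= 1.

Let pb L k i j : R := pbar L i j * k.+1%:R `^ (- nu i j).

(** Consensus noise has order k^(-2 gamma - nu) with 2 gamma + nu >= 2 h on every edge, and
    observation noise has order k^(-2), which is small enough since h <= 1. *)
Lemma poly_noise K L : 0 <= K -> 0 <= L -> exists2 Cn : R, 0 <= Cn &
  forall k, noise_const k K (pb L k) + growth_coeff k * L <= Cn * k.+1%:R `^ (- (2 * h)).
Proof.
move=> K0 L0.
pose c1 i j : R := if 0 < a i j then (alpha i j 1%N * a i j) ^+ 2 * pbar L i j else 0.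
have c10 i j : 0 <= c1 i j by rewrite /c1; case: ifP => // _; rewrite mulr_ge0 ?sqr_ge0 ?expR_ge0.
have Hb2 : 0 <= Hbar ^+ 2 by exact: sqr_ge0.
have Hb4 : 0 <= Hbar ^+ 4 by rewrite exprn_ge0// ltW.
exists (\sum_i (8 * N%:R * (\sum_j c1 i j) + 4 * Hbar ^+ 2 * beta i 1%N ^+ 2 * (1 + K))
   + 4 * Hbar ^+ 4 * (\sum_i beta i 1%N ^+ 2) * L).
  apply: addr_ge0; last first.
    apply: mulr_ge0 => //; apply: mulr_ge0; first exact: mulr_ge0.
    by apply: sumr_ge0 => i _; exact: sqr_ge0.
  apply: sumr_ge0 => i _; apply: addr_ge0.
    by apply: mulr_ge0; [exact: mulr_ge0|exact: sumr_ge0].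
  apply: mulr_ge0; last exact: addr_ge0.
  by apply: mulr_ge0; [exact: mulr_ge0|exact: sqr_ge0].
move=> k; rewrite /noise_const; set q := k.+1%:R; have q1 : 1 <= q by rewrite ler1n.
have q0 : 0 < q by exact: lt_le_trans q1.
set z := q `^ (- (2 * h)); have z0 : 0 <= z by exact: powR_ge0.
have bz i : beta i k.+1 ^+ 2 <= beta i 1%N ^+ 2 * z.
  rewrite beta_poly// exprMn; apply: ler_wpM2l; first exact: sqr_ge0.
  by rewrite exprVn -powR_invn ?(ltW q0)// ler_powR// lerN2; have := h_le1; lra.
have ez i j : ew a alpha k.+1 i j ^+ 2 * pb L k i j <= c1 i j * z.
  rewrite /ew /c1; case: ifP => aij; last by rewrite expr0n !mul0r.
  rewrite alpha_poly// /pb -/q.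
  have -> : (alpha i j 1%N / q `^ gamma i j * a i j) ^+ 2 * (pbar L i j * q `^ (- nu i j)) =
    (alpha i j 1%N * a i j) ^+ 2 * pbar L i j * ((q `^ gamma i j) ^- 2 * q `^ (- nu i j)).
    by field; rewrite gt_eqF// powR_gt0.
  apply: ler_wpM2l; first by rewrite mulr_ge0 ?sqr_ge0 ?expR_ge0.
  rewrite -powR_invn ?powR_ge0// -powRrM -powRD_gt0//.
  by rewrite ler_powR//; have := h_le aij; lra.
rewrite [leRHS]mulrDl; apply: lerD.
  rewrite mulr_suml; apply: ler_sum => i _; rewrite [leRHS]mulrDl; apply: lerD.
    rewrite -[leRHS]mulrA; apply: ler_wpM2l; first by rewrite mulr_ge0.
    by rewrite mulr_suml; apply: ler_sum => j _; exact: ez.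
  rewrite [leRHS]mulrAC; apply: ler_wpM2r; first exact: addr_ge0.
  by rewrite -[leRHS]mulrA; apply: ler_wpM2l => //; rewrite mulr_ge0.
rewrite [leRHS]mulrAC; apply: ler_wpM2r => //.
rewrite /growth_coeff -[leRHS]mulrA; apply: ler_wpM2l; first by rewrite mulr_ge0.
by rewrite mulr_suml; apply: ler_sum => i _; exact: bz.
Qed.

Lemma vE_le K ell k : (forall k, 0 <= ell k) -> vE K ell k <= ell k.
Proof.
move=> ell0; rewrite -[leRHS](Ex_cst mu); apply: Ex_le; [exact: VEv_L1|exact: L1_cst|].
move=> om; rewrite indicE; case: (boolP (om \in _)) => [/set_mem [_]|_]; last by rewrite mul0r.
by rewrite mul1r; apply.
Qed.

Lemma poly_step K L : 0 <= K -> 0 <= L -> exists2 Cn : R, 0 <= Cn &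
  forall ell, (forall k, 0 <= ell k) -> (forall k, ell k <= L) -> forall k,
  [/\ L1 mu (fun om => \1_(Ev K ell k) om * driftP k om),
      L1 mu (fun om => \1_(Ev K ell k) om * incP k om),
      Ex mu (fun om => \1_(Ev K ell k) om * incP k om) <= Cn * k.+1%:R `^ (- (2 * h)) &
      vE K ell k.+1 + ell k.+1 * Ex mu (\1_(exitE K ell k)) +
        Ex mu (fun om => \1_(Ev K ell k) om * driftP k om)
      <= vE K ell k + Cn * k.+1%:R `^ (- (2 * h))].
Proof.
move=> K0 L0; have [Cn Cn0 HC] := poly_noise K0 L0; exists Cn => // ell ell0 ellL k.
have pb0 i j : 0 < a i j -> 0 <= pb L k i j by move=> _; rewrite mulr_ge0 ?expR_ge0 ?powR_ge0.
have pbb i j om : 0 < a i j -> Ev K ell k om -> pP i j k om <= pb L k i j /\ pP j i k om <= pb L k i j.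
  move=> aij Eom; split; first exact: (Ev_pP_bound ellL aij Eom).
  have := Ev_pP_bound ellL (a_edge_sym aij) Eom.
  have [_ bs] := Hb aij; have [_ ns] := Hnu aij.
  by rewrite /pb /pbar bs ns.
have [l1 l2 ib st] := loc_step K0 ell0 pb0 pbb.
have ib' : Ex mu (fun om => \1_(Ev K ell k) om * incP k om) <= Cn * k.+1%:R `^ (- (2 * h)).
  apply: (le_trans ib); apply: le_trans (HC k); rewrite lerD2l -/(growth_coeff k).
  apply: ler_wpM2l; first exact: growth_coeff_ge0.
  by apply: (le_trans (vE_le K k ell0)).
by split => //; apply: (le_trans st); rewrite lerD2l.
Qed.

(** Puts both parts of the drift over the common factor 1 / (k + 1), in the form averaged by
    [pathwise_drift]; Xb is the range on which the slope of G is estimated. *)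
Lemma drift_lower k om bl ms Xb : 0 <= bl -> (forall i, bl <= beta i 1%N) ->
  (forall i, `|xSC (estP k om i) k.+1| <= Xb) ->
  (forall i j, 0 < a i j -> ms / k.+1%:R <=
     alpha i j k.+1 * (expR (- (Xb / b i j)) / b i j * k.+1%:R `^ (- nu i j))) ->
  k.+1%:R^-1 * (2 * bl * obs_form H k.+1 (errP k om) + ms * cons_form a k.+1 (errP k om))
  <= driftP k om.
Proof.
move=> bl0 blb xX slope; have q0 : 0 < k.+1%:R :> R by rewrite ltr0n.
rewrite mulrDr addrC; apply: lerD.
  rewrite mulrA /cons_form mulr_sumr; apply: ler_sum => i _; rewrite mulr_sumr.
  apply: ler_sum => j _; rewrite /ew.
  have -> : xSC (errP k om i) k.+1 - xSC (errP k om j) k.+1 =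
      xSC (estP k om i) k.+1 - xSC (estP k om j) k.+1.
    by rewrite !xSCB opprB addrA subrK.
  case: ifP => aij; last first.
    have -> : a i j = 0 by apply/eqP; rewrite eq_le a_ge0 andbT leNgt aij.
    by rewrite mul0r mulr0 mul0r.
  have [al0 _] := Halpha aij (ltn0Sn k); have [b0 _] := Hb aij.
  have sl := @GSC_slope R N nu b i j k.+1 (CSC_ge0 aij (ltn0Sn k)) b0 _ _ Xb isT (xX i) (xX j).
  have := slope i j aij; move: sl.
  move: (xSC _ _ - xSC _ _) (GSC _ _ _ _ _ _ - _) => dx dg sl sm.
  have q1 := ler_wpM2r (sqr_ge0 dx) sm; have q2 := ler_wpM2l (ltW al0) sl.
  have q3 : ms / k.+1%:R * dx ^+ 2 <= alpha i j k.+1 * (dx * dg).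
    by rewrite [leLHS]mulrA in q2; exact: le_trans q1 q2.
  have := ler_wpM2l (a_ge0 i j) q3; rewrite mulrCA (mulrC (k.+1%:R^-1)) => /le_trans; apply.
  by rewrite mulrCA mulrA.
rewrite mulrCA -mulrA [leLHS](_ : _ = 2 * (bl / k.+1%:R * obs_form H k.+1 (errP k om))); last by ring.
apply: ler_wpM2l => //; rewrite /obs_form mulr_sumr; apply: ler_sum => i _.
by apply: ler_wpM2r; [exact: nsq_ge0|rewrite beta_poly// ler_pM2r ?invr_gt0].
Qed.

Section Pass.
Variables (p : nat) (delta : R).
Hypothesis p0 : (0 < p)%N.
Hypothesis delta0 : 0 < delta.
Hypothesis H_pe : forall k, (1 <= k)%N ->
     loewner_ge_scalar
       (p%:R^-1 *: \sum_(k <= t < k + p) \sum_(i < N) ((H i t)^T *m H i t)) delta.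
Variables (bl lam : R).
Hypothesis bl0 : 0 < bl.
Hypothesis bl_le : forall i, bl <= beta i 1%N.
Hypothesis lam0 : 0 < lam.
Hypothesis gap : forall x : 'I_N -> R, \sum_i x i = 0 ->
    2 * lam * \sum_i x i ^+ 2 <= \sum_i \sum_j a i j * (x i - x j) ^+ 2.
Hypothesis N0 : (0 < N)%N.
Hypothesis n0 : (0 < n)%N.

(** The expectation of [pathwise_drift] supplies the lower bound that [weighted_descent] asks for.
    Levels, slope constant and starting time are left free because the pass is made twice: with
    crude constants first, then near theta. *)
Lemma poly_pass K L ell ms Xb (kap : R) (m1 : nat) : 0 <= K -> 0 <= L ->
  (forall k, 0 <= ell k) -> (forall k, ell k <= L) -> 0 < ms ->
  0 <= kap <= h - 1 / 2 -> kap < @coer_rate R N n Hbar delta bl ms lam ->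
  (forall k om i, (m1 <= k)%N -> Ev K ell k om -> `|xSC (estP k om i) k.+1| <= Xb) ->
  (forall k i j, (m1 <= k)%N -> 0 < a i j -> ms / k.+1%:R <=
     alpha i j k.+1 * (expR (- (Xb / b i j)) / b i j * k.+1%:R `^ (- nu i j))) ->
  exists2 m0 : nat, (0 < m0)%N & exists C : R, forall T', \sum_(m0 <= k < T') k%:R `^ (kap - 1) * vE K ell k <= C.
Proof.
move=> K0 L0 ell0 ellL ms0 /andP[kap0 kaph] kapr xX slope.
have HC := @pathwise_drift R N n m a H Hbar delta bl ms lam p a_ge0 Hbar0 H_norm p0 delta0
  H_pe bl0 ms0 lam0 gap N0 n0.
move: (coer_rate _ _ _ _ _) kapr HC => r kapr HC.
have r0 : 0 < r by exact: le_lt_trans kap0 kapr.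
(* With this eta, (1 - eta)^2 r >= r - 2 eta r = (r + kap) / 2 > kap. *)
pose eta := (r - kap) / (4 * r).
have eta0 : 0 < eta by apply: divr_gt0; [rewrite subr_gt0|rewrite mulr_gt0].
have eta4 : eta <= 1 / 4 by rewrite ler_pdivrMr; [lra|rewrite mulr_gt0].
have c_gt : kap < (1 - eta) ^+ 2 * r.
  have e2 : 1 - 2 * eta <= (1 - eta) ^+ 2 by have := sqr_ge0 eta; rewrite !expr2; lra.
  have e3 := ler_wpM2r (ltW r0) e2.
  have e4 : 2 * eta * r = (r - kap) / 2 by rewrite /eta; field; rewrite gt_eqF.
  by move: e3; rewrite mulrBl mul1r e4; lra.
have eta01 : 0 < eta < 1 by rewrite eta0/=; lra.
have {HC} [C Cg0 HC] := HC eta eta01.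
move: eta eta0 {eta4} c_gt {eta01} HC => eta eta0 c_gt HC.
have [Cn Cn0 Hst] := poly_step K0 L0.
have {}Hst := Hst ell ell0 ellL.
pose P := (p + n)%N.
have [m2 w_win] := weight_window kap0 P eta0.
pose m0 := (m1 + m2).+1.
have v0 k : 0 <= vE K ell k by exact: vE_ge0.
have vL k : vE K ell k <= L by exact: le_trans (vE_le K k ell0) (ellL k).
pose dE k := Ex mu (fun om => \1_(Ev K ell k) om * driftP k om).
pose iE k := Ex mu (fun om => \1_(Ev K ell k) om * incP k om).
have desc k : vE K ell k.+1 + dE k <= vE K ell k + Cn * k.+1%:R `^ (- (2 * h)).
  have [_ _ _ st] := Hst k; apply: le_trans st; rewrite lerD2r lerDl.
  by rewrite mulr_ge0// Ex_ge0// => om; rewrite indicE.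
have inc k : iE k <= Cn * k.+1%:R `^ (- (2 * h)) by have [] := Hst k.
exists m0 => //.
apply: (@weighted_descent R h kap h_half h_le1 kap0 kaph (vE K ell) dE iE L Cn C _
  (r * (L * P%:R)) P m0 isT v0 vL Cn0 Cg0 desc inc c_gt) => T'.
pose e om k := om \in Ev K ell k.
have e_anti om k : e om k.+1 -> e om k by move=> /set_mem/Ev_anti/mem_set.
have eL om k : e om k -> vsq (errP k om) <= L.
  move=> /set_mem[_ /(_ k (leqnn k))]; rewrite -/(VP k om) => /le_trans; apply; exact: ellL.
pose w (t : nat) : R := t%:R `^ (kap - 1).
have w0 t : 0 <= w t by exact: powR_ge0.
have w_win' k : (m0 <= k)%N -> (1 - eta) * w k <= w (k + P)%N.
  by move=> mk; apply: w_win; apply: leq_trans mk; rewrite ltnS leq_addl.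
have path om := HC (fun k => errP k om) (e om) w L m0 T' (e_anti om) w0
   (weight_anti h_le1 kaph) (weight_le1 h_le1 kaph) w_win' L0 (eL om) isT.
have indE om k : \1_(Ev K ell k) om = (e om k)%:R :> R by rewrite indicE.
have lV k : L1 mu (fun om => w k * (\1_(Ev K ell k) om * VP k om)) by apply: L1Z; exact: VEv_L1.
have lD0 t : L1 mu (fun om => \1_(Ev K ell t.-1) om * driftP t.-1 om) by have [] := Hst t.-1.
have lD t : L1 mu (fun om => t%:R `^ kap * (\1_(Ev K ell t.-1) om * driftP t.-1 om)) by exact: L1Z.
have lI t : L1 mu (fun om => \1_(Ev K ell t.-1) om * incP t.-1 om) by have [] := Hst t.-1.
pose SV om := \sum_(m0 <= k < T') w k * (\1_(Ev K ell k) om * VP k om).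
pose SDr om := \sum_(m0.+1 <= t < (T' + P).+1) t%:R `^ kap * (\1_(Ev K ell t.-1) om * driftP t.-1 om).
pose SIn om := \sum_(m0.+1 <= t < (T' + P).+1) (\1_(Ev K ell t.-1) om * incP t.-1 om).
have lS : L1 mu SV by exact: L1_sum.
have lSD : L1 mu SDr by exact: L1_sum.
have lSI : L1 mu SIn by exact: L1_sum.
have -> : \sum_(m0 <= k < T') k%:R `^ (kap - 1) * vE K ell k = Ex mu SV.
  by rewrite Ex_sum//; apply: eq_bigr => k _; rewrite ExZ//; exact: VEv_L1.
have -> : \sum_(m0.+1 <= t < (T' + P).+1) t%:R `^ kap * dE t.-1 = Ex mu SDr.
  by rewrite Ex_sum//; apply: eq_bigr => t _; rewrite ExZ.
have -> : \sum_(m0.+1 <= t < (T' + P).+1) iE t.-1 = Ex mu SIn by rewrite Ex_sum.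
rewrite -(ExZ _ lS) -(ExZ C lSI) -(ExD lSD (L1Z C lSI)) -[X in _ <= _ + X](Ex_cst mu).
rewrite -(ExD (L1D lSD (L1Z C lSI)) (L1_cst mu _)).
apply: Ex_le; [exact: L1Z|by apply: L1D; [apply: L1D => //; exact: L1Z|exact: L1_cst]|] => om.
have -> : SV om = \sum_(m0 <= k < T') w k * ((e om k)%:R * vsq (errP k om)).
  by apply: eq_bigr => k _; rewrite indE.
apply: (le_trans (path om)); rewrite lerD2r; apply: lerD.
  apply: ler_sum_nat => t /andP[mt _].
  have tp : 0 < t%:R :> R by rewrite ltr0n; exact: leq_trans mt.
  rewrite -indE /w powRB1// -mulrA; apply: ler_wpM2l; first exact: powR_ge0.
  rewrite mulrCA indicE; case: (boolP (om \in _)) => [/set_mem Et|_]; last by rewrite !mul0r.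
  rewrite !mul1r; case: t mt tp Et => // t mt tp /= Et.
  have mt' : (m1 <= t)%N by apply: leq_trans (leq_addr m2 m1) _; rewrite -ltnS; exact: ltnW.
  apply: drift_lower => //; [exact: ltW|by move=> i; exact: xX Et|by move=> i j; exact: slope].
apply: ler_wpM2l => //; apply: ler_sum_nat => t /andP[mt _].
rewrite -indE; apply: ler_wpM2l; first by rewrite indE.
case: t mt => // t _ /=; rewrite /incP /vsq le_eqVlt; apply/orP; left; apply/eqP.
by apply: eq_bigr => i _ /=; congr nsq; rewrite /errP /= opprB addrA subrK.
Qed.

Lemma slope_bound i j k Xb : 0 < a i j -> (1 <= k)%N ->
  alpha i j k * (expR (- (Xb / b i j)) / b i j * k%:R `^ (- nu i j)) =
  alpha i j 1%N * expR (- (Xb / b i j)) / b i j * k%:R `^ (- (nu i j + gamma i j)).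
Proof.
move=> aij k1; have kp : 0 < k%:R :> R by rewrite ltr0n.
rewrite alpha_poly// opprD powRD_gt0// (powRN _ (gamma i j)) /=; ring.
Qed.

(** With kap = 0 any positive rate is admissible, so the slope on the whole ball of level L
    suffices. Then vE / k is summable, and divergence of the harmonic series forces vE below eps at
    arbitrarily late times. *)
Lemma weak_pass K L (eps : R) (m1 : nat) : 0 <= K -> 0 <= L -> 0 < eps ->
  exists2 k, (m1 <= k)%N & vE K (fun=> L) k <= eps.
Proof.
move=> K0 L0 e0; pose Xb := norm1 theta + (1 + L).
pose f (ij : 'I_N * 'I_N) := alpha ij.1 ij.2 1%N * expR (- (Xb / b ij.1 ij.2)) / b ij.1 ij.2.
have [ms ms0 msf] : exists2 d : R, 0 < d & forall ij, 0 < a ij.1 ij.2 -> d <= f ij.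
  apply: finite_pos_lb => -[i j] /= aij; have [b0 _] := Hb aij.
  have [al0 _] := Halpha aij (leqnn 1).
  by apply: divr_gt0 => //; apply: mulr_gt0 => //; exact: expR_gt0.
have kapP : (0 : R) <= 0 <= h - 1 / 2 by rewrite lexx/=; have := h_half; lra.
have := @poly_pass K L (fun=> L) ms Xb 0 0%N K0 L0 (fun=> L0) (fun=> lexx L) ms0 kapP.
move=> /(_ _ _ _)/wrap[].
- exact: (coer_rate_gt0 Hbar0 delta0 bl0 ms0 lam0 N0 n0).
- by move=> k om i _; exact: Ev_x_bound.
- move=> k i j _ aij; rewrite slope_bound//.
  have k1 : 1 <= k.+1%:R :> R by rewrite ler1n.
  apply: ler_pM; [exact: ltW|by rewrite invr_ge0|exact: (msf (i, j))|].
  rewrite -[leLHS]powR_inv1//; apply: ler_powR => //; rewrite lerN2; exact: nugamma.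
move=> [m0 m00 [C HC]]; apply: contrapT => nex.
have big k : (m1 <= k)%N -> eps < vE K (fun=> L) k.
  by move=> mk; rewrite ltNge; apply/negP => le; apply: nex; exists k.
have [l lP] := harmonic_unbounded (maxn m0 m1) (C / eps).
have := HC l; apply/negP; rewrite -ltNge.
have : C < eps * \sum_(maxn m0 m1 <= k < l) k%:R^-1 by rewrite -ltr_pdivrMl// mulrC.
move=> /lt_le_trans; apply.
apply: (@le_trans _ _ (\sum_(maxn m0 m1 <= k < l) k%:R `^ (0 - 1) * vE K (fun=> L) k)).
  rewrite mulr_sumr; apply: ler_sum_nat => k /andP[mk _].
  rewrite sub0r powR_inv1// mulrC; apply: ler_wpM2l; first by rewrite invr_ge0.
  by apply/ltW/big; apply: leq_trans mk; exact: leq_maxr.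
apply: sum_nat_widen; [by rewrite leq_maxl|by []|] => k.
by rewrite mulr_ge0 ?powR_ge0 ?vE_ge0.
Qed.

Definition ellc (L eps : R) (k0 s : nat) : R := if (s <= k0)%N then L else eps.

Lemma ellc_ge0 L eps k0 s : 0 <= L -> 0 <= eps -> 0 <= ellc L eps k0 s.
Proof. by rewrite /ellc; case: ifP. Qed.

Lemma ellc_le L eps k0 s : 0 <= L -> 0 <= eps -> ellc L eps k0 s <= L + eps.
Proof. by move=> L0 e0; rewrite /ellc; case: ifP => _; rewrite ?lerDl ?lerDr. Qed.

Lemma Ev_ellc K L eps k0 : Ev K (ellc L eps k0) k0 = Ev K (fun=> L) k0.
Proof.
apply/seteqP; split => om [H1 H2]; split => // s sk; have := H2 s sk; by rewrite /ellc sk.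
Qed.

(* Start at a late time k0 with vE k0 small: afterwards each exit above eps costs
   eps in the descent inequality. *)
Lemma exit_tail_small K L eps e : 0 <= K -> 0 <= L -> 0 < eps -> 0 < e -> exists k0,
  forall l, \sum_(k0 <= k < l) Ex mu (\1_(exitE K (ellc L eps k0) k)) <= e.
Proof.
move=> K0 L0 ep0 e0.
have Le0 : 0 <= L + eps by rewrite addr_ge0// ltW.
have [Cn Cn0 Hst] := poly_step K0 Le0.
(* Since 2 h = s + (1 + s), a noise term splits into a factor t^(-s), small beyond k0, and a
   summable one; B collects the constants. *)
pose s := h - 1 / 2; have s0 : 0 < s by rewrite /s; have := h_half; lra.
pose B := Cn * (1 + s^-1) + 1.
have B0 : 0 < B.
  by apply: ltr_wpDl => //; apply: mulr_ge0 => //; apply: addr_ge0 => //; rewrite invr_ge0 ltW.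
have ee0 : 0 < e * eps / 2 by rewrite divr_gt0// mulr_gt0.
have [m1 m1P] := powRN_small s0 (divr_gt0 ee0 B0).
have [k0 mk0 vk0] := weak_pass m1.+1 K0 L0 ee0.
exists k0 => l; set ell := ellc L eps k0.
have ell0 k : 0 <= ell k by apply: ellc_ge0 => //; exact: ltW.
have ellL k : ell k <= L + eps by apply: ellc_le => //; exact: ltW.
have {}Hst := Hst ell ell0 ellL.
have st k : (k0 <= k)%N -> eps * Ex mu (\1_(exitE K ell k)) <=
    vE K ell k - vE K ell k.+1 + Cn * k.+1%:R `^ (- (2 * h)).
  move=> kk; have [_ _ _] := Hst k.
  have -> : ell k.+1 = eps by rewrite /ell /ellc leqNgt ltnS kk.
  have : 0 <= Ex mu (fun om => \1_(Ev K ell k) om * driftP k om).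
    by apply: Ex_ge0 => om; rewrite mulr_ge0 ?driftP_ge0// indicE ler0n.
  move: (Ex mu (fun om => _)) (eps * _) (vE _ _ _) (vE _ _ _) (Cn * _) => x1 x2 x3 x4 x5.
  lra.
have [lk|kl] := leqP l k0; first by rewrite big_geq// ltW.
have sumst : eps * \sum_(k0 <= k < l) Ex mu (\1_(exitE K ell k)) <=
    vE K ell k0 - vE K ell l + Cn * \sum_(k0 <= k < l) k.+1%:R `^ (- (2 * h)).
  have -> : vE K ell k0 - vE K ell l = \sum_(k0 <= k < l) (vE K ell k - vE K ell k.+1).
    rewrite -opprB -(telescope_sumr _ (ltnW kl)) -sumrN.
    by apply: eq_bigr => k _; rewrite opprB.
  rewrite !mulr_sumr -big_split/=; apply: ler_sum_nat => k /andP[kk _]; exact: st.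
have tail : Cn * \sum_(k0 <= k < l) k.+1%:R `^ (- (2 * h)) <= e * eps / 2.
  apply: (@le_trans _ _ (Cn * (k0%:R `^ (- s) * (1 + s^-1)))).
    apply: ler_wpM2l => //; apply: le_trans (ler_wpM2l (powR_ge0 _ _) (sum_powR_bounded l s0)).
    rewrite mulr_sumr.
    apply: (@le_trans _ _ (\sum_(k0.+1 <= t < l.+1) k0%:R `^ (- s) * t%:R `^ (- (1 + s)))); last first.
      by apply: sum_nat_widen => // t; rewrite mulr_ge0 ?powR_ge0.
    rewrite big_add1/=; apply: ler_sum_nat => k /andP[kk _].
    have kp : 0 < k.+1%:R :> R by rewrite ltr0n.
    have -> : - (2 * h) = - s + - (1 + s) by rewrite /s; field.
    rewrite powRD_gt0//; apply: ler_wpM2r; first exact: powR_ge0.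
    have k00 : 0 < k0%:R :> R by rewrite ltr0n; exact: leq_trans mk0.
    rewrite !powRN lef_pV2 ?posrE ?powR_gt0//.
    by apply: ge0_ler_powR; rewrite ?nnegrE ?(ltW s0) ?(ltW kp) ?(ltW k00)// ler_nat (leq_trans kk).
  rewrite mulrCA; apply: (@le_trans _ _ (k0%:R `^ (- s) * B)).
    by apply: ler_wpM2l; [exact: powR_ge0|rewrite /B lerDl].
  by rewrite -ler_pdivlMr//; exact: m1P.
have vk : vE K ell k0 <= e * eps / 2 by rewrite /vE Ev_ellc.
have vl : 0 <= vE K ell l by exact: vE_ge0.
rewrite -(ler_pM2l ep0); apply: (le_trans sumst).
move: tail vk vl; move: (vE _ _ _) (vE _ _ _) (Cn * _) => x1 x2 x3; lra.
Qed.

Lemma consistency K L eps : 0 <= K -> 0 <= L -> 0 < eps ->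
  {ae mu, forall om, (forall k, Ev K (fun=> L) k om) ->
     exists k0, forall k, Ev K (ellc L eps k0) k om}.
Proof.
move=> K0 L0 ep0.
suff : mu.-negligible [set om | (forall k, Ev K (fun=> L) k om) /\
    ~ exists k0, forall k, Ev K (ellc L eps k0) k om].
  apply: negligibleS => om /= H1; apply: contrapT => H2; apply: H1 => H3.
  by apply: contrapT => H4; apply: H2.
apply: negligible_small => e e0.
have [k0 k0P] := exit_tail_small K0 L0 ep0 e0.
(* Up to time k0 the level is L, which the path never exceeds, so only exits at indices k >= k0 have
   to be covered. *)
exists (fun k => if (k0 <= k)%N then exitE K (ellc L eps k0) k else set0); split.
- by move=> k; case: ifP => // _; exact: exitE_meas.
- move=> om /= [EL nex].
  have YK i k : (1 <= k)%N -> Y i k om <= K.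
    by move=> k1; have [+ _] := EL k; apply; rewrite k1/=.
  have V0 : VP 0 om <= ellc L eps k0 0 by have [_ +] := EL 0%N; apply.
  have [k ek] : exists k, exitE K (ellc L eps k0) k om.
    apply: exit_first => //; apply: contrapT => nx; apply: nex; exists k0 => k; split.
      by move=> i s /andP[s1 _]; exact: YK.
    by move=> s _; rewrite leNgt; apply/negP => ls; apply: nx; exists s.
  exists k => //; case: leqP => // kk; have [_ /=] := ek.
  rewrite /ellc kk ltNge => /negP; apply; have [_ +] := EL k.+1; exact.
- move=> l; have [lk|kl] := leqP l k0.
    rewrite big_nat big1 ?ltW// => k /andP[_ kl].
    rewrite leqNgt (leq_trans kl lk)/= (_ : \1_set0 = fun=> 0) ?Ex_cst//.
    by apply/funext => om; rewrite indicE in_set0.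
  rewrite (big_cat_nat (n := k0)) ?(ltnW kl)//= big_nat big1 ?add0r; last first.
    move=> k /andP[_ kk]; rewrite leqNgt kk/= (_ : \1_set0 = fun=> 0) ?Ex_cst//.
    by apply/funext => om; rewrite indicE in_set0.
  by apply: le_trans (k0P l); apply: ler_sum_nat => k /andP[-> _].
Qed.

(** On an edge with nu + gamma < 1 the effective gain decays more slowly than 1 / k and eventually
    exceeds ms / k for any ms. Only edges with nu + gamma = 1 restrict ms, and the factor 2 in their
    condition is the loss of slope near theta. *)
Lemma error_sum_bounded ms K L : 0 < ms -> 0 <= K -> 0 <= L ->
  h - 1 / 2 < @coer_rate R N n Hbar delta bl ms lam ->
  (forall i j, 0 < a i j -> nu i j + gamma i j < 1 \/
     2 * ms <= alpha i j 1%N * expR (- (norm1 theta / b i j)) / b i j) ->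
  {ae mu, forall om, (forall k, Ev K (fun=> L) k om) ->
     exists (m0 : nat) (M : R), (0 < m0)%N /\ forall l, \sum_(m0 <= k < l) k%:R `^ (h - 1 / 2 - 1) * VP k om <= M}.
Proof.
move=> ms0 K0 L0 hr edges.
(* Within distance d0 of theta the slope of G loses at most a factor 2. *)
have [d0 d00 d0b] : exists2 d : R, 0 < d & forall ij : 'I_N * 'I_N, 0 < a ij.1 ij.2 -> d <= b ij.1 ij.2 * ln 2.
  apply: finite_pos_lb => -[i j] /= aij; have [b0 _] := Hb aij.
  by rewrite mulr_gt0// ln_gt0// ltr1n.
pose eps := d0 ^+ 2; have ep0 : 0 < eps by rewrite exprn_gt0.
pose Xb := norm1 theta + d0.
have kapP : 0 <= h - 1 / 2 <= h - 1 / 2 by rewrite lexx andbT; have := h_half; lra.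
have half i j : 0 < a i j -> expR (- (norm1 theta / b i j)) / 2 <= expR (- (Xb / b i j)).
  move=> aij; have [b0 _] := Hb aij; rewrite /Xb mulrDl opprD expRD.
  apply: ler_wpM2l; first exact: expR_ge0.
  rewrite expRN lef_pV2 ?posrE ?expR_gt0// -[leRHS](@lnK R 2) ?posrE// ler_expR.
  by rewrite ler_pdivrMr// mulrC; exact: (d0b (i, j)).
have [m1 m1P] : exists m1, forall k (ij : 'I_N * 'I_N), (m1 <= k)%N -> 0 < a ij.1 ij.2 -> ms / k.+1%:R <=
     alpha ij.1 ij.2 k.+1 * (expR (- (Xb / b ij.1 ij.2)) / b ij.1 ij.2 * k.+1%:R `^ (- nu ij.1 ij.2)).
  apply: finite_eventually => -[i j] /=.
  case: (boolP (0 < a i j)) => [aij|na]; last by exists 0%N.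
  have [b0 _] := Hb aij; have [al0 _] := Halpha aij (leqnn 1).
  pose c := alpha i j 1%N * expR (- (Xb / b i j)) / b i j.
  have c0 : 0 < c by apply: divr_gt0 => //; apply: mulr_gt0 => //; exact: expR_gt0.
  case: (edges i j aij) => [lt1|ge].
    have sp : 0 < 1 - (nu i j + gamma i j) by rewrite subr_gt0.
    have [m1 m1P] := powRN_small sp (divr_gt0 c0 ms0).
    exists m1 => k mk _; rewrite slope_bound// -/c.
    have kp : 0 < k.+1%:R :> R by rewrite ltr0n.
    have := m1P k.+1; rewrite ltnS => /(_ mk); rewrite ler_pdivlMr// mulrC => le1.
    have := ler_wpM2r (powR_ge0 k.+1%:R (- (nu i j + gamma i j))) le1.
    rewrite -mulrA -powRD_gt0// (_ : - _ + - _ = -1); last by ring.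
    by rewrite powR_inv1.
  exists 0%N => k _ _; rewrite slope_bound// -/c.
  have k1 : 1 <= k.+1%:R :> R by rewrite ler1n.
  apply: ler_pM; [exact: ltW|by rewrite invr_ge0| |].
    have q1 : ms <= alpha i j 1%N * (expR (- (norm1 theta / b i j)) / 2) / b i j.
      rewrite (_ : _ / b i j = alpha i j 1%N * expR (- (norm1 theta / b i j)) / b i j / 2); last by ring.
      by rewrite ler_pdivlMr// mulrC.
    apply: (le_trans q1); rewrite /c ler_pM2r ?invr_gt0//; apply: ler_wpM2l (ltW al0) _ _ _.
    exact: half.
  rewrite -[leLHS]powR_inv1//; apply: ler_powR => //; rewrite lerN2; exact: nugamma.
(* The time after which V stays below eps depends on the path; each k0 gets its own null set, and
   there are countably many. *)
have pass (k0 : nat) : {ae mu, forall om, (forall k, Ev K (ellc L eps k0) k om) ->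
    exists (m0 : nat) (M : R), (0 < m0)%N /\ forall l, \sum_(m0 <= k < l) k%:R `^ (h - 1 / 2 - 1) * VP k om <= M}.
  set ell := ellc L eps k0.
  have ell0 k : 0 <= ell k by apply: ellc_ge0 => //; exact: ltW.
  have ellL k : ell k <= L + eps by apply: ellc_le => //; exact: ltW.
  have Le0 : 0 <= L + eps by rewrite addr_ge0// ltW.
  have := @poly_pass K (L + eps) ell ms Xb (h - 1 / 2) (maxn m1 k0.+1) K0 Le0 ell0 ellL ms0 kapP hr.
  move=> /(_ _ _)/wrap[].
  - move=> k om i; rewrite geq_max => /andP[_ kk] [_ /(_ k (leqnn k))].
    rewrite {1}/ell /ellc leqNgt kk/= => Vk.
    have -> : estP k om i = theta + errP k om i by rewrite /errP /= addrC subrK.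
    rewrite xSCD; apply: (le_trans (ler_normD _ _)); apply: lerD; first exact: xSC_norm1_le.
    rewrite -(@ler_pXn2r _ 2) ?nnegrE ?(ltW d00)// real_normK ?num_real//.
    apply: (le_trans (xSC_sq_le _ _)); apply: le_trans Vk.
    by rewrite /VP /vsq (bigD1 i)//= lerDl sumr_ge0// => l _; exact: nsq_ge0.
  - by move=> k i j; rewrite geq_max => /andP[mk _]; exact: (m1P k (i, j) mk).
  move=> [m0 m00 [C HC]].
  have := @ae_bounded_sums _ _ _ mu (fun k om => (m0 <= k)%N%:R * (k%:R `^ (h - 1 / 2 - 1) *
     (\1_(Ev K ell k) om * VP k om))) C.
  move=> /(_ _ _ _)/wrap[].
  - by move=> k om; apply: mulr_ge0 => //; rewrite !mulr_ge0 ?powR_ge0 ?VP_ge0// indicE ler0n.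
  - by move=> k; apply: L1Z; apply: L1Z; exact: VEv_L1.
  - move=> l; apply: le_trans (HC (maxn l m0)).
    have -> : \sum_(0 <= k < l) Ex mu (fun om => (m0 <= k)%N%:R * (k%:R `^ (h - 1 / 2 - 1) *
       (\1_(Ev K ell k) om * VP k om))) = \sum_(0 <= k < l) (m0 <= k)%N%:R * (k%:R `^ (h - 1 / 2 - 1) * vE K ell k).
      by apply: eq_bigr => k _; rewrite !ExZ//; [exact: VEv_L1|apply: L1Z; exact: VEv_L1].
    have f0 k : 0 <= k%:R `^ (h - 1 / 2 - 1) * vE K ell k by rewrite mulr_ge0 ?powR_ge0 ?vE_ge0.
    apply: (@le_trans _ _ (\sum_(0 <= k < maxn l m0) (m0 <= k)%N%:R * (k%:R `^ (h - 1 / 2 - 1) * vE K ell k))).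
      by apply: sum_nat_widen; [by []|rewrite leq_maxl|move=> k; rewrite mulr_ge0].
    rewrite (big_cat_nat (n := m0)) ?leq_maxr//= big_nat big1 ?add0r; last first.
      by move=> k /andP[_ kk]; rewrite leqNgt kk mul0r.
    by apply: ler_sum_nat => k /andP[mk _]; rewrite mk [leLHS]mul1r.
  apply: filterS => om [M HM] Eom; exists m0, M; split=> // l.
  have f0 k : 0 <= k%:R `^ (h - 1 / 2 - 1) * VP k om by rewrite mulr_ge0 ?powR_ge0 ?VP_ge0.
  apply: le_trans (HM l).
  apply: (@le_trans _ _ (\sum_(m0 <= k < l) (m0 <= k)%N%:R * (k%:R `^ (h - 1 / 2 - 1) *
     (\1_(Ev K ell k) om * VP k om)))).
    apply: ler_sum_nat => k /andP[mk _]; rewrite mk [leRHS]mul1r.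
    have -> : \1_(Ev K ell k) om = 1 :> R by rewrite indicE (mem_set (Eom k)).
    by rewrite [1 * VP k om]mul1r.
  by apply: sum_nat_widen => // k; apply: mulr_ge0 => //; rewrite !mulr_ge0 ?powR_ge0 ?VP_ge0// indicE ler0n.
have := ae_foralln pass; have := consistency K0 L0 ep0.
apply: filterS2 => om C1 C2 Eom; have [k0 Ek0] := C1 Eom; exact: C2 Ek0.
Qed.

End Pass.

(** [cosh_shift_le] is used with s the selected coordinate of theta over b and u the corresponding
    error over b, where u^2 <= V / b^2: the excess over exp(|theta|_1 / b) is linear in V. *)
Lemma Ev_pP_sharp K L i j t om : 0 < a i j -> Ev K (fun=> L) t om ->
  pP i j t om <= (expR (norm1 theta / b i j) +
    expR (norm1 theta / b i j) * (1 + expR ((1 + L) / b i j)) / b i j ^+ 2 * VP t om) * t.+1%:R `^ (- nu i j).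
Proof.
move=> aij [_ /(_ t (leqnn t))] Vt; have [b0 _] := Hb aij.
apply: (le_trans (@psend_le_cosh R N nu b i j t.+1 b0 _ isT)).
apply: ler_wpM2r; first exact: powR_ge0.
have -> : estP t om i = theta + errP t om i by rewrite /errP /= addrC subrK.
rewrite xSCD [(_ + xSC (errP t om i) _) / _]mulrDl; set s := _ / b i j; set u := xSC (errP t om i) _ / b i j.
have x2 : xSC (errP t om i) t.+1 ^+ 2 <= VP t om.
  apply: (le_trans (xSC_sq_le _ _)).
  by rewrite /VP /vsq (bigD1 i)//= lerDl sumr_ge0// => l _; exact: nsq_ge0.
have uB : `|u| <= (1 + L) / b i j.
  rewrite normrM (gtr0_norm (x := (b i j)^-1)) ?invr_gt0// ler_pM2r ?invr_gt0//.
  move: x2; move: (xSC _ _) => x x2.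
  have := sqr_ge0 (`|x| - 1); rewrite sqrrB1 real_normK ?num_real// mulr2n.
  have := sqr_ge0 x; move: (x ^+ 2) (`|x|) x2 Vt => y z; move: (VP t om) => V; lra.
apply: (le_trans (cosh_shift_le s uB)).
have es : expR `|s| <= expR (norm1 theta / b i j).
  rewrite ler_expR /s normrM (gtr0_norm (x := (b i j)^-1)) ?invr_gt0// ler_pM2r ?invr_gt0//.
  exact: xSC_norm1_le.
apply: lerD => //.
have -> : expR (norm1 theta / b i j) * (1 + expR ((1 + L) / b i j)) / b i j ^+ 2 * VP t om =
   expR (norm1 theta / b i j) * (1 + expR ((1 + L) / b i j)) * (VP t om / b i j ^+ 2) by ring.
have e0 : 0 <= 1 + expR ((1 + L) / b i j) by rewrite addr_ge0 ?expR_ge0.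
apply: ler_pM; [by rewrite mulr_ge0 ?expR_ge0|exact: sqr_ge0|by apply: ler_wpM2r|].
by rewrite /u exprMn exprVn ler_pM2r ?invr_gt0 ?exprn_gt0.
Qed.

(** The three contributions are the leading sum, the excess, controlled by the weighted sum of V,
    and the martingale deviation. The deviation has order sqrt(ln k) k^((1 - nu) / 2), and h <= 1 -
    nu / 2 makes this at most sqrt(ln k) k^g. *)
Lemma data_rate_sharp i j : 0 < a i j -> nu i j < 1 -> h <= 1 - nu i j / 2 ->
  (forall K L : nat, {ae mu, forall om, (forall k, Ev K%:R (fun=> L%:R) k om) ->
     exists (m0 : nat) (M : R), (0 < m0)%N /\
       forall l, \sum_(m0 <= k < l) k%:R `^ (h - 1 / 2 - 1) * VP k om <= M}) ->
  {ae mu, forall om, exists M : R, forall k, (2 <= k)%N ->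
     BSC a H theta th0 nu b alpha beta (fun i' k' => W i' k' om) (fun i' k' => D i' k' om) i j k
     <= expR (norm1 theta / b i j) / ((1 - nu i j) * k%:R `^ nu i j)
        + M * (Num.sqrt (ln k%:R) / k%:R `^ (h - 1 / 2 + nu i j))}.
Proof.
move=> aij nu1 hnu HS; have [nu0 _] := Hnu aij; have [b0 _] := Hb aij.
have n1 : 0 < 1 - nu i j by rewrite subr_gt0.
have HZ := ae_foralln (fun K : nat => ae_foralln (fun L : nat =>
  @zeta_sum_bound K%:R L%:R (fun=> L%:R) i j (fun=> lexx _) aij nu1)).
have {}HS := ae_foralln (fun K : nat => ae_foralln (HS K)).
have HZS : {ae mu, forall om, forall K L : nat, (forall k, Ev K%:R (fun=> L%:R) k om) ->
   (exists M : R, 0 <= M /\ forall l, (2 <= l)%N ->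
    \sum_(0 <= t < l) zetaP i j t om <=
    \sum_(0 <= t < l) pP i j t om + M * Num.sqrt (ln l%:R * l%:R `^ (1 - nu i j))) /\
   (exists (m0 : nat) (M : R), (0 < m0)%N /\
       forall l, \sum_(m0 <= k < l) k%:R `^ (h - 1 / 2 - 1) * VP k om <= M)}.
  move: HZ HS; apply: filterS2 => om H1 H2 K L Eom; split; [exact: H1|exact: H2].
move: Ev_exhaust HZS; apply: filterS2 => om [K [L Eom]] /(_ K L Eom) [[M0 [M00 HM0]] [m0 [M1 [m00 HM1]]]].
set A := expR (norm1 theta / b i j).
set Cp := A * (1 + expR ((1 + L%:R) / b i j)) / b i j ^+ 2.
have Cp0 : 0 <= Cp.
  apply: divr_ge0; last exact: sqr_ge0.
  by apply: mulr_ge0; [exact: expR_ge0|rewrite addr_ge0 ?expR_ge0].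
(* The exponent turning the weight into the decay of the sending probability: t^(-nu) = t^(h - 3/2)
   t^g. As g >= 0, the factor t^g is at most l^g and leaves the sum. *)
pose g := 1 - (h - 1 / 2) - nu i j.
have g0 : 0 <= g by rewrite /g; move: hnu nu1; lra.
pose B0 := \sum_(0 <= t < m0) VP t om.
have B00 : 0 <= B0 by apply: sumr_ge0 => t _; exact: VP_ge0.
have M10 : 0 <= M1 by have := HM1 0%N; rewrite big_geq.
have Vsum l : (1 <= l)%N -> \sum_(0 <= t < l) VP t om * t.+1%:R `^ (- nu i j) <= (B0 + M1) * l%:R `^ g.
  move=> l1; have lp : 1 <= l%:R :> R by rewrite ler1n.
  have lg : 1 <= l%:R `^ g by rewrite -[leLHS](powRr0 l%:R); exact: ler_powR.
  have f0 t : 0 <= VP t om * t.+1%:R `^ (- nu i j) by rewrite mulr_ge0 ?VP_ge0 ?powR_ge0.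
  have p1 : \sum_(0 <= t < m0) VP t om * t.+1%:R `^ (- nu i j) <= B0 * l%:R `^ g.
    rewrite mulr_suml; apply: ler_sum => t _; apply: ler_wpM2l; first exact: VP_ge0.
    by apply: le_trans lg; exact: powRN_le1.
  have p2 : \sum_(m0 <= t < l) VP t om * t.+1%:R `^ (- nu i j) <= M1 * l%:R `^ g.
    apply: le_trans (ler_wpM2r (powR_ge0 _ _) (HM1 l)); rewrite mulr_suml.
    apply: ler_sum_nat => t /andP[mt tl].
    rewrite -mulrA mulrCA; apply: ler_wpM2l; first exact: VP_ge0.
    have t0 : 0 < t%:R :> R by rewrite ltr0n; exact: leq_trans mt.
    have t1 : 0 < t.+1%:R :> R by rewrite ltr0n.
    apply: (@le_trans _ _ (t%:R `^ (- nu i j))).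
      rewrite !powRN lef_pV2 ?posrE ?powR_gt0//.
      by apply: ge0_ler_powR; rewrite ?nnegrE// ler_nat.
    have -> : - nu i j = (h - 1 / 2 - 1) + g by rewrite /g; field.
    rewrite powRD_gt0//; apply: ler_wpM2l; first exact: powR_ge0.
    by apply: ge0_ler_powR; rewrite ?nnegrE// ler_nat ltnW.
  apply: (@le_trans _ _ (\sum_(0 <= t < maxn l m0) VP t om * t.+1%:R `^ (- nu i j))).
    by apply: sum_nat_widen => //; rewrite leq_maxl.
  rewrite (big_cat_nat (n := m0)) ?leq_maxr//= mulrDl; apply: lerD => //.
  by have [lm|ml] := leqP l m0; [rewrite big_geq// mulr_ge0 ?powR_ge0|].
have psum l : (1 <= l)%N -> \sum_(0 <= t < l) pP i j t om <=
    A * (l%:R `^ (1 - nu i j) / (1 - nu i j)) + Cp * ((B0 + M1) * l%:R `^ g).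
  move=> l1; have nu01 : 0 <= nu i j < 1 by rewrite nu0.
  apply: le_trans (lerD (ler_wpM2l (expR_ge0 _) (sum_powRN_le l nu01)) (ler_wpM2l Cp0 (Vsum l l1))).
  rewrite big_add1/= !mulr_sumr -big_split/=; apply: ler_sum => t _.
  apply: (le_trans (Ev_pP_sharp aij (Eom t))).
  by rewrite mulrDl -/A -/Cp -mulrA.
have ln2 : 0 < ln (2 : R) by rewrite ln_gt0// ltr1n.
pose s2 := Num.sqrt (ln (2 : R)); have s20 : 0 < s2 by rewrite sqrtr_gt0.
exists (Cp * (B0 + M1) / s2 + M0) => k k2.
have k1 : (1 <= k)%N by exact: ltnW.
have kp : 0 < k%:R :> R by rewrite ltr0n.
have kR1 : 1 <= k%:R :> R by rewrite ler1n.
rewrite BSC_zetaP mulrC ler_pdivrMr//; apply: (le_trans (HM0 k k2)).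
apply: (le_trans (lerD (psum k k1) (lexx _))); rewrite -addrA [leRHS]mulrDl; apply: lerD.
  rewrite powRD_gt0// powRr1 ?(ltW kp)// powRN le_eqVlt; apply/orP; left; apply/eqP.
  by field; rewrite !gt_eqF// ?powR_gt0.
have sk : s2 <= Num.sqrt (ln k%:R) by rewrite ler_wsqrtr// ler_ln ?posrE// ler_nat.
have kg : k%:R `^ g = k%:R / k%:R `^ (h - 1 / 2 + nu i j).
  by rewrite -powRN -{2}[k%:R]powRr1 ?(ltW kp)// -powRD_gt0//; congr (_ `^ _); rewrite /g; ring.
rewrite [X in _ <= X * _]mulrDl [leRHS]mulrDl; apply: lerD.
  rewrite kg; set q := _ / _.
  have q0 : 0 <= q by rewrite divr_ge0 ?powR_ge0// ltW.
  have -> : Cp * (B0 + M1) / s2 * (Num.sqrt (ln k%:R) / k%:R `^ (h - 1 / 2 + nu i j)) * k%:R =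
     Cp * ((B0 + M1) * q) * (Num.sqrt (ln k%:R) / s2) by rewrite /q; ring.
  apply: ler_peMr; first by apply: mulr_ge0 => //; apply: mulr_ge0 => //; rewrite addr_ge0.
  by rewrite ler_pdivlMr// mul1r.
rewrite -mulrA; apply: ler_wpM2l => //.
rewrite sqrtrM ?ln_ge0// -mulrA; apply: ler_wpM2l; first exact: sqrtr_ge0.
rewrite mulrC -kg -powR12_sqrt ?powR_ge0// -powRrM; apply: ler_powR => //.
by rewrite /g; move: hnu; lra.
Qed.

End Polynomial.
End SC.

(** * Minima over edges and the final choice of constants *)

Section Constants.
Variable R : realType.

Lemma bigmin_attained (I : finType) (P : pred I) (f : I -> \bar R) :
  let x := \big[Order.min/+oo%E]_(i | P i) f i in x = +oo%E \/ exists2 i, P i & x = f i.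
Proof.
apply: (big_ind (fun x => x = +oo%E \/ exists2 i, P i & x = f i)); [by left| |by move=> i Pi; right; exists i].
by move=> x y Hx Hy; rewrite /Order.min; case: ifP.
Qed.

(** The constants of the statement are real parts of minima with default +oo; a nonempty index set
    makes the minimum finite and attained. *)
Lemma fine_bigmin (I : finType) (P : pred I) (f : I -> R) i0 : P i0 ->
  let x := fine (\big[Order.min/+oo%E]_(i | P i) (f i)%:E) in
  (exists2 i, P i & x = f i) /\ forall i, P i -> x <= f i.
Proof.
move=> Pi0 x.
have le i : P i -> (\big[Order.min/+oo%E]_(i | P i) (f i)%:E <= (f i)%:E)%E.
  by move=> Pi; exact: bigmin_le_cond.
have [xoo|[i Pi xi]] := bigmin_attained P (fun i => (f i)%:E).
  by have := le i0 Pi0; rewrite xoo.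
split; first by exists i => //; rewrite /x xi.
by move=> l /le; rewrite /x xi lee_fin.
Qed.

Lemma fine_bigmin2 (I J : finType) (P : I -> pred J) (f : I -> J -> R) i0 j0 : P i0 j0 ->
  let x := fine (\big[Order.min/+oo%E]_i \big[Order.min/+oo%E]_(j | P i j) (f i j)%:E) in
  (exists i j, P i j /\ x = f i j) /\ forall i j, P i j -> x <= f i j.
Proof.
move=> P0 x.
have le i j : P i j -> (\big[Order.min/+oo%E]_i \big[Order.min/+oo%E]_(j | P i j) (f i j)%:E <= (f i j)%:E)%E.
  move=> Pij; apply: (le_trans (bigmin_le _ i _)); exact: bigmin_le_cond.
have [xoo|[i _ xi]] := bigmin_attained predT (fun i => \big[Order.min/+oo%E]_(j | P i j) (f i j)%:E).
  by have := le i0 j0 P0; rewrite xoo.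
have [yoo|[j Pij yj]] := bigmin_attained (P i) (fun j => (f i j)%:E).
  by have := le i0 j0 P0; rewrite xi yoo.
split; first by exists i, j; rewrite /x xi yj.
by move=> k l /le; rewrite /x xi yj lee_fin.
Qed.

End Constants.

Theorem theorem5p1
  (R : realType) (disp : measure_display) (T : measurableType disp)
  (mu : probability T R)
  (* network *)
  (N : nat) (a : 'I_N -> 'I_N -> R)
  (Ha_nonneg : forall i j, 0 <= a i j)
  (Ha_sym : forall i j, a i j = a j i)
  (Ha_loop : forall i, a i i = 0)
  (* observation model *)
  (n : nat) (theta : 'cV[R]_n) (m : 'I_N -> nat)
  (H : forall i : 'I_N, nat -> 'M[R]_(m i, n))
  (W : forall i : 'I_N, nat -> T -> 'cV[R]_(m i))
  (D : 'I_N -> nat -> T -> R)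
  (* (A1) *)
  (Hbar : R) (p : nat) (delta : R)
  (HA1_Hbar : 0 < Hbar)
  (HA1_norm : forall i k, (1 <= k)%N -> opnorm_le (H i k) Hbar)
  (HA1_p : (0 < p)%N) (HA1_delta : 0 < delta)
  (HA1_pe : forall k, (1 <= k)%N ->
     loewner_ge_scalar
       (p%:R^-1 *: \sum_(k <= t < k + p) \sum_(i < N) ((H i t)^T *m H i t)) delta)
  (* (A2) *)
  (HW_meas : forall i k (r : 'I_(m i)), measurable_fun setT (fun om => W i k om r 0))
  (HA2_mds : forall i k (r : 'I_(m i)), (1 <= k)%N ->
     cond_exp_zero mu (filtF W D k.-1) (fun om => W i k om r 0))
  (HA2_mom : exists rho : R, 2 < rho /\
     exists Y : 'I_N -> nat -> T -> R,
       (forall i k, (1 <= k)%N ->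
          is_cond_exp_nonneg mu (filtFw W k.-1)
            (fun om => vnorm (W i k om) `^ rho) (Y i k)) /\
       {ae mu, forall om, exists M : R, forall i k, (1 <= k)%N -> Y i k om <= M})
  (* (A3) *)
  (HA3 : \rank (laplacian a) = N.-1)
  (* (A4) *)
  (HD_meas : forall i k, measurable_fun setT (D i k))
  (HA4_lap : forall i k (x : R), (1 <= k)%N ->
     mu [set om | D i k om <= x] = (laplace_cdf x)%:E)
  (HA4_indep : mutually_independent mu
     (fun o : option ('I_N * nat) =>
        match o with
        | None => sigmaWall W
        | Some (i, k) => sigma_of [set D i k.+1]
        end))
  (* algorithm parameters *)
  (th0 : 'I_N -> 'cV[R]_n) (nu b : 'I_N -> 'I_N -> R)
  (alpha : 'I_N -> 'I_N -> nat -> R) (beta : 'I_N -> nat -> R)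
  (Hnu : forall i j, 0 < a i j -> 0 <= nu i j /\ nu i j = nu j i)
  (Hb : forall i j, 0 < a i j -> 0 < b i j /\ b i j = b j i)
  (Halpha : forall i j k, 0 < a i j -> (1 <= k)%N ->
     0 < alpha i j k /\ alpha i j k = alpha j i k)
  (Hbeta : forall i k, (1 <= k)%N -> 0 < beta i k)
  (* step-size conditions (i)-(iii) *)
  (Hi : forall i j, 0 < a i j ->
     (\sum_(1 <= k <oo) ((alpha i j k) ^+ 2)%:E < +oo)%E /\
     exists M : R, forall k, (1 <= k)%N -> alpha i j k.+1 / alpha i j k <= M)
  (Hii : forall i,
     (\sum_(1 <= k <oo) ((beta i k) ^+ 2)%:E < +oo)%E /\
     exists M : R, forall k, (1 <= k)%N -> beta i k.+1 / beta i k <= M)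
  (Hiii : (\sum_(1 <= k <oo) zSC a nu alpha beta k = +oo)%E) :
  (* B_ij(k) = O(k^{-nu_ij}) a.s. *)
  (forall i j, 0 < a i j ->
     {ae mu, forall om, exists M : R, forall k, (1 <= k)%N ->
        `| BSC a H theta th0 nu b alpha beta
             (fun i' k' => W i' k' om) (fun i' k' => D i' k' om) i j k |
        <= M * (k%:R `^ (- nu i j))}) /\
  (* nu_ij = 0 => B_ij(k) = 1 for all k a.s. *)
  (forall i j, 0 < a i j -> nu i j = 0 ->
     {ae mu, forall om, forall k, (1 <= k)%N ->
        BSC a H theta th0 nu b alpha beta
          (fun i' k' => W i' k' om) (fun i' k' => D i' k' om) i j k = 1}) /\
  (* polynomial step sizes *)
  (forall gamma : 'I_N -> 'I_N -> R,
     (forall i j, 0 < a i j ->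
        [/\ gamma i j = gamma j i, 1 / 2 < gamma i j, gamma i j <= 1,
            nu i j + gamma i j <= 1 &
            forall k, (1 <= k)%N -> alpha i j k = alpha i j 1%N / (k%:R `^ gamma i j)]) ->
     (forall i k, (1 <= k)%N -> beta i k = beta i 1%N / k%:R) ->
     aSC a nu b gamma alpha beta theta delta Hbar > hSC a nu gamma - 1 / 2 ->
     forall i j, 0 < a i j -> 0 < nu i j ->
     {ae mu, forall om, exists M : R, forall k, (2 <= k)%N ->
        BSC a H theta th0 nu b alpha beta
          (fun i' k' => W i' k' om) (fun i' k' => D i' k' om) i j k
        <= expR (norm1 theta / b i j) / ((1 - nu i j) * k%:R `^ nu i j)
           + M * (Num.sqrt (ln k%:R) / k%:R `^ (hSC a nu gamma - 1 / 2 + nu i j))}).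
Proof.
have [rho [rho2 [Y [Y_cond Y_bounded]]]] := HA2_mom.
have Hi1 i j (aij : 0 < a i j) := (Hi i j aij).1.
have Hii1 i := (Hii i).1.
have nu1 i j : 0 < a i j -> nu i j < 1 by move=> aij; apply: (nu_lt1 Halpha Hbeta Hi1 Hiii).
split; last split.
- by move=> i j aij; apply: (data_rate_O Ha_nonneg Ha_sym theta HA1_Hbar HA1_norm HW_meas HA2_mds rho2 Y_cond
    HD_meas HA4_lap HA4_indep _ Hnu Hb Halpha Hbeta Hi1 Hii1 Y_bounded aij (nu1 i j aij)).
- by move=> i j aij nu0; apply: (data_rate_one Ha_sym theta H HW_meas HD_meas HA4_lap HA4_indep th0 alpha beta Hnu Hb aij nu0).
move=> gamma Hg Hbp ha i j aij nu0.
set h := hSC a nu gamma in ha *.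
have [[i1 [j1 [a1 hE]]] h_le] := fine_bigmin2 (P := fun i j => 0 < a i j)
  (fun i j => nu i j / 2 + gamma i j) aij.
have {h_le} h_le : forall i j, 0 < a i j -> h <= nu i j / 2 + gamma i j := h_le.
have {hE} hE : h = nu i1 j1 / 2 + gamma i1 j1 := hE.
have h_half : 1 / 2 < h.
  by rewrite hE; have [_ g1 _ _ _] := Hg _ _ a1; have [n1 _] := Hnu _ _ a1; lra.
have nugamma i' j' : 0 < a i' j' -> nu i' j' + gamma i' j' <= 1 by move=> /Hg[].
have alpha_poly i' j' k : 0 < a i' j' -> (1 <= k)%N ->
    alpha i' j' k = alpha i' j' 1%N / (k%:R `^ gamma i' j').
  by move=> /Hg[_ _ _ _ +]; apply.
have hnu : h <= 1 - nu i j / 2 by have := h_le i j aij; have := nugamma i j aij; lra.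
have h_le1 : h <= 1 by apply: (le_trans hnu); lra.
apply: (data_rate_sharp Ha_nonneg Ha_sym HA1_Hbar HA1_norm HW_meas HA2_mds rho2 Y_cond
    HD_meas HA4_lap HA4_indep Hnu Hb Halpha Hbeta Hi1 Hii1 Y_bounded aij (nu1 i j aij) hnu) => K L.
(* In dimension 0 the error vanishes identically, while the coercivity estimate divides by n. *)
have [n0|n0] := posnP n.
  apply: aeW => om _; exists 1%N, 0; split=> // l; rewrite big1// => k _.
  rewrite /VP /vsq big1 ?mulr0// => i' _; rewrite /nsq big1// => r _.
  by exfalso; have := ltn_ord r; rewrite {2}n0.
have N0 : (0 < N)%N by exact: leq_ltn_trans (ltn_ord i).
have [[i2 _ blE] bl_le] := @fine_bigmin R _ xpredT (fun i => beta i 1%N) i isT.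
set bl := fine _ in blE bl_le.
have {}bl_le i' : bl <= beta i' 1%N by exact: bl_le.
have bl0 : 0 < bl by rewrite blE; exact: Hbeta.
have [gm [gm0 l2gm gapm]] := spectral_gap Ha_nonneg Ha_sym HA3.
have NR : 0 < N%:R :> R by rewrite ltr0n.
have nR : 0 < n%:R :> R by rewrite ltr0n.
pose X := 2 * n%:R * Hbar ^+ 2 * bl.
have X0 : 0 < X by rewrite !mulr_gt0// exprn_gt0.
have c0 : 0 < delta * bl / N%:R by rewrite divr_gt0// mulr_gt0.
have K0 : 0 <= K%:R :> R by exact: ler0n.
have L0 : 0 <= L%:R :> R by exact: ler0n.
have summable lam := @error_sum_bounded R disp T mu N a Ha_nonneg Ha_sym n theta m H W D Hbar
  HA1_Hbar HA1_norm HW_meas HA2_mds rho Y rho2 Y_cond HD_meas HA4_lap HA4_indep th0 nu b alpha beta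
  Hnu Hb Halpha Hbeta gamma h alpha_poly Hbp nugamma h_le h_half h_le1 p delta HA1_p HA1_delta HA1_pe
  bl lam bl0 bl_le.
move: ha; rewrite /aSC -/bl; case: ifPn => [/existsP[i3 /existsP[j3 E3]]|noE] ha.
  have [[i4 [j4 [E4 mpE]]] mp_le] := fine_bigmin2 (P := EprimeSC a nu gamma)
    (fun i j => alpha i j 1%N * expR (- norm1 theta / b i j) / b i j) E3.
  set mp := fine _ in mpE mp_le; rewrite -/(mprimeSC a nu b gamma alpha theta) in ha.
  have mp0 : 0 < mp.
    have /andP[a4 _] := E4; have [b4 _] := Hb _ _ a4; have [al4 _] := Halpha _ _ 1%N a4 isT.
    by rewrite mpE; apply: divr_gt0 => //; apply: mulr_gt0 => //; exact: expR_gt0.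
  set l2 := lambda2 _ in ha l2gm.
  (* If [lambda2] were 0, possibly through its default value, then a = 0, against a > h - 1/2 >
     0. *)
  have l20 : 0 < l2.
    rewrite lt_neqAle lambda2_ge0// andbT; apply/eqP => l2z; move: ha.
    by rewrite -l2z mulr0 !mul0r; move: h_half; lra.
  have gap2 x : \sum_i x i = 0 -> 2 * l2 * \sum_i x i ^+ 2 <= \sum_i \sum_j a i j * (x i - x j) ^+ 2.
    move=> sx; apply: le_trans (gapm x sx); apply: ler_wpM2r; last by rewrite ler_pM2l.
    by apply: sumr_ge0 => i' _; exact: sqr_ge0.
  (* The slope constant is m' / 2: the factor 2 in [coer_rate] restores m' in the numerator, and the
     denominator X + l2 m' / 2 is below the one in a, so the rate is at least a. *)
  have mp20 : 0 < mp / 2 by rewrite divr_gt0.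
  apply: (summable l2 l20 gap2 N0 n0 (mp / 2) K%:R L%:R mp20 K0 L0).
    apply: (lt_le_trans ha); rewrite /coer_rate -/X.
    have y0 : 0 < l2 * mp by rewrite mulr_gt0.
    have -> : delta * l2 * bl * mp / (2 * N%:R * n%:R * Hbar ^+ 2 * bl + N%:R * l2 * mp) =
       delta * bl / N%:R * (l2 * mp / (X + l2 * mp)).
      have -> : 2 * N%:R * n%:R * Hbar ^+ 2 * bl + N%:R * l2 * mp = N%:R * (X + l2 * mp) by rewrite /X; ring.
      have := addr_gt0 X0 y0; move: (X + l2 * mp) => z z0.
      by field; rewrite !gt_eqF.
    have -> : 2 * (delta * bl / N%:R * (l2 * (mp / 2) / (X + l2 * (mp / 2)))) =
       delta * bl / N%:R * (l2 * mp / (X + l2 * (mp / 2))).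
      have := addr_gt0 X0 (mulr_gt0 l20 mp20); move: (X + l2 * (mp / 2)) => z z0.
      by field; rewrite !gt_eqF.
    rewrite ler_pM2l// ler_pM2l// lef_pV2 ?posrE ?addr_gt0 ?mulr_gt0// lerD2l mulrA.
    by move: y0; lra.
  move=> i' j' aij'; have := nugamma i' j' aij'; rewrite le_eqVlt => /orP[e|]; last by left.
  right; have -> : 2 * (mp / 2) = mp by field.
  have := mp_le i' j'; rewrite /EprimeSC aij' e mulNr; exact.
have edge_lt i' j' : 0 < a i' j' -> nu i' j' + gamma i' j' < 1.
  move=> aij'; rewrite lt_neqAle nugamma// andbT; apply: contra noE => e.
  by apply/existsP; exists i'; apply/existsP; exists j'; rewrite /EprimeSC aij'.
(* Without critical edges ms is free. The choice gm ms = X makes the ratio in [coer_rate] equal to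
   1/2 and the rate exactly delta bl / N = a. *)
have ms0 : 0 < X / gm by rewrite divr_gt0.
apply: (summable gm gm0 gapm N0 n0 (X / gm) K%:R L%:R ms0 K0 L0).
  apply: (lt_le_trans ha); rewrite /coer_rate -/X.
  have -> : gm * (X / gm) = X by field; rewrite gt_eqF.
  have -> : X / (X + X) = 2^-1 by field; rewrite gt_eqF// addr_gt0.
  by rewrite [leRHS]mulrCA mulfV ?mulr1// pnatr_eq0.
by move=> i' j' aij'; left; exact: edge_lt.
Qed.
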